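(* Let $\mathbb K=\mathbb R$ (resp. $\mathbb K=\mathbb C$), let $f=(f^1,\dots,f^p):\mathbb K^n\to\mathbb K^p$ be a real polynomial map (resp. mixed polynomial map), and let $F:\mathbb K^n\times\mathbb K\to\mathbb K^p$ be a deformation of $f$. Assume: (i) $f$ is SWH (resp. SRWH) of weight-type $(w;\mathbf d)=(w_1,\dots,w_n;d_1,\dots,d_p)$; (ii) for each $j=1,\dots,p$ and each $\varepsilon\in\mathbb K$, $d(w;F^j_\varepsilon-f^j)\ge d_j$. Then $F$ is link-constant along some neighborhood $T\subset\mathbb K$ of the origin. If the inequalities in (ii) are all strict, then $F$ is link-constant. Furthermore, if $\Sigma(f_w)=\{0\}$, then $F$ is also topologically trivial along the respective set ($T$, or $\mathbb K$ in the strict case).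
   Context: Notation. A real polynomial map $f:\mathbb R^n\to\mathbb R^p$ has real polynomial components and $f(0)=0$. A mixed polynomial map $f:\mathbb C^n\to\mathbb C^p$ has components that are finite sums $\sum c_{\nu,\mu}x^\nu\bar x^\mu$, $c_{\nu,\mu}\in\mathbb C$, and $f(0)=0$. For a component $g$, $\mathrm{supp}(g)=\{\nu: c_\nu\ne0\}$ in the real case and $\mathrm{supp}(g)=\{\nu+\mu: c_{\nu,\mu}\neq0\}$ in the mixed case. For $w\in(\mathbb Q_{>0})^n$, $d(w;g)=\min\{\langle w,\nu\rangle:\nu\in\mathrm{supp}(g)\}$ ($+\infty$ if $g=0$), and $g_w$ is the sum of the terms of $g$ whose exponent $\nu$ (resp. $\nu+\mu$) attains this minimum; $f_w=(f^1_w,\dots,f^p_w)$. $V(f)=f^{-1}(0)$; $\Sigma(f)$ is the set of points where the real Jacobian matrix of $f$ has rank $<p$ if $\mathbb K=\mathbb R$, and rank $<2p$ if $\mathbb K=\mathbb C$ (identifying $\mathbb C=\mathbb R^2$). Weighted homogeneity. A real (resp. mixed) polynomial map $f:\mathbb K^n\to\mathbb K^p$, $n\ge p$, is weighted homogeneous, WH (resp. radially weighted homogeneous, RWH), of weight-type $(w;\mathbf d)$, $w_i,d_j\in\mathbb Q_{>0}$, if $f^j(\lambda^{w_1}x_1,\dots,\lambda^{w_n}x_n)=\lambda^{d_j}f^j(x)$ for all real $\lambda>0$ and all $j$. A real (resp. mixed) polynomial map $f$ is semi-weighted homogeneous, SWH (resp. semi-radially weighted homogeneous, SRWH), of weight-type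 $(w;\mathbf d)$ if $f_w$ is WH (resp. RWH) of weight-type $(w;\mathbf d)$, $\Sigma(f_w)\cap V(f_w)=\{0\}$, and $d(w;f^j-f^j_w)>d_j$ for each $j$. Deformations. A deformation of $f$ is a map $F:\mathbb K^n\times\mathbb K\to\mathbb K^p$, $F_\varepsilon(x)=F(x,\varepsilon)$, with $F_0=f$, $F_\varepsilon(0)=0$ for all $\varepsilon$, each $F_\varepsilon$ being a real (resp. mixed) polynomial map with coefficients depending real-analytically on $\varepsilon$. Link-constancy and topological triviality. If $\Sigma(g)\cap V(g)\subseteq\{0\}$ near $0$, the link $L_g=V(g)\cap\mathbb S_r$ ($\mathbb S_r$ the sphere of radius $r$ centred at $0$) is smooth and, up to ambient isotopy, independent of small $r>0$ (Milnor); $g$ then has a well-defined link. Let $T\subset\mathbb K$ be connected, $0\in T$. $F$ is link-constant along $T$ if every $F_\varepsilon$, $\varepsilon\in T$, has a well-defined link and $L_{F_\varepsilon}$ is ambient isotopic to $L_{F_0}$ in the sphere, i.e. (for small radius $\epsilon$ at which both links are defined) there is a continuous $H:\mathbb S_\epsilon\times[0,1]\to\mathbb S_\epsilon$ with each $H_t$ a homeomorphism, $H_0=\mathrm{id}$, $H_1(L_{F_0})=L_{F_\varepsilon}$. $F$ is topologically trivial along $T$ if there is a continuous family of homeomorphism germs $h_\varepsilon:(\mathbb K^n,0)\to(\mathbb K^n,0)$ with $F_0=F_\varepsilon\circ h_\varepsilon$ for all $\varepsilon\in T$. If $T=\mathbb K$, one says simply link-constant, topologically trivial. *)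

(* Defs.v *)
From HB Require Import structures.
From mathcomp Require Import all_boot all_order all_algebra.
From mathcomp Require Import all_classical all_reals all_analysis.
From mathcomp Require Import complex.
(* The notations of mpoly clash with those of analysis. *)
From mathcomp Require Import -(notations) mpoly.
Set Implicit Arguments.
Unset Strict Implicit.
Unset Printing Implicit Defensive.
Import Order.TTheory GRing.Theory Num.Theory.
Import numFieldNormedType.Exports.
Local Open Scope classical_set_scope.
Local Open Scope ring_scope.
Local Open Scope complex_scope.

Section Weights.

Definition wdot n (w : 'I_n -> rat) (nu : multinom n) : rat :=
  \sum_i w i * (nu i)%:R.

(* A monomial of a polynomial in [m] variables is given an exponent in N^n by
   [expo]: the identity (m = n) for real polynomials, (nu, mu) |-> nu + mu
   (m = n + n) for mixed ones. *)
Variables (K : nzRingType) (m n : nat) (expo : multinom m -> multinom n).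
Variable w : 'I_n -> rat.

Definition supp (g : mpoly m K) : seq (multinom n) :=
  [seq expo a | a <- msupp g].

Definition wdeg (g : mpoly m K) : \bar rat :=
  \big[Order.min/+oo%E]_(nu <- supp g) (wdot w nu)%:E.

Definition winit (g : mpoly m K) : mpoly m K :=
  \sum_(a <- msupp g | (wdot w (expo a))%:E == wdeg g)
    mcoeff a g *: mpolyX K a.

End Weights.

Definition mixed_expo n (a : multinom (n + n)) : multinom n :=
  Multinom [tuple (a (lshift n i) + a (rshift n i))%N | i < n].

Notation real_wdeg := (wdeg id).
Notation real_winit := (winit id).
Notation mixed_wdeg := (wdeg (@mixed_expo _)).
Notation mixed_winit := (winit (@mixed_expo _)).

Section RealAnalytic.
Variables (R : realType) (k : nat).

Definition monom (a : multinom k) (x : 'rV[R]_k) : R :=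
  \prod_i x 0 i ^+ a i.

(* [bmultinom k N] is the finite type of exponents of degree < N. *)
Definition real_analytic (u : 'rV[R]_k -> R) : Prop :=
  forall a : 'rV[R]_k, exists c : multinom k -> R, \forall x \near a,
    cvg ((fun N => \sum_(m : bmultinom k N)
            `|c m * monom m (x - a)|) @ \oo) /\
    (fun N => \sum_(m : bmultinom k N)
       c m * monom m (x - a)) @ \oo --> u x.

End RealAnalytic.

Section RealMaps.
Variables (R : realType) (N P : nat).
Implicit Type g : 'rV[R]_N -> 'rV[R]_P.

Definition zero_set g : set 'rV[R]_N := g @^-1` [set 0].

Definition sing_set g : set 'rV[R]_N := [set x | (\rank ('J g x) < P)%N].

(* Euclidean sphere: the norm of 'rV[R]_N is the sup norm. *)
Definition esphere (r : R) : set 'rV[R]_N :=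
  [set x | \sum_i x 0 i ^+ 2 = r ^+ 2].

Definition link g (r : R) : set 'rV[R]_N := zero_set g `&` esphere r.

Definition has_link g : Prop :=
  \forall x \near (0 : 'rV[R]_N), (sing_set g `&` zero_set g) x -> x = 0.

End RealMaps.

Definition homeo_on (X Y : topologicalType) (A : set X) (B : set Y)
    (h : X -> Y) : Prop :=
  {within A, continuous h} /\
  exists k : Y -> X,
    [/\ {within B, continuous k},
        (forall x, A x -> B (h x) /\ k (h x) = x) &
        (forall y, B y -> A (k y) /\ h (k y) = y)].

Definition ambient_isotopic (R : realType) (X : topologicalType)
    (S A B : set X) : Prop :=
  exists H : X -> R -> X,
    [/\ {within S `*` [set t : R | 0 <= t <= 1],
           continuous (fun z : X * R => H z.1 z.2)},
        (forall t : R, 0 <= t <= 1 -> homeo_on S S (H ^~ t)),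
        (forall x, S x -> H x 0 = x) &
        [set H x 1 | x in A] = B].

Section Families.
Variables (R : realType) (N P : nat) (E : topologicalType) (e0 : E).
Variable G : E -> 'rV[R]_N -> 'rV[R]_P.

Definition link_constant (T : set E) : Prop :=
  forall e, T e -> has_link (G e) /\
    exists2 r0 : R, 0 < r0 & forall r : R, 0 < r < r0 ->
      ambient_isotopic R (@esphere R N r) (link (G e0) r) (link (G e) r).

(* The germs are represented on the slices of an open set [W] containing
   T x {0}; the size of the slices may depend on the parameter. *)
Definition topologically_trivial (T : set E) : Prop :=
  exists (W : set (E * 'rV[R]_N)) (h : E -> 'rV[R]_N -> 'rV[R]_N),
    [/\ open W,
        (forall e, T e -> W (e, 0)),
        {within W `&` (T `*` setT),
           continuous (fun z : E * 'rV[R]_N => h z.1 z.2)} &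
        forall e, T e ->
          [/\ h e 0 = 0,
              (exists2 U : set 'rV[R]_N, open U &
                 homeo_on [set x | W (e, x)] U (h e)) &
              (forall x, W (e, x) -> G e0 x = G e (h e x))]].

End Families.

Section RealPolynomialMaps.
Variables (R : realType) (n p : nat).
Implicit Types (f : 'I_p -> mpoly n R) (w : 'I_n -> rat) (d : 'I_p -> rat).

Definition real_map f (x : 'rV[R]_n) : 'rV[R]_p :=
  \row_j meval (fun i => x 0 i) (f j).

Definition WH w d f : Prop :=
  [/\ (p <= n)%N, (forall i, 0 < w i), (forall j, 0 < d j) &
      forall (l : R) (x : 'rV[R]_n) (j : 'I_p), 0 < l ->
        real_map f (\row_i (l `^ ratr (w i) * x 0 i)) 0 j =
        l `^ ratr (d j) * real_map f x 0 j].

Definition SWH w d f : Prop :=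
  let fw := fun j => real_winit w (f j) in
  [/\ WH w d fw,
      sing_set (real_map fw) `&` zero_set (real_map fw) = [set 0] &
      forall j, ((d j)%:E < real_wdeg w (f j - fw j)%R)%E].

Definition real_deformation f (F : R -> 'I_p -> mpoly n R) : Prop :=
  [/\ F 0 = f,
      (forall e, real_map (F e) 0 = 0) &
      forall j a,
        real_analytic (fun e : 'rV[R]_1 => mcoeff a (F (e 0 0) j))].

End RealPolynomialMaps.

Section Realification.
Variable R : realType.

Definition cplx_row n (x : 'rV[R]_(n + n)) : 'rV[R[i]]_n :=
  \row_i (x 0 (lshift n i) +i* x 0 (rshift n i)).

Definition real_row n (z : 'rV[R[i]]_n) : 'rV[R]_(n + n) :=
  row_mx (\row_i complex.Re (z 0 i)) (\row_i complex.Im (z 0 i)).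

End Realification.

Section MixedPolynomialMaps.
Variables (R : realType) (n p : nat).
Implicit Types (f : 'I_p -> mpoly (n + n) R[i]).
Implicit Types (w : 'I_n -> rat) (d : 'I_p -> rat).

(* The last [n] variables stand for the conjugates of the first [n]. *)
Definition mixed_map f (z : 'rV[R[i]]_n) : 'rV[R[i]]_p :=
  \row_j meval
    (fun i => match fintype.split i with
              | inl k => z 0 k
              | inr k => (z 0 k)^*
              end) (f j).

Definition mixed_real_map f (x : 'rV[R]_(n + n)) : 'rV[R]_(p + p) :=
  real_row (mixed_map f (cplx_row x)).

Definition RWH w d f : Prop :=
  [/\ (p <= n)%N, (forall i, 0 < w i), (forall j, 0 < d j) &
      forall (l : R) (z : 'rV[R[i]]_n) (j : 'I_p), 0 < l ->
        mixed_map f (\row_i ((l `^ ratr (w i))%:C * z 0 i)) 0 j =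
        (l `^ ratr (d j))%:C * mixed_map f z 0 j].

Definition SRWH w d f : Prop :=
  let fw := fun j => mixed_winit w (f j) in
  [/\ RWH w d fw,
      sing_set (mixed_real_map fw) `&` zero_set (mixed_real_map fw)
        = [set 0] &
      forall j, ((d j)%:E < mixed_wdeg w (f j - fw j)%R)%E].

(* Real-analytic in the real and imaginary parts of the parameter. *)
Definition mixed_deformation f (F : R[i] -> 'I_p -> mpoly (n + n) R[i]) :
    Prop :=
  [/\ F 0 = f,
      (forall e, mixed_map (F e) 0 = 0) &
      forall j a,
        real_analytic (fun e : 'rV[R]_(1 + 1) =>
          complex.Re (mcoeff a (F (cplx_row e 0 0) j))) /\
        real_analytic (fun e : 'rV[R]_(1 + 1) =>
          complex.Im (mcoeff a (F (cplx_row e 0 0) j)))].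

End MixedPolynomialMaps.

(* Main.v *)
Require Import Defs.
From HB Require Import structures.
From mathcomp Require Import all_boot all_order all_algebra.
From mathcomp Require Import all_classical all_reals all_analysis.
From mathcomp Require Import complex.
From mathcomp Require Import -(notations) mpoly.
From mathcomp Require Import ring lra zify.
Set Implicit Arguments.
Unset Strict Implicit.
Unset Printing Implicit Defensive.
Import Order.TTheory GRing.Theory Num.Theory.
Import numFieldNormedType.Exports.
Local Open Scope classical_set_scope.
Local Open Scope ring_scope.


(** The proof avoids the integration of vector fields: all homeomorphisms are
    near-identity maps [x + y *m A x], where [A] is a right inverse of a
    differential and [y] is the solution of a small system, found as the fixed
    point of a contraction.

    Reduction.  With integer weights the initial form [fw] and the remaining
    terms are homogeneous for the dilations [wscale W t].  By Baire's theorem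
    and the identity theorem for analytic functions the degrees of all the
    [F e] are bounded ([analytic_finite_support]), so that the deformation is a
    family [gp fw mm c] with finitely many coefficients [c], continuous in the
    parameter.  A mixed map is a real one in the real coordinates, of the same
    kind.  The dilation by [t] multiplies the coefficient of a term by [t] to
    the power its excess degree.  So near the origin only the terms of excess
    degree zero matter; they vanish at the centre of the deformation, hence are
    small on a ball of parameters, and are absent in the strict case.

    Links.  For small coefficients the variety is transverse to the unit
    weighted sphere, by compactness ([regular_small]), and by dilation the
    varieties of all tame coefficients are transverse to small weighted spheres.
    Moving the coefficients along a segment gives an isotopy within a weighted
    sphere.  It remains to go from round spheres to weighted ones.  The
    hypersurfaces [a * q + b * rho = 1], where [q] and [rho] are the squared
    Euclidean radius and a power of the weighted one, are star-shaped and
    interpolate between the two.  The variety is transverse to them near the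
    origin ([transverse_near0]).  In differential terms this is the absence of
    opposite gradients of [q] and [rho] on the variety, which is usually seen
    with the curve selection lemma.  Here a sequence of bad points is made into
    one generic point by an ultrafilter; derivations of the field generated by
    its coordinates are tangent vectors ([generic_tangent_vector]); the values
    of [q] and [rho] then satisfy an algebraic relation, which defines a plane
    curve with negative slope at points with positive coordinates tending to the
    origin, and such a curve does not exist ([relation_slope_lt0]).  The
    isotopies themselves come from [level_deformation] and the connectedness of
    the unit interval ([isotopy_path]).

    Trivialisation.  If [fw] is a submersion away from the origin, the equation
    [gp s (x + v) = gp t x] has, for small coefficients [s] and [t], a unique
    small solution [v] in the range of an equivariant right inverse of the
    differential of [fw], for [x] in a weighted annulus ([shell_displacement]).
    Uniqueness makes the solution equivariant, so the solutions on all the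
    dilated annuli fit together to a homeomorphism near the origin
    ([triv_scale], [family_trivial]). *)

(** * Derivations along an ultrafilter *)

Section Derivations.
Variables (I : Type) (U : set_system I).
Context {UU : UltraFilter U}.
Variable K : numFieldType.

Definition derivation_over (B : comNzRingType) (ev D : B -> K) : Prop :=
  (forall a b, D (a + b) = D a + D b) /\
  (forall a b, D (a * b) = ev a * D b + D a * ev b).

Section DerivationTheory.
Variables (B : comNzRingType) (ev : {rmorphism B -> K}) (D : B -> K).
Hypothesis dD : derivation_over ev D.

Lemma derivation0 : D 0 = 0.
Proof. by apply: (addrI (D 0)); rewrite -dD.1 !addr0. Qed.

Lemma derivationN a : D (- a) = - D a.
Proof. by apply: (addrI (D a)); rewrite -dD.1 !subrr derivation0. Qed.

Definition poly_ev (x : K) (p : {poly B}) : K :=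
  \sum_(i < size p) ev p`_i * x ^+ i.

Let poly_ev_horner x p :
  poly_ev x p = horner_morph (fun b => mulrC x (ev b)) p.
Proof.
have le : (size (map_poly ev p) <= size p)%N by exact: size_poly.
rewrite /= /horner_morph (horner_coef_wide _ le).
by apply: eq_bigr => i _; rewrite coef_map.
Qed.

Fact poly_ev_is_zmod_morphism x : zmod_morphism (poly_ev x).
Proof. by move=> p q; rewrite !poly_ev_horner rmorphB. Qed.

Fact poly_ev_is_monoid_morphism x : monoid_morphism (poly_ev x).
Proof.
by split=> [|p q]; rewrite !poly_ev_horner ?rmorph1 ?rmorphM.
Qed.

HB.instance Definition _ x :=
  GRing.isZmodMorphism.Build _ _ (poly_ev x) (poly_ev_is_zmod_morphism x).
HB.instance Definition _ x :=
  GRing.isMonoidMorphism.Build _ _ (poly_ev x) (poly_ev_is_monoid_morphism x).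

(** The only derivation over [poly_ev x] that extends [D] and sends ['X] to
    [v]. *)
Definition poly_der (x v : K) (p : {poly B}) : K :=
  (\sum_(i < size p) D p`_i * x ^+ i) + v * poly_ev x p^`().

Lemma poly_ev_C x c : poly_ev x c%:P = ev c.
Proof. by rewrite poly_ev_horner /= /horner_morph map_polyC hornerC. Qed.

Lemma poly_ev_X x : poly_ev x 'X = x.
Proof. by rewrite poly_ev_horner /= /horner_morph map_polyX hornerX. Qed.

Lemma coef_der_wide x p n : (size p <= n)%N ->
  \sum_(i < size p) D p`_i * x ^+ i = \sum_(i < n) D p`_i * x ^+ i.
Proof.
move=> le; rewrite -(subnKC le) big_split_ord /= [X in _ = _ + X]big1 ?addr0 //.
by move=> i _; rewrite nth_default ?leq_addr // derivation0 mul0r.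
Qed.

Lemma poly_derC x v c : poly_der x v c%:P = D c.
Proof.
rewrite /poly_der derivC rmorph0 mulr0 addr0.
rewrite (coef_der_wide x (size_polyC_leq1 c)) big_ord1.
by rewrite coefC /= expr0 mulr1.
Qed.

Lemma poly_derD x v p q :
  poly_der x v (p + q) = poly_der x v p + poly_der x v q.
Proof.
rewrite /poly_der derivD rmorphD mulrDr addrACA; congr (_ + _).
pose n := maxn (size p) (size q).
rewrite (coef_der_wide x (size_polyD p q)) -/n.
rewrite (coef_der_wide x (leq_maxl _ _ : (size p <= n)%N)).
rewrite (coef_der_wide x (leq_maxr _ _ : (size q <= n)%N)) -big_split /=.
by apply: eq_bigr => i _; rewrite coefD dD.1 mulrDl.
Qed.

Lemma poly_derCM x v c p :
  poly_der x v (c%:P * p) = ev c * poly_der x v p + D c * poly_ev x p.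
Proof.
rewrite /poly_der.
have le : (size (c%:P * p)%R <= size p)%N.
  by rewrite mul_polyC size_scale_leq.
rewrite (coef_der_wide x le) derivM derivC mul0r add0r rmorphM /= poly_ev_C.
have -> : \sum_(i < size p) D (c%:P * p)`_i * x ^+ i =
          ev c * (\sum_(i < size p) D p`_i * x ^+ i) + D c * poly_ev x p.
  rewrite !mulr_sumr -big_split /=.
  by apply: eq_bigr => i _; rewrite coefCM dD.2; ring.
by ring.
Qed.

Lemma poly_derMX x v p :
  poly_der x v (p * 'X) = x * poly_der x v p + v * poly_ev x p.
Proof.
rewrite /poly_der.
have le : (size (p * 'X)%R <= (size p).+1)%N.
  by apply: leq_trans (size_polyMleq _ _) _; rewrite size_polyX addn2.
rewrite (coef_der_wide x le) big_ord_recl coefMX /= derivation0 mul0r add0r.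
rewrite derivM derivX mulr1 rmorphD rmorphM /= poly_ev_X.
have -> : \sum_(i < size p) D (p * 'X)`_(lift ord0 i) * x ^+ lift ord0 i =
          x * \sum_(i < size p) D p`_i * x ^+ i.
  by rewrite mulr_sumr; apply: eq_bigr => i _; rewrite coefMX /= exprS; ring.
by ring.
Qed.

Lemma poly_der_derivation x v : derivation_over (poly_ev x) (poly_der x v).
Proof.
split=> [|p q]; first exact: poly_derD.
elim/poly_ind: p => [|p c ih].
  rewrite mul0r rmorph0 mul0r.
  by rewrite -[0]/(0%:P) poly_derC derivation0 mul0r addr0.
rewrite mulrDl poly_derD mulrAC poly_derMX ih poly_derCM rmorphD !rmorphM /=.
by rewrite poly_ev_C poly_ev_X poly_derD poly_derMX poly_derC; ring.
Qed.

End DerivationTheory.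

(** Along an ultrafilter a family with this property acts as one derivation of
    the field generated by the values; working up to null sets spares the
    construction of that field. *)
Definition respects_null (B : comNzRingType) (ev D : I -> B -> K) : Prop :=
  forall b, U [set k | ev k b = 0] -> U [set k | D k b = 0].

Lemma not_ultra (A : set I) : ~ U A -> U (~` A).
Proof. by case: (in_ultra_setVsetC A UU). Qed.

Lemma ultraS (A B : set I) : A `<=` B -> U A -> U B.
Proof. exact: filterS. Qed.

Lemma ultraI (A B : set I) : U A -> U B -> U (A `&` B).
Proof. exact: filterI. Qed.

Lemma ultra_all (A : set I) : (forall k, A k) -> U A.
Proof. by move=> h; apply: (@filterS _ U _ setT) => //; exact: filterT. Qed.

Lemma ultra_forall_ord n (A : 'I_n -> set I) :
  (forall i, U (A i)) -> U [set k | forall i, A i k].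
Proof.
elim: n A => [|n ih] A h.
  by apply: ultra_all => k [].
have := ultraI (h ord0) (ih (fun i => A (lift ord0 i)) (fun i => h _)).
apply: ultraS => k [h0 h1] i.
by case: (unliftP ord0 i) => [j ->|->].
Qed.

(** Extension to one more generator.  If the generator is algebraic its
    derivative is forced by a relation of minimal degree; every other relation
    is a multiple of that one up to a nonzero leading coefficient.  If it is
    transcendental its derivative is arbitrary, because all coefficients of a
    relation are null. *)
Lemma derivation_extend (B : comNzRingType) (ev : I -> {rmorphism B -> K})
    (D : I -> B -> K) (x : I -> K) :
  (forall k, derivation_over (ev k) (D k)) ->
  respects_null (fun k => ev k : B -> K) D ->
  exists v : I -> K, respects_null (fun k => poly_ev (ev k) (x k))
    (fun k => poly_der (ev k) (D k) (x k) (v k)).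
Proof.
move=> dD nD.
pose ze b := U [set k | ev k b = 0].
pose rel (p : {poly B}) := U [set k | poly_ev (ev k) (x k) p = 0].
pose triv (p : {poly B}) := forall i, ze p`_i.
have triv_rel p : triv p -> rel p.
  move=> tp; apply: ultraS (ultra_forall_ord (fun i : 'I_(size p) => tp i)).
  by move=> k h /=; rewrite /poly_ev big1 // => i _; rewrite h mul0r.
have triv_der p v : triv p ->
    U [set k | poly_der (ev k) (D k) (x k) (v k) p = 0].
  move=> tp.
  have td : triv p^`().
    move=> i; apply: ultraS (tp i.+1) => k /= h.
    by rewrite coef_deriv rmorphMn /= h mul0rn.
  have := ultraI (triv_rel _ td)
    (ultra_forall_ord (fun i : 'I_(size p) => nD _ (tp i))).
  apply: ultraS => k [h0 h1] /=; rewrite /poly_der h0 mulr0 addr0.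
  by rewrite big1 // => i _; rewrite h1 mul0r.
have [alltriv|] := pselect (forall p, rel p -> triv p).
  by exists (fun=> 0) => p /alltriv/triv_der.
move=> /existsNP[p /not_implyP[relp ntp]].
pose good n := exists p, [/\ rel p, ~ triv p & size p = n].
have [n [q [relq ntq szq]] minq] : exists2 n, good n &
    forall m, good m -> (n <= m)%N.
  have ex : exists n, `[< good n >] by exists (size p); apply/asboolP; exists p.
  case: (ex_minnP ex) => n /asboolP gn mn; exists n => // m gm.
  by apply: mn; apply/asboolP.
have mint r : rel r -> (size r < size q)%N -> triv r.
  move=> rr lt; apply: contrapT => nt.
  have : good (size r) by exists r.
  by move=> /minq; rewrite -szq leqNgt lt.
have q0 : q != 0.
  by apply/eqP => q0; apply: ntq => i; rewrite q0 coef0;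
    apply: ultra_all => k /=; rewrite rmorph0.
have lead_nz : ~ ze (lead_coef q).
  move=> zl.
  pose r := \poly_(i < (size q).-1) q`_i.
  have qE : q = r + lead_coef q *: 'X^((size q).-1).
    apply/polyP => i; rewrite coefD coef_poly coefZ coefXn.
    case: ltngtP => [lt|gt|->]; rewrite ?mulr0 ?addr0 ?mulr1 ?add0r //.
    by rewrite nth_default //; case: (size q) gt.
  have szr : (size r < size q)%N.
    apply: leq_ltn_trans (size_poly _ _) _.
    by rewrite prednK ?size_poly_gt0.
  have relr : rel r.
    apply: ultraS (ultraI relq zl) => k [/= h1 h2].
    move: h1; rewrite {1}qE -mul_polyC rmorphD rmorphM /=.
    by rewrite poly_ev_C h2 mul0r addr0.
  apply: ntq => i; rewrite qE.
  apply: ultraS (ultraI (mint _ relr szr i) zl) => k [/= h1 h2].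
  by rewrite coefD coefZ rmorphD rmorphM /= h1 h2 mul0r addr0.
have sz1 : (1 < size q)%N.
  rewrite ltnNge; apply/negP => sz.
  apply: ntq => i; have -> : q = (q`_0)%:P by rewrite -size1_polyC.
  rewrite coefC; case: eqP => _; last first.
    by apply: ultra_all => k /=; rewrite rmorph0.
  apply: ultraS relq => k /=.
  by rewrite {1}(size1_polyC sz) poly_ev_C.
have nrelq' : ~ rel q^`().
  move=> /mint h; apply: lead_nz.
  have /h/(_ (size q).-2) : (size q^`() < size q)%N by apply: lt_size_deriv.
  apply: ultraS => k /=; rewrite coef_deriv.
  have -> : ((size q).-2.+1 = (size q).-1)%N by case: (size q) sz1 => [|[]].
  rewrite -lead_coefE rmorphMn /= -mulr_natr => /eqP.
  rewrite mulf_eq0 pnatr_eq0 -leqn0 leqNgt -subn1 subn_gt0 sz1 orbF.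
  by move/eqP.
pose v k := - (\sum_(i < size q) D k q`_i * x k ^+ i) /
  poly_ev (ev k) (x k) q^`().
exists v => r relr.
have Dq : U [set k | poly_der (ev k) (D k) (x k) (v k) q = 0].
  apply: ultraS (not_ultra nrelq') => k /= /eqP nz.
  by rewrite /poly_der /v mulfVK // subrr.
set c := lead_coef q ^+ Pdiv.Ring.rscalp r q.
have rE : c%:P * r = Pdiv.Ring.rdivp r q * q + Pdiv.Ring.rmodp r q.
  by rewrite mul_polyC Pdiv.ComRing.rdivp_eq.
set s := Pdiv.Ring.rmodp r q in rE.
have szs : (size s < size q)%N by rewrite Pdiv.Ring.ltn_rmodp.
have rels : rel s.
  apply: ultraS (ultraI relr relq) => k [/= h1 h2].
  have := congr1 (poly_ev (ev k) (x k)) rE.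
  by rewrite rmorphD !rmorphM /= h1 h2 !mulr0 add0r => <-.
have Ds := triv_der _ v (mint _ rels szs).
have := ultraI (ultraI (ultraI relr relq) (ultraI Dq Ds))
  (not_ultra lead_nz).
apply: ultraS => k [[[/= h1 h2] [h3 h4]] /eqP nz].
have [dA dM] := poly_der_derivation (dD k) (x k) (v k).
have := congr1 (poly_der (ev k) (D k) (x k) (v k)) rE.
rewrite dA !dM h1 h2 h3 h4 !mulr0 !addr0 poly_ev_C => /eqP.
by rewrite mulf_eq0 rmorphXn expf_eq0 (negbTE nz) andbF => /eqP.
Qed.

(** The coordinates of the points are adjoined one at a time; at each stage
    the derivative of the new one is chosen along with it. *)
Lemma derivation_tower n (x : nat -> I -> K) (B0 : comNzRingType)
    (ev0 : I -> {rmorphism B0 -> K}) (D0 : I -> B0 -> K) :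
  (forall k, derivation_over (ev0 k) (D0 k)) ->
  respects_null (fun k => ev0 k : _ -> K) D0 ->
  exists (B : comNzRingType) (ev : I -> {rmorphism B -> K}) (D : I -> B -> K)
      (i0 : {rmorphism B0 -> B}) (X : nat -> B),
    [/\ forall k, derivation_over (ev k) (D k),
        respects_null (fun k => ev k : _ -> K) D,
        (forall k b, ev k (i0 b) = ev0 k b),
        (forall k b, D k (i0 b) = D0 k b) &
        forall k i, (i < n)%N -> ev k (X i) = x i k].
Proof.
move=> dD0 nD0; elim: n => [|n [B [ev [D [i0 [X [dD nD evE DE XE]]]]]]].
  by exists B0, ev0, D0, idfun, (fun=> 0); split.
have [v nv] := derivation_extend (x n) dD nD.
exists {poly B}, (fun k => poly_ev (ev k) (x n k)),
  (fun k => poly_der (ev k) (D k) (x n k) (v k)),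
  (polyC \o i0 : {rmorphism B0 -> {poly B}}),
  (fun i => if (i < n)%N then (X i)%:P else 'X); split => //.
- by move=> k; exact: poly_der_derivation.
- by move=> k b; rewrite -evE -(poly_ev_C (ev k) (x n k)).
- by move=> k b; rewrite -DE -(poly_derC (dD k) (x n k) (v k)).
move=> k i; rewrite ltnS leq_eqVlt => /predU1P[->|lt].
  by rewrite ltnn /= poly_ev_X.
by rewrite lt /= poly_ev_C XE.
Qed.

End Derivations.

(** * Branches of a plane algebraic curve at the origin *)

Lemma closed_preim (S T : topologicalType) (f : S -> T) (A : set T) :
  continuous f -> closed A -> closed (f @^-1` A).
Proof. by move=> cf; apply: preimage_closed => x _; exact: cf. Qed.

Section PolyNearZero.
Variable R : realType.
Implicit Types p : {poly R}.

Lemma poly_pos_near p b : 0 < p.[b] ->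
  exists2 e, 0 < e & forall x, `|x - b| < e -> 0 < p.[x].
Proof.
move=> pb; have := @continuous_horner R p b.
move/cvgrPdist_lt => /(_ _ pb) /nbhs_ballP[e /= e0 h].
exists e => // x xb.
have : ball b e x by rewrite /ball /= distrC.
move/h; rewrite /= => lt.
by move: (ler_norm (p.[b] - p.[x])); lra.
Qed.

Lemma poly_neq0_near p : p != 0 ->
  exists2 e, 0 < e & forall x, 0 < x < e -> p.[x] != 0.
Proof.
elim/poly_ind: p => [|p c ih]; first by rewrite eqxx.
have [->|c0] := eqVneq c 0.
  rewrite addr0 mulf_eq0 polyX_eq0 orbF => /ih[e e0 h].
  exists e => // x xe; rewrite hornerM hornerX mulf_neq0 ?h //.
  by case/andP: xe => /lt0r_neq0.
move=> _.
have : 0 < ((p * 'X + c%:P) ^+ 2).[0].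
  rewrite horner_exp hornerD hornerM hornerX mulr0 add0r hornerC.
  by rewrite exprn_even_gt0.
case/poly_pos_near => e e0 h; exists e => // x /andP[x0 xe].
have : `|x - 0| < e by rewrite subr0 gtr0_norm.
by move/h; rewrite horner_exp exprn_even_gt0.
Qed.

(** A simple root is a change of sign: factor it out. *)
Lemma poly_sign_change p b : p.[b] = 0 -> 0 < p^`().[b] ->
  exists2 e, 0 < e & (forall x, b < x < b + e -> 0 < p.[x]) /\
                     (forall x, b - e < x < b -> p.[x] < 0).
Proof.
move=> pb; have /factor_theorem[q ->] : root p b by apply/rootP.
rewrite derivM derivXsubC mulr1 !hornerE subrr mulr0 add0r.
case/poly_pos_near => e e0 h; exists e => //.
split=> x /andP[x1 x2]; rewrite !hornerE.
  by apply: mulr_gt0; [apply: h; rewrite ger0_norm; lra|lra].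
by rewrite pmulr_rlt0; [lra|apply: h; rewrite ltr0_norm; lra].
Qed.

Lemma deriv_eq0_size p : p^`() = 0 -> (size p <= 1)%N.
Proof.
move=> dp; rewrite leqNgt; apply/negP => s1.
have := congr1 (fun h : {poly R} => h`_(size p).-2) dp.
rewrite coef0 coef_deriv.
have -> : ((size p).-2.+1 = (size p).-1)%N by case: (size p) s1 => [|[]].
rewrite -lead_coefE => /eqP; rewrite -mulr_natr mulf_eq0 lead_coef_eq0.
rewrite -size_poly_eq0 pnatr_eq0.
by case: (size p) s1 => [|[]].
Qed.

End PolyNearZero.

Section PlaneCurve.
Variable R : realType.

(** The outer variable of a bivariate polynomial is [a], the inner one [b]. *)
Definition ev2 (F : {poly {poly R}}) (a b : R) : R := F.[a%:P].[b].

Lemma ev2E F a b : ev2 F a b = (map_poly (horner_eval b) F).[a].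
Proof.
by rewrite /ev2 -[RHS](congr1 (horner _) (hornerC a b)) -horner_evalE
  -horner_map.
Qed.

Lemma ev2M F G a b : ev2 (F * G) a b = ev2 F a b * ev2 G a b.
Proof. by rewrite /ev2 !hornerM. Qed.

Lemma ev2D F G a b : ev2 (F + G) a b = ev2 F a b + ev2 G a b.
Proof. by rewrite /ev2 !hornerD. Qed.

Lemma ev2C c a b : ev2 c%:P a b = c.[b].
Proof. by rewrite /ev2 hornerC. Qed.

Lemma ev2X a b : ev2 'X a b = a.
Proof. by rewrite /ev2 hornerX hornerC. Qed.

Definition der_a (F : {poly {poly R}}) := F^`().
Definition der_b (F : {poly {poly R}}) := map_poly (@deriv R) F.

Lemma ev2_deriv_b F a : F.[a%:P]^`() = (der_b F).[a%:P].
Proof.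
rewrite /der_b; elim/poly_ind: F => [|F c ih].
  by rewrite map_poly0 !horner0 deriv0.
have -> : map_poly (@deriv R) (F * 'X + c%:P) =
          map_poly (@deriv R) F * 'X + c^`()%:P.
  apply/polyP => i; rewrite coef_map_id0 ?deriv0 // !coefD !coefMX !coefC.
  rewrite derivD; case: i => [|i] /=; first by rewrite deriv0.
  by rewrite coef_map_id0 ?deriv0.
by rewrite !hornerE derivD derivM ih derivC mulr0 addr0.
Qed.

Lemma ev2_deriv_a F b : (map_poly (horner_eval b) F)^`() =
  map_poly (horner_eval b) (der_a F).
Proof. by rewrite deriv_map. Qed.

Lemma ev2_continuous F : continuous (fun z : R * R => ev2 F z.1 z.2).
Proof.
elim/poly_ind: F => [|F c ih].
  have -> : (fun z : R * R => ev2 0 z.1 z.2) = (fun=> 0).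
    by apply/funext => z; rewrite /ev2 !horner0.
  by move=> z; exact: cvg_cst.
have -> : (fun z : R * R => ev2 (F * 'X + c%:P) z.1 z.2) =
          (fun z : R * R => ev2 F z.1 z.2 * z.1 + c.[z.2]).
  by apply/funext => y; rewrite ev2D ev2M ev2X ev2C.
move=> z; apply: cvgD.
  by apply: cvgM; [exact: ih|exact: cvg_fst].
apply: (@cvg_comp _ _ _ (fun z : R * R => z.2) (horner c) _ (nbhs z.2)).
  exact: cvg_snd.
exact: continuous_horner.
Qed.

(** At a point of the curve with [der_a F * der_b F > 0] the
    curve is the graph of a decreasing function of [b].  Following this branch
    towards larger [b] never leaves the strip [0 < a <= a0], so it reaches
    [b = b1]. *)
Lemma decreasing_branch (F : {poly {poly R}}) (a0 b0 b1 : R) :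
  0 < a0 -> b0 <= b1 ->
  (forall b, b0 <= b <= b1 -> (F`_0).[b] != 0) ->
  (forall a b, 0 < a <= a0 -> b0 <= b <= b1 -> ev2 F a b = 0 ->
     ev2 (der_a F) a b * ev2 (der_b F) a b != 0) ->
  ev2 F a0 b0 = 0 -> 0 < ev2 (der_a F) a0 b0 * ev2 (der_b F) a0 b0 ->
  exists2 a, 0 < a <= a0 & ev2 F a b1 = 0.
Proof.
move=> a00 b01 F0 nz F00 s00.
pose G a b := ev2 (der_a F) a b * ev2 (der_b F) a b.
have cG : continuous (fun z : R * R => G z.1 z.2).
  by move=> z; apply: cvgM; exact: ev2_continuous.
pose A := (`[0, a0]%classic `*` `[b0, b1]%classic) `&`
  ([set z : R * R | ev2 F z.1 z.2 = 0] `&` [set z | 0 <= G z.1 z.2]).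
have cA : compact A.
  apply: compact_closedI.
    by apply: compact_setX; exact: segment_compact.
  apply: closedI.
    exact: (closed_preim (@ev2_continuous F) (@closed_eq R 0)).
  exact: (closed_preim cG (@closed_ge R 0)).
have A0 : A !=set0.
  by exists (a0, b0); do !split => //=; rewrite ?in_itv /= ?lexx ?b01 ?ltW.
have c2 : {within A, continuous (fun z : R * R => z.2)}.
  by apply: continuous_subspaceT => z; exact: cvg_snd.
have [[a b] /[!inE] Aab bmax] := compact_EVT_max A0 cA c2.
have [[/= ia ib] [Fab Gab]] := Aab.
move: ia ib; rewrite !in_itv /= => /andP[a_ge0 aa0] /andP[b0b bb1].
have a_gt0 : 0 < a.
  rewrite lt_def a_ge0 andbT; apply/eqP => a0E.
  move: Fab => /= /eqP; rewrite /ev2 a0E -[0%:P]/(0 : {poly R}) horner_coef0.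
  by rewrite (negbTE (F0 _ _)) ?b0b.
have [->|b_neq] := eqVneq b1 b; first by exists a; rewrite ?a_gt0.
have b_lt : b < b1 by rewrite lt_def b_neq.
have G_gt0 : 0 < G a b.
  by rewrite lt_def Gab andbT; apply: nz => //; rewrite ?a_gt0 ?b0b.
(* The sign of the derivatives is irrelevant: change [F] into [-F]. *)
have [H [H0 Ha Hb]] : exists H : {poly {poly R}},
    [/\ (forall x y, (ev2 H x y == 0) = (ev2 F x y == 0)),
        0 < ev2 (der_a H) a b & 0 < ev2 (der_b H) a b].
  have [pa|na] := ltP 0 (ev2 (der_a F) a b).
    by exists F; split=> //; move: G_gt0; rewrite /G pmulr_rgt0.
  have na' : ev2 (der_a F) a b < 0.
    rewrite lt_neqAle na andbT; apply/eqP => z.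
    by move: G_gt0; rewrite /G z mul0r ltxx.
  exists (- F); rewrite /der_a /der_b derivN; split.
  - by move=> x y; rewrite /ev2 !hornerN oppr_eq0.
  - by rewrite /ev2 !hornerN oppr_gt0.
  rewrite (_ : map_poly _ _ = - der_b F); last first.
    by apply/polyP => i; rewrite coefN !coef_map_id0 ?deriv0 // coefN derivN.
  rewrite /ev2 !hornerN oppr_gt0 -[X in X < 0]/(ev2 _ _ _).
  by move: G_gt0; rewrite /G nmulr_rgt0.
have Hab : ev2 H a b = 0 by apply/eqP; rewrite H0; apply/eqP.
have [da da0 [_ neg]] : exists2 e, 0 < e &
   (forall x, a < x < a + e -> 0 < (map_poly (horner_eval b) H).[x]) /\
   (forall x, a - e < x < a -> (map_poly (horner_eval b) H).[x] < 0).
  by apply: poly_sign_change; rewrite ?ev2_deriv_a -ev2E.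
have [db db0 [pos _]] : exists2 e, 0 < e &
   (forall x, b < x < b + e -> 0 < H.[a%:P].[x]) /\
   (forall x, b - e < x < b -> H.[a%:P].[x] < 0).
  by apply: poly_sign_change; rewrite ?ev2_deriv_b.
have [e e0 Gpos] : exists2 e, 0 < e & forall x y, `|x - a| < e ->
    `|y - b| < e -> 0 < G x y.
  have := cG (a, b); move/cvgrPdist_lt => /(_ _ G_gt0) /nbhs_ballP[e /= e0 h].
  exists e => // x y xa yb.
  have : ball (a, b) e (x, y) by split; rewrite /ball /= distrC.
  move/h; rewrite /= => lt.
  by move: (ler_norm (G a b - G x y)); lra.
pose d := Num.min a (Num.min da e) / 2.
have d0 : 0 < d by rewrite divr_gt0 // !lt_min a_gt0 da0 e0.
have [d1 d2 d3] : [/\ d < a, d < da & d < e].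
  have h : d < Num.min a (Num.min da e) by rewrite /d; move: d0; rewrite /d; lra.
  by move: h; rewrite !lt_min => /and3P.
have Hd : 0 < (- (H.[(a - d)%:P])).[b].
  by rewrite hornerN oppr_gt0 -[X in X < 0]/(ev2 H (a - d) b) ev2E neg //; lra.
have [e2 e20 neg2] := poly_pos_near Hd.
pose t := Num.min (b1 - b) (Num.min db (Num.min e e2)) / 2.
have t0 : 0 < t by rewrite divr_gt0 // !lt_min subr_gt0 b_lt db0 e0 e20.
have [t1 t2 t3 t4] : [/\ t < b1 - b, t < db, t < e & t < e2].
  have h : t < Num.min (b1 - b) (Num.min db (Num.min e e2)).
    by rewrite /t; move: t0; rewrite /t; lra.
  by move: h; rewrite !lt_min => /and4P.
have le : a - d <= a by lra.
have Hl : (map_poly (horner_eval (b + t)) H).[a - d] <= 0.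
  rewrite -ev2E ltW // -oppr_gt0 -hornerN neg2 //.
  by rewrite addrC addKr gtr0_norm.
have Hr : 0 <= (map_poly (horner_eval (b + t)) H).[a].
  by rewrite -ev2E ltW // /ev2 pos //; lra.
have [|x /andP[x1 x2] /rootP] := poly_ivt le (p := map_poly (horner_eval (b + t)) H).
  by rewrite Hl Hr.
rewrite -ev2E => /eqP; rewrite H0 => /eqP Hx.
have : A (x, b + t).
  split; first by split; rewrite /= in_itv /=; apply/andP; split; lra.
  split=> //=; rewrite ltW // Gpos //; last by rewrite addrC addKr gtr0_norm.
  by rewrite ler0_norm; lra.
by rewrite -inE => /bmax /=; lra.
Qed.

End PlaneCurve.

Section RelationSlope.
Variables (R : realType) (I : Type) (U : set_system I).
Context {UU : UltraFilter U}.
Variables q r : I -> R.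
Hypotheses (q_gt0 : forall k, 0 < q k) (r_gt0 : forall k, 0 < r k).
Hypothesis q_small : forall e, 0 < e -> U [set k | q k < e].
Hypothesis r_small : forall e, 0 < e -> U [set k | r k < e].

Let null (F : {poly {poly R}}) := U [set k | ev2 F (q k) (r k) = 0].

Lemma small_neq0 (x : I -> R) (p : {poly R}) : (forall k, 0 < x k) ->
  (forall e, 0 < e -> U [set k | x k < e]) -> p != 0 ->
  U [set k | p.[x k] != 0].
Proof.
move=> x0 xs /poly_neq0_near[e e0 h].
by apply: ultraS (xs _ e0) => k /= xe; apply: h; rewrite x0.
Qed.

Lemma nullC c : null c%:P -> c = 0.
Proof.
move=> nc; apply/eqP/negP => /negP c0.
have [k [/= h1 /negP[]]] :=
  filter_ex (ultraI nc (small_neq0 r_gt0 r_small c0)).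
by move: h1; rewrite ev2C => ->.
Qed.

Lemma nullM F G : null (F * G) -> null F \/ null G.
Proof.
move=> n; have [?|nF] := pselect (null F); first by left.
right; apply: ultraS (ultraI n (not_ultra nF)) => k [/= h /eqP z].
by move: h; rewrite ev2M => /eqP; rewrite mulf_eq0 (negbTE z) => /eqP.
Qed.

Lemma nullMl F G : null F -> null (G * F).
Proof. by move=> n; apply: ultraS n => k /= h; rewrite ev2M h mulr0. Qed.

(** A relation of minimal degree in [a], and among those with a leading
    coefficient of minimal degree in [b]. *)
Lemma minimal_relation F : F != 0 -> null F ->
  exists G, [/\ G != 0, null G,
    (forall H, null H -> (size H < size G)%N -> H = 0) &
    (forall H, H != 0 -> null H -> size H = size G ->
       (size (lead_coef G) <= size (lead_coef H))%N)].
Proof.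
move=> F0 nF.
pose P n := `[< exists G, [/\ G != 0, null G & size G = n] >].
have exP : exists n, P n by exists (size F); apply/asboolP; exists F.
case: (ex_minnP exP) => n /asboolP[G [G0 nG sG]] minP.
pose Q m := `[< exists H, [/\ H != 0, null H, size H = n & size (lead_coef H) = m] >].
have exQ : exists m, Q m.
  by exists (size (lead_coef G)); apply/asboolP; exists G.
case: (ex_minnP exQ) => m /asboolP[H [H0 nH sH lH]] minQ.
exists H; split => // [L nL|L L0 nL sL].
  move=> lt; apply/eqP/negP => /negP L0.
  have /minP : P (size L) by apply/asboolP; exists L.
  by rewrite -sH leqNgt lt.
by rewrite lH minQ //; apply/asboolP; exists L; split => //; rewrite sL.
Qed.

(** Elimination of [a]: an element of minimal degree in the ideal generated by
    the minimal relation [G] and a non-relation [H] divides a multiple of [G],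
    hence has degree zero in [a]. *)
Lemma minimal_relation_coprime G H : G != 0 -> null G ->
  (forall L, null L -> (size L < size G)%N -> L = 0) -> ~ null H ->
  exists d u v, d != 0 /\ u * G + v * H = d%:P.
Proof.
move=> G0 nG minG nH.
pose P n := `[< exists L u v, [/\ L != 0, u * G + v * H = L & size L = n] >].
have exP : exists n, P n.
  exists (size G); apply/asboolP; exists G, 1, 0; split => //.
  by rewrite mul0r addr0 mul1r.
case: (ex_minnP exP) => n /asboolP[L [u [v [L0 LE sL]]]] minP.
have divL M : (exists s t, s * G + t * H = M) ->
    exists c w, c != 0 /\ c *: M = w * L.
  move=> [s [t ME]].
  have rE := Pdiv.ComRing.rdivp_eq L M.
  have sr : (size (Pdiv.Ring.rmodp M L) < size L)%N.
    by rewrite Pdiv.Ring.ltn_rmodp.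
  have r0 : Pdiv.Ring.rmodp M L = 0.
    apply/eqP/negP => /negP nz.
    have /minP : P (size (Pdiv.Ring.rmodp M L)).
      apply/asboolP; exists (Pdiv.Ring.rmodp M L).
      set c := (_ ^+ _) in rE; set w := Pdiv.Ring.rdivp _ _ in rE.
      exists (c%:P * s - w * u), (c%:P * t - w * v); split => //.
      move: rE => /eqP; rewrite addrC -subr_eq => /eqP <-.
      by rewrite -mul_polyC -LE -ME; ring.
    by rewrite leqNgt -sL sr.
  exists (lead_coef L ^+ Pdiv.Ring.rscalp M L), (Pdiv.Ring.rdivp M L).
  by rewrite rE r0 addr0 expf_neq0 // lead_coef_eq0.
have [c [w [c0 cG]]] : exists c w, c != 0 /\ c *: G = w * L.
  by apply: divL; exists 1, 0; rewrite mul0r addr0 mul1r.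
have [c' [w' [c'0 cH]]] : exists c w, c != 0 /\ c *: H = w * L.
  by apply: divL; exists 0, 1; rewrite mul0r add0r mul1r.
have nL : ~ null L.
  move=> nL; apply: nH.
  have : null (c'%:P * H) by rewrite mul_polyC cH; exact: nullMl.
  by case/nullM => // /nullC c0'; rewrite c0' eqxx in c'0.
have cG0 : c *: G != 0 by rewrite -mul_polyC mulf_neq0 ?polyC_eq0.
have nw : null w.
  have : null (w * L) by rewrite -cG -mul_polyC; exact: nullMl.
  by case/nullM.
have w0 : w != 0 by apply: contraNneq cG0 => w0; rewrite cG w0 mul0r.
have szw : (size G <= size w)%N.
  by rewrite leqNgt; apply/negP => /(minG _ nw) w0'; rewrite w0' eqxx in w0.
have sE : size G = (size w + size L).-1.
  by rewrite -size_mul // -cG -mul_polyC size_Cmul.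
have sL1 : (size L <= 1)%N.
  by move: szw; rewrite sE; case: (size w) (size L) => [|m] [|[|l]] //=; lia.
exists L`_0, u, v; rewrite LE -size1_polyC //; split => //.
by apply: contraNneq L0 => z; rewrite (size1_polyC sL1) z.
Qed.

(** A minimal relation [G] is a curve through the points.  Near the origin its
    two partial derivatives do not vanish on it, since both are coprime to [G],
    and [c >= 0] gives them the same sign at the points.  The decreasing branch
    through a point [(q k, r k)] then reaches the fixed height [b1] with a
    positive abscissa at most [q k]; as [q k] tends to [0], the polynomial
    [G (-, b1)] would have roots accumulating at [0]. *)
Lemma relation_slope_lt0 F (c : I -> R) : F != 0 -> null F ->
  (forall k, 0 <= c k) ->
  (forall G, null G -> U [set k | ev2 (der_b G) (q k) (r k) =
                                  c k * ev2 (der_a G) (q k) (r k)]) ->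
  False.
Proof.
move=> F0 nF c0 dc.
have [G [G0 nG minG minl]] := minimal_relation F0 nF.
have sG : (1 < size G)%N.
  rewrite ltnNge; apply/negP => s1.
  move: nG G0; rewrite (size1_polyC s1) => /nullC ->.
  by rewrite eqxx.
have nGa : ~ null (der_a G).
  move=> na.
  have lt : (size (der_a G) < size G)%N by apply: lt_size_deriv.
  have : (der_a G)`_(size G).-2 = 0 by rewrite (minG _ na lt) coef0.
  rewrite coef_deriv.
  have -> : ((size G).-2.+1 = (size G).-1)%N by case: (size G) sG => [|[]].
  rewrite -lead_coefE => /eqP; rewrite -mulr_natr mulf_eq0.
  rewrite lead_coef_eq0 (negbTE G0) -(rmorph_nat (@polyC R)) polyC_eq0.
  by rewrite pnatr_eq0; case: (size G) sG => [|[]].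
have szb : (size (der_b G) <= size G)%N by exact: size_poly.
have nGb : ~ null (der_b G).
  move=> nb.
  have [b0|b0] := eqVneq (der_b G) 0.
    pose g := map_poly (horner_eval 0) G.
    have gE : G = map_poly polyC g.
      apply/polyP => i; rewrite -map_poly_comp coef_map_id0 ?rmorph0 //=.
      have := congr1 (fun p : {poly {poly R}} => p`_i) b0.
      rewrite coef0 coef_map_id0 ?deriv0 // => di.
      have s1 := deriv_eq0_size di.
      by rewrite {1}(size1_polyC s1) horner_evalE horner_coef0.
    have g0 : g != 0 by apply: contraNneq G0 => z; rewrite gE z rmorph0.
    have [k [/= h1 /negP[]]] :=
      filter_ex (ultraI nG (small_neq0 q_gt0 q_small g0)).
    by move: h1; rewrite /ev2 {1}gE (horner_map polyC) hornerC => ->.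
  have [lt|ge] := ltnP (size (der_b G)) (size G).
    by move: b0; rewrite (minG _ nb lt) eqxx.
  have sE : size (der_b G) = size G by apply/eqP; rewrite eqn_leq szb.
  have := minl _ b0 nb sE.
  rewrite leqNgt => /negP; apply.
  rewrite lead_coefE sE coef_map_id0 ?deriv0 // -lead_coefE.
  by apply: lt_size_deriv; rewrite lead_coef_eq0.
have [da [u [v [da0 daE]]]] := minimal_relation_coprime G0 nG minG nGa.
have [db [u' [v' [db0 dbE]]]] := minimal_relation_coprime G0 nG minG nGb.
have G00 : G`_0 != 0.
  apply/eqP => z.
  have /factor_theorem[H HE] : root G 0 by rewrite /root horner_coef0 z.
  rewrite subr0 in HE.
  have H0 : H != 0 by apply: contraNneq G0 => z'; rewrite HE z' mul0r.
  have : null (H * 'X) by rewrite -HE.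
  case/nullM => [nH|nX].
    have : (size H < size G)%N by rewrite HE size_mulX.
    by move/(minG _ nH) => z'; rewrite z' eqxx in H0.
  have [k /=] := filter_ex nX; rewrite ev2X => qk0.
  by have := q_gt0 k; rewrite qk0 ltxx.
have l0 : lead_coef G != 0 by rewrite lead_coef_eq0.
have all0 : G`_0 * lead_coef G * (da * db) != 0 by rewrite !mulf_neq0.
have [e e0 he] := poly_neq0_near all0.
have {}he b : 0 < b < e -> [/\ (G`_0).[b] != 0, (lead_coef G).[b] != 0,
    da.[b] != 0 & db.[b] != 0].
  move/he; rewrite !hornerM !mulf_eq0 !negb_or.
  by case/andP => /andP[-> ->] /andP[-> ->].
pose b1 := e / 2.
have b1e : 0 < b1 < e by rewrite /b1; apply/andP; split; lra.
have g0 : map_poly (horner_eval b1) G != 0.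
  apply/eqP => /(congr1 (fun p : {poly R} => p`_(size G).-1)).
  rewrite coef0 coef_map /= -lead_coefE horner_evalE => z.
  by have [_ /negP[]] := he _ b1e; rewrite z.
have [e1 e10 he1] := poly_neq0_near g0.
have b10 : 0 < b1 by case/andP: b1e.
have [k [[/= h1 h2] [[h3 h4] h5]]] := filter_ex (ultraI (ultraI (q_small e10)
  (r_small b10)) (ultraI (ultraI nG (not_ultra nGa)) (dc _ nG))).
have nz a b : 0 < b < e -> ev2 G a b = 0 ->
    ev2 (der_a G) a b * ev2 (der_b G) a b != 0.
  move=> be z; have [_ _ daz dbz] := he _ be.
  rewrite mulf_neq0 //.
    apply: contraNneq daz => z'.
    by rewrite -(ev2C da a) -daE ev2D !ev2M z z' !mulr0 addr0.
  apply: contraNneq dbz => z'.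
  by rewrite -(ev2C db a) -dbE ev2D !ev2M z z' !mulr0 addr0.
have rk : 0 < r k < e.
  by rewrite r_gt0 /= (lt_trans h2) //; case/andP: b1e.
have s0 : 0 < ev2 (der_a G) (q k) (r k) * ev2 (der_b G) (q k) (r k).
  have nzk := nz _ _ rk h3.
  by rewrite lt_def nzk /= h5 mulrCA -expr2 mulr_ge0 // sqr_ge0.
have inE b : r k <= b <= b1 -> 0 < b < e.
  case/andP => x1 x2; rewrite (lt_le_trans (r_gt0 k)) // (le_lt_trans x2) //.
  by case/andP: b1e.
have [b /inE/he[]//|a b _ /inE be|a /andP[a1 a2]] :=
  @decreasing_branch R G (q k) (r k) b1 (q_gt0 k) (ltW h2) _ _ h3 s0.
  exact: nz.
apply/eqP; rewrite ev2E; apply: he1.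
by rewrite a1 (le_lt_trans a2 h1).
Qed.

End RelationSlope.

(** * Tangent vectors at generic points *)

(** Polynomials are built from constants and variables by ring operations; the
    estimates below are stable under these operations. *)
Lemma mpoly_ring_ind n (R : nzRingType) (P : mpoly n R -> Prop) :
  (forall c, P (mpolyC n c)) -> (forall i, P (mpolyX R (mnm1 i))) ->
  (forall p q, P p -> P q -> P (p + q)) ->
  (forall p q, P p -> P q -> P (p * q)) -> forall p, P p.
Proof.
move=> PC PX PD PM; elim/mpolyind => [|c m p _ _ ih].
  by rewrite -(mpolyC0 n R); exact: PC.
apply: (PD _ _ _ ih); rewrite -mul_mpolyC; apply: (PM) => //.
rewrite mpolyXE_id; elim/big_ind: _ => [||i _]; [|exact: PM|].
  by rewrite -(mpolyC1 n R); exact: PC.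
elim: (m i) => [|k ihk]; first by rewrite expr0 -(mpolyC1 n R); exact: PC.
by rewrite exprS; exact: PM.
Qed.

Section CompositionTwo.
Variables (R : comNzRingType) (N : nat) (q r : mpoly N R).

Definition subst1 (p : {poly R}) : mpoly N R := (map_poly (@mpolyC N R) p).[r].
Definition subst2 (F : {poly {poly R}}) : mpoly N R := (map_poly subst1 F).[q].

Fact subst1_is_zmod_morphism : zmod_morphism subst1.
Proof. by move=> p p'; rewrite /subst1 rmorphB hornerD hornerN. Qed.
Fact subst1_is_monoid_morphism : monoid_morphism subst1.
Proof.
by split=> [|p p']; rewrite /subst1 ?rmorph1 ?hornerC // rmorphM hornerM.
Qed.
HB.instance Definition _ :=
  GRing.isZmodMorphism.Build _ _ subst1 subst1_is_zmod_morphism.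
HB.instance Definition _ :=
  GRing.isMonoidMorphism.Build _ _ subst1 subst1_is_monoid_morphism.

Lemma meval_subst1 x p : meval x (subst1 p) = p.[meval x r].
Proof.
elim/poly_ind: p => [|p c ih]; first by rewrite /subst1 rmorph0 !horner0 meval0.
rewrite /subst1 rmorphD rmorphM /= map_polyX map_polyC !hornerE.
by rewrite mevalD mevalM -/(subst1 p) ih mevalC.
Qed.

Lemma mderiv_subst1 x i p :
  meval x (mderiv i (subst1 p)) = (p^`()).[meval x r] * meval x (mderiv i r).
Proof.
elim/poly_ind: p => [|p c ih].
  by rewrite /subst1 rmorph0 deriv0 !horner0 mderiv0 meval0 mul0r.
rewrite {1}/subst1 rmorphD rmorphM /= map_polyX map_polyC !hornerE.
rewrite mderivD mderivM mderivC addr0 mevalD !mevalM -/(subst1 p) ih.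
rewrite meval_subst1 derivD derivM derivX derivC mulr1 addr0 !hornerE.
by ring.
Qed.

Lemma subst2_MXaddC F c : subst2 (F * 'X + c%:P) = subst2 F * q + subst1 c.
Proof.
by rewrite /subst2 rmorphD rmorphM /= map_polyX map_polyC !hornerE.
Qed.

End CompositionTwo.

Section CompositionTwoReal.
Variables (R : realType) (N : nat) (q r : mpoly N R).

Lemma meval_subst2 x F :
  meval x (subst2 q r F) = ev2 F (meval x q) (meval x r).
Proof.
elim/poly_ind: F => [|F c ih].
  by rewrite /subst2 rmorph0 /ev2 !horner0 meval0.
by rewrite subst2_MXaddC mevalD mevalM ih meval_subst1 ev2D ev2M ev2X ev2C.
Qed.

Lemma mderiv_subst2 x i F :
  meval x (mderiv i (subst2 q r F)) =
  ev2 (der_a F) (meval x q) (meval x r) * meval x (mderiv i q) +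
  ev2 (der_b F) (meval x q) (meval x r) * meval x (mderiv i r).
Proof.
elim/poly_ind: F => [|F c ih].
  rewrite /subst2 rmorph0 /der_a /der_b deriv0 map_poly0 horner0 mderiv0.
  by rewrite /ev2 meval0 !horner0 !mul0r addr0.
rewrite subst2_MXaddC mderivD mderivM !mevalD !mevalM ih meval_subst2.
rewrite mderiv_subst1 /der_a derivD derivM derivX derivC mulr1 addr0.
rewrite !ev2D !ev2M ev2X.
have -> : der_b (F * 'X + c%:P) = der_b F * 'X + (c^`())%:P.
  apply/polyP => j; rewrite coef_map_id0 ?deriv0 // !coefD !coefMX !coefC.
  rewrite derivD; case: j => [|j] /=; first by rewrite deriv0.
  by rewrite coef_map_id0 ?deriv0.
by rewrite ev2D ev2M ev2X ev2C; ring.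
Qed.

End CompositionTwoReal.

Section Tangent.
Variables (R : realType) (I : Type) (U : set_system I).
Context {UU : UltraFilter U}.
Variables (N : nat) (x : I -> 'I_N -> R).

Section Base.
Variables (B0 : comNzRingType) (ev0 : I -> {rmorphism B0 -> R}).
Variables (D0 : I -> B0 -> R) (cst0 : {rmorphism R -> B0}).
Hypothesis ev0_cst : forall k c, ev0 k (cst0 c) = c.
Hypothesis D0_cst : forall k c, D0 k (cst0 c) = 0.
Hypothesis dD0 : forall k, derivation_over (ev0 k) (D0 k).
Hypothesis nD0 : respects_null U (fun k => ev0 k : _ -> R) D0.

(** The vector [v k] collects the derivatives of the coordinates of [x k] for
    an extension of [D0] to the algebra they generate; the chain rule then
    computes the derivative of every polynomial in them, and the extension
    respects the relations that hold almost everywhere. *)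
Lemma generic_tangent_vector : exists v : I -> 'I_N -> R,
  forall (h : mpoly N R) (b : B0),
    U [set k | meval (x k) h = ev0 k b] ->
    U [set k | \sum_i meval (x k) (mderiv i h) * v k i = D0 k b].
Proof.
pose xn (i : nat) (k : I) := if insub i is Some j then x k j else 0.
have [B [ev [D [i0 [X [dD nD evE DE XE]]]]]] :=
  derivation_tower (U := U) N xn dD0 nD0.
pose Y (i : 'I_N) := X i.
pose cs : {rmorphism R -> B} := i0 \o cst0.
have YE k i : ev k (Y i) = x k i.
  by rewrite XE // /xn valK.
have evh k h : ev k (mmap cs Y h) = meval (x k) h.
  elim/mpoly_ring_ind: h => [c|i|p p' ih ih'|p p' ih ih'].
  - by rewrite mmapC /= evE ev0_cst mevalC.
  - by rewrite mmapX mmap1U YE mevalXU.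
  - by rewrite !raddfD /= ih ih'.
  - by rewrite !rmorphM /= ih ih'.
have Dh k h : D k (mmap cs Y h) =
    \sum_i meval (x k) (mderiv i h) * D k (Y i).
  elim/mpoly_ring_ind: h => [c|i|p p' ih ih'|p p' ih ih'].
  - rewrite mmapC /= DE D0_cst big1 // => i _.
    by rewrite mderivC meval0 mul0r.
  - rewrite mmapX mmap1U (bigD1 i) //= big1 ?addr0 => [|j ji].
      rewrite mderivX mnm1E eqxx scale1r.
      have -> : mnm_sub (mnm1 i) (mnm1 i) = mnm0 by apply/mnmP => j; rewrite mnmBE subnn mnm0E.
      by rewrite mpolyX0 meval1 mul1r.
    by rewrite mderivX mnm1E eq_sym (negbTE ji) scale0r meval0 mul0r.
  - rewrite raddfD (dD k).1 /= ih ih' -big_split /=.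
    by apply: eq_bigr => i _; rewrite mderivD mevalD mulrDl.
  - rewrite rmorphM (dD k).2 /= ih ih' !evh mulr_sumr mulr_suml -big_split /=.
    by apply: eq_bigr => i _; rewrite mderivM mevalD !mevalM; ring.
exists (fun k i => D k (Y i)) => h b hb.
have /nD : U [set k | ev k (mmap cs Y h - i0 b) = 0].
  by apply: ultraS hb => k /= e; rewrite rmorphB /= evh evE e subrr.
apply: ultraS => k /=; rewrite (dD k).1 (derivationN (dD k)) Dh DE => /eqP.
by rewrite subr_eq0 => /eqP.
Qed.

End Base.

(** The values of [q] and [r] at the points satisfy an algebraic relation,
    otherwise a tangent vector could increase [q] while keeping [r] fixed; and
    differentiating this relation in a direction that increases [r] shows
    that the curve it defines has slope [- c]. *)
Lemma no_opposite_gradients P (g : 'I_P -> mpoly N R) (q r : mpoly N R)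
    (c : I -> R) (mu : I -> 'I_P -> R) :
  (forall k j, meval (x k) (g j) = 0) ->
  (forall k, 0 < meval (x k) q) -> (forall k, 0 < meval (x k) r) ->
  (forall e, 0 < e -> U [set k | meval (x k) q < e]) ->
  (forall e, 0 < e -> U [set k | meval (x k) r < e]) ->
  (forall k, 0 <= c k) ->
  (forall k i, meval (x k) (mderiv i q) = - c k * meval (x k) (mderiv i r) +
     \sum_j mu k j * meval (x k) (mderiv i (g j))) -> False.
Proof.
move=> g0 q_gt0 r_gt0 q_small r_small c_ge0 dq.
pose qv k := meval (x k) q; pose rv k := meval (x k) r.
have dqE k v : (forall j, \sum_i meval (x k) (mderiv i (g j)) * v i = 0) ->
    \sum_i meval (x k) (mderiv i q) * v i =
    - c k * \sum_i meval (x k) (mderiv i r) * v i.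
  move=> gv; under eq_bigr do rewrite dq mulrDl -mulrA.
  rewrite big_split /= -mulr_sumr -[RHS]addr0; congr (_ + _).
  under eq_bigr do rewrite mulr_suml.
  rewrite exchange_big big1 //= => j _.
  by under eq_bigr do rewrite -mulrA; rewrite -mulr_sumr gv mulr0.
have [[F [F0 nF]]|indep] := pselect (exists F : {poly {poly R}},
    F != 0 /\ U [set k | ev2 F (qv k) (rv k) = 0]).
  pose ev0 k : {rmorphism {poly R} -> R} := horner_eval (rv k).
  pose D0 k (p : {poly R}) := (p^`()).[rv k].
  have [k y|k y|k|b nb|v vE] := @generic_tangent_vector _ ev0 D0 polyC.
  - by rewrite /ev0 /= horner_evalE hornerC.
  - by rewrite /D0 derivC horner0.
  - split=> a b; rewrite /D0 /ev0 /= ?derivD ?hornerD // derivM hornerD.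
    by rewrite !hornerM !horner_evalE addrC.
  - have [->|b0] := eqVneq b 0.
      by apply: ultra_all => k /=; rewrite /D0 deriv0 horner0.
    have [k [/= h1 /negP[]]] :=
      filter_ex (ultraI nb (small_neq0 r_gt0 r_small b0)).
    by move: h1; rewrite /ev0 /= horner_evalE => ->.
  have gv : U [set k | forall j, \sum_i meval (x k) (mderiv i (g j)) * v k i = 0].
    apply: ultra_forall_ord => j.
    have := vE (g j) 0; rewrite /D0 deriv0 => h.
    apply: ultraS (h _) => [k /=|]; first by rewrite horner0.
    by apply: ultra_all => k /=; rewrite g0 rmorph0.
  have rvE : U [set k | \sum_i meval (x k) (mderiv i r) * v k i = 1].
    have := vE r 'X; rewrite /D0 derivX => h.
    apply: ultraS (h _) => [k /=|]; first by rewrite hornerC.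
    by apply: ultra_all => k /=; rewrite /ev0 /= horner_evalE hornerX.
  apply: (relation_slope_lt0 (U := U) q_gt0 r_gt0 q_small r_small F0 nF c_ge0).
  move=> G nG.
  have := vE (subst2 q r G) 0; rewrite /D0 deriv0 => h.
  have {}h : U [set k | \sum_i meval (x k) (mderiv i (subst2 q r G)) * v k i = 0].
    apply: ultraS (h _) => [k /=|]; first by rewrite horner0.
    by apply: ultraS nG => k /=; rewrite meval_subst2 rmorph0.
  apply: ultraS (ultraI gv (ultraI rvE h)) => k [/= h1 [h2 h3]].
  move: h3; under eq_bigr do rewrite mderiv_subst2 mulrDl -!mulrA.
  rewrite big_split /= -!mulr_sumr dqE // h2 !mulr1 => /eqP.
  by rewrite addrC mulrN subr_eq0 mulrC => /eqP.
pose ev0 k : {rmorphism {poly {poly R}} -> R} :=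
  horner_eval (rv k) \o horner_eval (qv k)%:P.
pose D0 k (F : {poly {poly R}}) := ev2 F^`() (qv k) (rv k).
have [k y|k y|k|F nF|v vE] := @generic_tangent_vector _ ev0 D0 (polyC \o polyC).
- by rewrite /ev0 /= !horner_evalE !hornerC.
- by rewrite /D0 derivC /ev2 !horner0.
- split=> a b; rewrite /D0 /ev0 /= ?derivD ?ev2D // derivM ev2D !ev2M.
  by rewrite !horner_evalE addrC.
- have [->|F0] := eqVneq F 0.
    by apply: ultra_all => k /=; rewrite /D0 deriv0 /ev2 !horner0.
  by case: indep; exists F.
have gv : U [set k | forall j, \sum_i meval (x k) (mderiv i (g j)) * v k i = 0].
  apply: ultra_forall_ord => j.
  have := vE (g j) 0; rewrite /D0 deriv0 /ev2 => h.
  apply: ultraS (h _) => [k /=|]; first by rewrite !horner0.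
  by apply: ultra_all => k /=; rewrite g0 /ev0 /= !horner_evalE !horner0.
have rvE : U [set k | \sum_i meval (x k) (mderiv i r) * v k i = 0].
  have := vE r ('X%:P); rewrite /D0 derivC /ev2 => h.
  apply: ultraS (h _) => [k /=|]; first by rewrite !horner0.
  by apply: ultra_all => k /=; rewrite /ev0 /= !horner_evalE hornerC hornerX.
have qvE : U [set k | \sum_i meval (x k) (mderiv i q) * v k i = 1].
  have := vE q 'X; rewrite /D0 derivX /ev2 => h.
  apply: ultraS (h _) => [k /=|]; first by rewrite !hornerC.
  by apply: ultra_all => k /=; rewrite /ev0 /= !horner_evalE hornerX hornerC.
have [k [/= h1 [h2 h3]]] := filter_ex (ultraI gv (ultraI rvE qvE)).
move: (dqE k (v k) h1); rewrite h2 h3 mulr0 => /eqP.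
by rewrite oner_eq0.
Qed.

End Tangent.

(** * Lipschitz estimates *)

(* Row vectors are complete: this is used for the contraction principle and
   for Baire's theorem. *)
HB.instance Definition _ (R : realType) m n := Complete.on 'M[R]_(m, n).

Section Norms.
Variable R : realType.

Lemma normr_coord n (x : 'rV[R]_n) i : `|x 0 i| <= `|x|.
Proof.
have /mapP[j Hj ->] : `|x 0 i| \in [seq `|x y.1 y.2| | y : 'I_1 * 'I_n].
  by apply/mapP; exists (0, i) => //=; rewrite mem_enum.
by rewrite [leRHS]/Num.norm /= mx_normrE; apply/bigmax_geP; right => /=; exists j.
Qed.

Lemma normr_row_le n (x : 'rV[R]_n) c :
  0 <= c -> (forall i, `|x 0 i| <= c) -> `|x| <= c.
Proof.
move=> c0 h; rewrite [leLHS]/Num.norm /= mx_normrE; apply/bigmax_leP; split=> //.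
by case=> i j _ /=; rewrite ord1.
Qed.

Lemma fixpoint_ball (V : completeNormedModType R) (c : V) (r k : R)
    (f : V -> V) : 0 <= r -> 0 <= k < 1 ->
  (forall y, `|y - c| <= r -> `|f y - c| <= r) ->
  (forall y z, `|y - c| <= r -> `|z - c| <= r ->
     `|f y - f z| <= k * `|y - z|) ->
  exists2 y, `|y - c| <= r & f y = y.
Proof.
move=> r0 /andP[k0 k1] fB fL; pose U := [set y : V | `|y - c| <= r].
have fU : {homo f : x / U x >-> U x} by move=> y; exact: fB.
pose g : {fun U >-> U} := HB.pack_for {fun U >-> U} f (isFun.Build _ _ U U f fU).
have UE : U = closed_ball_ Num.norm c r.
  by apply/seteqP; split=> y; rewrite /U /closed_ball_ /= distrC.
have ctr : is_contraction g.
  exists (NngNum k0); split; first exact: k1.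
  by move=> [y z] [/= Uy Uz]; exact: fL.
have [||p Up pE] := banach_fixed_point ctr.
- by rewrite UE; exact: closed_closed_ball_.
- by exists c; rewrite /U /= subrr normr0.
by exists p.
Qed.

(** These functions form a ring that contains the inverses of its elements
    bounded away from zero, which is how every coefficient below is seen to be
    Lipschitz. *)
Definition blip (V : normedModType R) (A : set V) (f : V -> R) : Prop :=
  exists C : R, [/\ 0 <= C, forall x, A x -> `|f x| <= C &
    forall x y, A x -> A y -> `|f x - f y| <= C * `|x - y|].

Section Blip.
Variables (V : normedModType R) (A : set V).
Implicit Types f g : V -> R.

Lemma blip_cst c : blip A (fun=> c).
Proof.
by exists `|c|; split=> // x y _ _; rewrite subrr normr0 mulr_ge0.
Qed.

Lemma blipD f g : blip A f -> blip A g -> blip A (fun x => f x + g x).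
Proof.
move=> [C [C0 Cb Cl]] [D [D0 Db Dl]]; exists (C + D); split=> [|x Ax|x y Ax Ay].
- exact: addr_ge0.
- by rewrite (le_trans (ler_normD _ _)) // lerD ?Cb ?Db.
rewrite opprD addrACA (le_trans (ler_normD _ _)) // mulrDl.
by rewrite lerD ?Cl ?Dl.
Qed.

Lemma blipM f g : blip A f -> blip A g -> blip A (fun x => f x * g x).
Proof.
move=> [C [C0 Cb Cl]] [D [D0 Db Dl]].
have CD := mulr_ge0 C0 D0.
exists (C * D + C * D); split=> [|x Ax|x y Ax Ay].
- exact: addr_ge0.
- by rewrite normrM (le_trans (ler_pM _ _ (Cb _ Ax) (Db _ Ax))) // lerDl.
have -> : f x * g x - f y * g y = f x * (g x - g y) + (f x - f y) * g y.
  by ring.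
rewrite (le_trans (ler_normD _ _)) // !normrM mulrDl lerD //.
  by rewrite -mulrA ler_pM // ?Cb ?Dl.
by rewrite mulrAC ler_pM // ?Cl ?Db.
Qed.

Lemma blipN f : blip A f -> blip A (fun x => - f x).
Proof.
move=> [C [C0 Cb Cl]]; exists C; split=> // [x Ax|x y Ax Ay].
  by rewrite normrN Cb.
by rewrite -opprD normrN Cl.
Qed.

Lemma blip_sum (J : Type) (s : seq J) (f : J -> V -> R) :
  (forall j, blip A (f j)) -> blip A (fun x => \sum_(j <- s) f j x).
Proof.
move=> h; elim: s => [|j s ih].
  have -> : (fun x => \sum_(j <- [::]) f j x) = (fun=> 0).
    by apply/funext => x; rewrite big_nil.
  exact: blip_cst.
have -> : (fun x => \sum_(j <- j :: s) f j x) =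
          (fun x => f j x + \sum_(j <- s) f j x).
  by apply/funext => x; rewrite big_cons.
exact: blipD.
Qed.

Lemma blipV f c : 0 < c -> (forall x, A x -> c <= `|f x|) ->
  blip A f -> blip A (fun x => (f x)^-1).
Proof.
move=> c0 cf [C [C0 Cb Cl]].
have fn0 x : A x -> f x != 0.
  by move=> /cf h; rewrite -normr_gt0 (lt_le_trans c0).
have iv x : A x -> `|(f x)^-1| <= c^-1.
  move=> Ax; rewrite normfV lef_pV2 ?posrE ?cf // normr_gt0; exact: fn0.
have ci : 0 <= c^-1 by rewrite invr_ge0 ltW.
exists (c^-1 + c^-1 * c^-1 * C); split=> [|x Ax|x y Ax Ay].
- by rewrite addr_ge0 // !mulr_ge0.
- by rewrite (le_trans (iv _ Ax)) // lerDl !mulr_ge0.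
have -> : (f x)^-1 - (f y)^-1 = (f x)^-1 * (f y)^-1 * (f y - f x).
  by field; rewrite !fn0.
have h1 : `|(f x)^-1| * `|(f y)^-1| <= c^-1 * c^-1 by rewrite ler_pM ?iv.
have h2 : `|f y - f x| <= C * `|x - y| by rewrite distrC Cl.
rewrite !normrM mulrDl ler_wpDl ?mulr_ge0 // -[leRHS]mulrA.
by rewrite ler_pM ?mulr_ge0.
Qed.

Lemma blip_max f c : blip A f -> blip A (fun x => Num.max (f x) c).
Proof.
move=> [C [C0 Cb Cl]]; exists (C + `|c|); split=> [|x Ax|x y Ax Ay].
- exact: addr_ge0.
- have := Cb _ Ax; rewrite /Num.max; case: ifP => _ h.
    by rewrite ler_wpDl.
  by rewrite ler_wpDr.
apply: (@le_trans _ _ (`|f x - f y|)); last first.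
  by rewrite (le_trans (Cl _ _ Ax Ay)) // ler_wpM2r // lerDl.
have := ler_norm (f x - f y); have := ler_norm (f y - f x).
rewrite distrC; set d := `|f x - f y| => d1 d2; rewrite ler_norml.
by rewrite /Num.max; case: ltP => h1; case: ltP => h2; apply/andP; split; lra.
Qed.

Lemma eq_blip f g : (forall x, A x -> f x = g x) -> blip A f -> blip A g.
Proof.
move=> e [C [C0 Cb Cl]]; exists C; split=> // [x Ax|x y Ax Ay].
  by rewrite -e ?Cb.
by rewrite -!e ?Cl.
Qed.

Lemma blip_comp (W : normedModType R) (B : set W) (h : W -> V) (k : R) f :
  (forall x, B x -> A (h x)) ->
  (forall x y, B x -> B y -> `|h x - h y| <= k * `|x - y|) ->
  blip A f -> blip B (f \o h).
Proof.
move=> hB hk [C [C0 Cb Cl]].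
exists (C + C * `|k|); split=> [|x Bx|x y Bx By] /=.
- by rewrite addr_ge0 ?mulr_ge0.
- by rewrite (le_trans (Cb _ (hB _ Bx))) // lerDl mulr_ge0.
rewrite (le_trans (Cl _ _ (hB _ Bx) (hB _ By))) // mulrDl.
rewrite ler_wpDl ?mulr_ge0 // -mulrA ler_wpM2l //.
rewrite (le_trans (hk _ _ Bx By)) // ler_wpM2r //; exact: ler_norm.
Qed.

Lemma blip_prod (J : Type) (s : seq J) (f : J -> V -> R) :
  (forall j, blip A (f j)) -> blip A (fun x => \prod_(j <- s) f j x).
Proof.
move=> h; elim: s => [|j s ih].
  have -> : (fun x => \prod_(j <- [::]) f j x) = (fun=> 1).
    by apply/funext => x; rewrite big_nil.
  exact: blip_cst.
have -> : (fun x => \prod_(j <- j :: s) f j x) =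
          (fun x => f j x * \prod_(j <- s) f j x).
  by apply/funext => x; rewrite big_cons.
exact: blipM.
Qed.

End Blip.
End Norms.

(** * Polynomial maps *)

Section PolyMaps.
Variable R : realType.

Definition pe N (p : mpoly N R) (x : 'rV[R]_N) : R := meval (fun i => x 0 i) p.

Lemma peC N c (x : 'rV[R]_N) : pe (mpolyC N c) x = c.
Proof. exact: mevalC. Qed.
Lemma peX N i (x : 'rV[R]_N) : pe (mpolyX R (mnm1 i)) x = x 0 i.
Proof. exact: mevalXU. Qed.
Lemma peD N p q (x : 'rV[R]_N) : pe (p + q) x = pe p x + pe q x.
Proof. exact: mevalD. Qed.
Lemma peM N p q (x : 'rV[R]_N) : pe (p * q) x = pe p x * pe q x.
Proof. exact: mevalM. Qed.
Lemma peZ N c p (x : 'rV[R]_N) : pe (c *: p) x = c * pe p x.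
Proof. exact: mevalZ. Qed.
Lemma pe0 N (x : 'rV[R]_N) : pe 0 x = 0.
Proof. exact: meval0. Qed.
Lemma pe_sum N (J : Type) (s : seq J) (p : J -> mpoly N R) (x : 'rV[R]_N) :
  pe (\sum_(j <- s) p j) x = \sum_(j <- s) pe (p j) x.
Proof. by rewrite /pe rmorph_sum. Qed.

Lemma pe_mderivX N (i k : 'I_N) (x : 'rV[R]_N) :
  pe (mderiv i (mpolyX R (mnm1 k))) x = (k == i)%:R.
Proof.
rewrite mderivX mnm1E; case: eqP => [->|_]; last by rewrite scale0r pe0.
have -> : mnm_sub (mnm1 i) (mnm1 i) = mnm0.
  by apply/mnmP => j; rewrite mnmBE subnn mnm0E.
by rewrite scale1r mpolyX0 /pe meval1.
Qed.

Definition jac N P (g : 'I_P -> mpoly N R) (x : 'rV[R]_N) : 'M[R]_(N, P) :=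
  \matrix_(i, j) pe (mderiv i (g j)) x.

Definition taylor_rem N (p : mpoly N R) (x v : 'rV[R]_N) : R :=
  pe p (x + v) - pe p x - \sum_i v 0 i * pe (mderiv i p) x.

Lemma blip_coord N (A : set 'rV[R]_N) C i :
  (forall x, A x -> `|x| <= C) -> blip A (fun x => x 0 i).
Proof.
move=> h; exists (Num.max C 1); split.
- by rewrite le_max ler01 orbT.
- move=> x Ax; apply: (le_trans (normr_coord x i)).
  by apply: (le_trans (h _ Ax)); rewrite le_max lexx.
move=> x y _ _; have := normr_coord (x - y) i; rewrite !mxE => le.
by apply: (le_trans le); rewrite ler_peMl // le_max lexx orbT.
Qed.

Lemma blip_pe (V : normedModType R) (A : set V) N (p : mpoly N R)
    (h : V -> 'rV[R]_N) :
  (forall i, blip A (fun z => h z 0 i)) -> blip A (fun z => pe p (h z)).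
Proof.
move=> bh; elim/mpoly_ring_ind: p => [c|i|p q bp bq|p q bp bq].
- by apply: eq_blip (blip_cst A c) => z _; rewrite peC.
- by apply: eq_blip (bh i) => z _; rewrite peX.
- by apply: eq_blip (blipD bp bq) => z _; rewrite peD.
- by apply: eq_blip (blipM bp bq) => z _; rewrite peM.
Qed.

Lemma norm_pair (V W : normedModType R) (z : V * W) :
  `|z| = Num.max `|z.1| `|z.2|.
Proof. by []. Qed.

Lemma norm_fst (V W : normedModType R) (z : V * W) : `|z.1| <= `|z|.
Proof. by rewrite norm_pair le_max lexx. Qed.

Lemma norm_snd (V W : normedModType R) (z : V * W) : `|z.2| <= `|z|.
Proof. by rewrite norm_pair le_max lexx orbT. Qed.

Section Small.
Variables (V W : normedModType R) (X : set V).

Definition slab (e : R) : set (V * W) := [set z | X z.1 /\ `|z.2| <= e].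

(** Up to linear terms, the equations to be solved for the second variable have
    this form: near [y = 0] they are contracting, uniformly in [x]. *)
Definition small (f : V * W -> R) : Prop := forall k, 0 < k ->
  exists e, [/\ 0 < e, e <= 1, forall z, slab e z -> `|f z| <= k &
    forall z z', slab e z -> slab e z' -> `|f z - f z'| <= k * `|z - z'|].

Lemma slab_le e e' : e <= e' -> slab e `<=` slab e'.
Proof. by move=> le z [Xz ze]; split=> //; exact: le_trans le. Qed.

Lemma small0 : small (fun=> 0).
Proof.
move=> k k0; exists 1; split=> // [z _|z z' _ _]; first by rewrite normr0 ltW.
by rewrite subrr normr0 mulr_ge0 // ltW.
Qed.

Lemma smallD f g : small f -> small g -> small (fun z => f z + g z).
Proof.
move=> sf sg k k0; have k20 : 0 < k / 2 by rewrite divr_gt0.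
have [e [e0 e1 fb fl]] := sf _ k20; have [e' [e'0 e'1 gb gl]] := sg _ k20.
have l1 : Num.min e e' <= e by rewrite ge_min lexx.
have l2 : Num.min e e' <= e' by rewrite ge_min lexx orbT.
exists (Num.min e e'); split=> [||z sz|z z' sz sz'].
- by rewrite lt_min e0.
- exact: le_trans e1.
- rewrite (le_trans (ler_normD _ _)) // [leRHS]splitr.
  by rewrite lerD ?fb ?gb //; exact: slab_le sz.
rewrite opprD addrACA (le_trans (ler_normD _ _)) // [X in X * _]splitr mulrDl.
by rewrite lerD ?fl ?gl //; first [exact: slab_le sz|exact: slab_le sz'].
Qed.

Lemma small_blipM b f : blip (slab 1) b -> small f ->
  small (fun z => b z * f z).
Proof.
move=> [C [C0 bb bl]] sf k k0.
have C2 : 0 < 2 * C + 1 by rewrite ltr_wpDl // mulr_ge0.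
have kC : 0 < k / (2 * C + 1) by rewrite divr_gt0.
have kE : k = k / (2 * C + 1) * (2 * C + 1) by rewrite divfK // gt_eqF.
have [e [e0 e1 fb fl]] := sf _ kC; exists e; split=> // [z sz|z z' sz sz'].
  have : `|b z * f z| <= C * (k / (2 * C + 1)).
    by rewrite normrM ler_pM ?bb ?fb //; exact: slab_le sz.
  move/le_trans; apply; move: kE kC; set t := k / _ => kE kC; nra.
have -> : b z * f z - b z' * f z' = b z * (f z - f z') + (b z - b z') * f z'.
  by ring.
apply: (@le_trans _ _ (C * (k / (2 * C + 1) * `|z - z'|) +
                       C * `|z - z'| * (k / (2 * C + 1)))).
  rewrite (le_trans (ler_normD _ _)) // !normrM lerD // ler_pM //;
    rewrite ?bb ?bl ?fb ?fl //;
    by [exact: (slab_le e1 sz)|exact: (slab_le e1 sz')].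
move: (normr_ge0 (z - z')) kE kC; set n := `|z - z'|; set t := k / _.
by move=> n0 -> t0; have := mulr_ge0 (ltW t0) n0; nra.
Qed.

Lemma smallN f : small f -> small (fun z => - f z).
Proof.
move=> sf; have -> : (fun z => - f z) = (fun z => (-1) * f z).
  by apply/funext => z; rewrite mulN1r.
by apply: small_blipM => //; exact: blip_cst.
Qed.

(** Quadratic terms: each factor is of the size of the second variable. *)
Lemma small_vanish2 a b : blip (slab 1) a -> blip (slab 1) b ->
  (forall x, a (x, 0) = 0) -> (forall x, b (x, 0) = 0) ->
  small (fun z => a z * b z).
Proof.
move=> [C [C0 ab al]] [D [D0 bb bl]] a0 b0 k k0.
have CD : 0 <= C * D by rewrite mulr_ge0.
have CD2 : 0 < 2 * (C * D) + 1 by rewrite ltr_wpDl // mulr_ge0.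
have kCD : 0 < k / (2 * (C * D) + 1) by rewrite divr_gt0.
pose e := Num.min 1 (k / (2 * (C * D) + 1)).
have e0 : 0 < e by rewrite lt_min ltr01.
have e1 : e <= 1 by rewrite ge_min lexx.
have ek : 2 * (C * D) * e <= k.
  apply: (@le_trans _ _ (2 * (C * D) * (k / (2 * (C * D) + 1)))).
    by rewrite ler_wpM2l ?mulr_ge0 // ge_min lexx orbT.
  have kE : k = k / (2 * (C * D) + 1) * (2 * (C * D) + 1).
    by rewrite divfK // gt_eqF.
  by move: kE kCD; set t := k / _ => kE kCD; nra.
have van f F z : blip (slab 1) f -> 0 <= F ->
    (forall z z', slab 1 z -> slab 1 z' -> `|f z - f z'| <= F * `|z - z'|) ->
    (forall x, f (x, 0) = 0) -> slab e z -> `|f z| <= F * e.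
  move=> _ F0 fl f0 sz; have s1 := slab_le e1 sz.
  have s0 : slab 1 (z.1, 0) by split; [exact: sz.1|rewrite normr0].
  have := fl _ _ s1 s0; rewrite f0 subr0 => /le_trans; apply.
  rewrite ler_wpM2l // norm_pair /= subrr normr0 subr0.
  by rewrite ge_max ltW //=; exact: sz.2.
have va z : slab e z -> `|a z| <= C * e.
  by apply: van => //; exists C.
have vb z : slab e z -> `|b z| <= D * e.
  by apply: van => //; exists D.
exists e; split=> // [z sz|z z' sz sz'].
  have : `|a z * b z| <= C * e * (D * 1).
    rewrite normrM ler_pM ?va //; apply: le_trans (vb _ sz) _.
    by rewrite ler_wpM2l.
  move/le_trans; apply; move: ek CD e0; set t := C * D; set u := C * e * _.
  have -> : u = t * e by rewrite /u /t; ring.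
  by move=> h1 h2 h3; nra.
have -> : a z * b z - a z' * b z' = a z * (b z - b z') + (a z - a z') * b z'.
  by ring.
apply: (@le_trans _ _ (C * e * (D * `|z - z'|) + C * `|z - z'| * (D * e))).
  rewrite (le_trans (ler_normD _ _)) // !normrM lerD // ler_pM //;
    rewrite ?va ?vb ?al ?bl //;
    by [exact: (slab_le e1 sz)|exact: (slab_le e1 sz')].
have -> : C * e * (D * `|z - z'|) + C * `|z - z'| * (D * e) =
  2 * (C * D) * e * `|z - z'| by ring.
by rewrite ler_wpM2r.
Qed.

Lemma eq_small f g : (forall z, f z = g z) -> small f -> small g.
Proof. by move=> /funext ->. Qed.

End Small.
End PolyMaps.

(** * Solving small Lipschitz systems *)

Section Solve.
Variables (R : realType) (V : normedModType R) (P M : nat) (X : set V).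
Notation W := 'rV[R]_P.

Lemma small_fin n (f : 'I_n -> V * W -> R) : (forall j, small X (f j)) ->
  forall k, 0 < k -> exists e, [/\ 0 < e, e <= 1,
    forall j z, slab X e z -> `|f j z| <= k &
    forall j z z', slab X e z -> slab X e z' ->
      `|f j z - f j z'| <= k * `|z - z'|].
Proof.
elim: n f => [|n ih] f sf k k0.
  by exists 1; split=> // [] [].
have [e [e0 e1 fb fl]] := sf ord0 k k0.
have [e' [e'0 e'1 fb' fl']] := ih (fun j => f (lift ord0 j)) (fun j => sf _) k k0.
have l1 : Num.min e e' <= e by rewrite ge_min lexx.
have l2 : Num.min e e' <= e' by rewrite ge_min lexx orbT.
exists (Num.min e e'); split=> [||j z sz|j z z' sz sz'].
- by rewrite lt_min e0.
- exact: le_trans e1.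
- case: (unliftP ord0 j) => [i ->|->].
    by apply: fb'; exact: (slab_le l2 sz).
  by apply: fb; exact: (slab_le l1 sz).
case: (unliftP ord0 j) => [i ->|->].
  by apply: fl'; [exact: (slab_le l2 sz)|exact: (slab_le l2 sz')].
by apply: fl; [exact: (slab_le l1 sz)|exact: (slab_le l1 sz')].
Qed.

Lemma blip_fin (T : normedModType R) (A : set T) (J : finType) (f : J -> T -> R) :
  (forall j, blip A (f j)) ->
  exists C : R, [/\ 0 <= C, forall j x, A x -> `|f j x| <= C &
    forall j x y, A x -> A y -> `|f j x - f j y| <= C * `|x - y|].
Proof.
move=> /choice[C hC]; have C0 j : 0 <= C j by have [] := hC j.
have le j : C j <= \sum_i C i by rewrite (bigD1 j) //= lerDl sumr_ge0.
exists (\sum_j C j); split=> [|j x Ax|j x y Ax Ay]; first exact: sumr_ge0.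
  by have [_ h _] := hC j; rewrite (le_trans (h _ Ax)).
by have [_ _ h] := hC j; rewrite (le_trans (h _ _ Ax Ay)) // ler_wpM2r.
Qed.

Variables (f : 'I_P -> V * W -> R) (u : 'I_M -> 'I_P -> V * W -> R).
Hypothesis sf : forall j, small X (f j).
Hypothesis f0 : forall j x, f j (x, 0) = 0.
Hypothesis bu : forall a j, blip (slab X 1) (u a j).

Definition small_system (c : 'rV[R]_M) (x : V) (y : W) : W :=
  \row_j (f j (x, y) + \sum_a c 0 a * u a j (x, y)).

(** The right hand side is contracting in [y] near [0], and stays so when the
    terms with coefficients [c] are added.  The Lipschitz constant of the
    solution in [x] is at most the one of the right hand side in [x], up to a
    fixed factor, hence small. *)
Theorem small_system_solution (k : R) : 0 < k ->
  exists2 e : R, 0 < e & forall k' : R, 0 < k' ->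
  exists2 d : R, 0 < d & exists2 y : 'rV[R]_M -> V -> W,
    [/\ forall c x, `|c| <= d -> X x -> `|y c x| <= k' /\ `|y c x| <= e,
        forall c x, `|c| <= d -> X x -> small_system c x (y c x) = y c x &
        forall c x z, `|c| <= d -> X x -> `|z| <= e ->
          small_system c x z = z -> z = y c x] &
    (forall c x x', `|c| <= d -> X x -> X x' ->
       `|y c x - y c x'| <= k * `|x - x'|) /\
    exists C, forall c c' x, `|c| <= d -> `|c'| <= d -> X x ->
       `|y c x - y c' x| <= C * `|c - c'|.
Proof.
move=> k0; pose q := Num.min (k / 4) (1 / 4).
have q0 : 0 < q by rewrite lt_min !divr_gt0.
have qk : q <= k / 4 by rewrite ge_min lexx.
have q4 : q <= 1 / 4 by rewrite ge_min lexx orbT.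
have [e [e0 e1 _ fl]] := small_fin sf q0.
have [C [C0 ub ul]] := @blip_fin _ (slab X 1) ('I_M * 'I_P)%type
  (fun i => u i.1 i.2) (fun i => bu i.1 i.2).
exists e => // k' k'0.
pose D := M%:R * C; have D0 : 0 <= D by rewrite mulr_ge0.
pose m := Num.min (Num.min k' e / 2) q.
have m0 : 0 < m by rewrite lt_min q0 andbT divr_gt0 // lt_min k'0.
have D1 : 0 < D + 1 by rewrite ltr_wpDl.
pose d := m / (D + 1); have d0 : 0 < d by rewrite divr_gt0.
have dm : D * d <= m.
  have : m = d * (D + 1) by rewrite divfK // gt_eqF.
  by move: d0; move: d => d d0 ->; nra.
have mq : m <= q by rewrite ge_min lexx orbT.
have mk : m <= Num.min k' e / 2 by rewrite ge_min lexx.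
have mk' : m <= k' / 2.
  by apply: le_trans mk _; rewrite ler_pM2r ?invr_gt0 // ge_min lexx.
have me : m <= e / 2.
  by apply: le_trans mk _; rewrite ler_pM2r ?invr_gt0 // ge_min lexx orbT.
have sumb (b : R) (F : 'I_M -> R) : (forall a, `|F a| <= b) ->
    `|\sum_a F a| <= M%:R * b.
  move=> h; apply: le_trans (ler_norm_sum _ _ _) _.
  apply: (@le_trans _ _ (\sum_(a < M) b)); first exact: ler_sum.
  by rewrite sumr_const card_ord mulr_natl.
have TL (c : 'rV[R]_M) x (y : W) x' (y' : W) : `|c| <= d -> slab X e (x, y) -> slab X e (x', y') ->
    `|small_system c x y - small_system c x' y'| <=
      2 * q * Num.max `|x - x'| `|y - y'|.
  move=> cd s s'; apply: normr_row_le => [|j].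
    by rewrite mulr_ge0 ?mulr_ge0 ?(ltW q0) // le_max normr_ge0.
  rewrite !mxE opprD addrACA -sumrB (le_trans (ler_normD _ _)) //.
  have -> : 2 * q * Num.max `|x - x'| `|y - y'| =
    q * Num.max `|x - x'| `|y - y'| + q * Num.max `|x - x'| `|y - y'| by ring.
  rewrite lerD //; first exact: (fl j (x, y) (x', y')).
  apply: (@le_trans _ _ (M%:R * (d * (C * Num.max `|x - x'| `|y - y'|)))).
    apply: sumb => a; rewrite -mulrBr normrM ler_pM //.
      exact: le_trans (normr_coord _ _) cd.
    by apply: (ul (a, j)); [exact: (slab_le e1 s)|exact: (slab_le e1 s')].
  have -> : M%:R * (d * (C * Num.max `|x - x'| `|y - y'|)) =
            D * d * Num.max `|x - x'| `|y - y'| by rewrite /D; ring.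
  by rewrite ler_wpM2r ?(le_trans dm) // le_max normr_ge0.
have T0 (c : 'rV[R]_M) x : `|c| <= d -> X x -> `|small_system c x 0| <= m.
  move=> cd Xx; apply: normr_row_le => [|j]; first exact: ltW.
  rewrite !mxE f0 add0r; apply: le_trans dm.
  have -> : D * d = M%:R * (d * C) by rewrite /D; ring.
  apply: sumb => a; rewrite normrM ler_pM //.
    exact: le_trans (normr_coord _ _) cd.
  by apply: (ub (a, j)); split=> //=; rewrite normr0.
have Tm (c : 'rV[R]_M) x (y : W) : `|c| <= d -> X x -> `|y| <= e ->
    `|small_system c x y| <= 1 / 2 * `|y| + m.
  move=> cd Xx ye.
  have s : slab X e (x, y) by [].
  have s0 : slab X e (x, 0 : W) by split=> //=; rewrite normr0 ltW.
  have := TL c x y x 0 cd s s0; rewrite subrr normr0 subr0.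
  rewrite (max_idPr _) // => le.
  rewrite -(subrK (small_system c x 0) (small_system c x y)).
  rewrite (le_trans (ler_normD _ _)) // lerD ?T0 // (le_trans le) //.
  by rewrite ler_wpM2r //; lra.
have Tc (c : 'rV[R]_M) x (y z : W) : `|c| <= d -> X x -> `|y| <= e -> `|z| <= e ->
    `|small_system c x y - small_system c x z| <= 1 / 2 * `|y - z|.
  move=> cd Xx ye ze.
  have := TL c x y x z cd (conj Xx ye) (conj Xx ze).
  rewrite subrr normr0 (max_idPr _) // => /le_trans; apply.
  by rewrite ler_wpM2r //; lra.
have ex (c : 'rV[R]_M) x : exists y : W, `|c| <= d -> X x ->
    `|y| <= e /\ small_system c x y = y.
  have [[cd Xx]|h] := pselect (`|c| <= d /\ X x); last first.
    by exists 0 => cd Xx; case: h.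
  have [||y yz|y z|y ye yE] := @fixpoint_ball R _ (0 : W) e (1 / 2) (small_system c x).
  - exact: ltW.
  - by apply/andP; split; lra.
  - rewrite !subr0 in yz *; rewrite (le_trans (Tm _ _ _ cd Xx yz)) //; lra.
  - by rewrite !subr0; exact: Tc.
  by exists y => _ _; rewrite subr0 in ye.
have [y hy] : exists y : 'rV[R]_M -> V -> W, forall c x, `|c| <= d -> X x ->
    `|y c x| <= e /\ small_system c x (y c x) = y c x.
  have /choice[y hy] : forall c, exists y, forall x, `|c| <= d -> X x ->
      `|y x| <= e /\ small_system c x (y x) = y x.
    by move=> c; have /choice[y hy] := ex c; exists y.
  by exists y.
exists d => //; exists y; split.
- move=> c x cd Xx; have [ye yE] := hy c x cd Xx; split=> //.
  have := Tm c x (y c x) cd Xx ye; rewrite yE => le.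
  by move: le mk'; lra.
- by move=> c x cd Xx; have [] := hy c x cd Xx.
- move=> c x z cd Xx ze zE; have [ye yE] := hy c x cd Xx.
  have := Tc c x z (y c x) cd Xx ze ye; rewrite zE yE => le.
  by apply/eqP; rewrite -subr_eq0 -normr_le0; lra.
- move=> c x x' cd Xx Xx'.
  have [ye yE] := hy c x cd Xx; have [y'e y'E] := hy c x' cd Xx'.
  have := TL c x (y c x) x' (y c x') cd (conj Xx ye) (conj Xx' y'e).
  rewrite yE y'E; set a := `|x - x'|; set b := `|y c x - y c x'| => le.
  have a0 : 0 <= a by exact: normr_ge0.
  have b0 : 0 <= b by exact: normr_ge0.
  have : Num.max a b <= a + b by rewrite ge_max lerDl lerDr a0 b0.
  move: (qk) (q4) (q0) le; move: (Num.max a b) => n; nra.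
exists (2 * D) => c c' x cd c'd Xx.
have [ye yE] := hy c x cd Xx; have [y'e y'E] := hy c' x c'd Xx.
have h1 := Tc c x (y c x) (y c' x) cd Xx ye y'e.
have h2 : `|small_system c x (y c' x) - small_system c' x (y c' x)| <=
    D * `|c - c'|.
  apply: normr_row_le => [|j]; first by rewrite mulr_ge0.
  rewrite !mxE opprD addrACA subrr add0r -sumrB.
  have -> : D * `|c - c'| = M%:R * (`|c - c'| * C) by rewrite /D; ring.
  apply: sumb => a; rewrite -mulrBl normrM ler_pM //.
    by have := normr_coord (c - c') a; rewrite !mxE.
  by apply: (ub (a, j)); split=> //=; exact: le_trans e1.
have := ler_normD (small_system c x (y c x) - small_system c x (y c' x))
  (small_system c x (y c' x) - small_system c' x (y c' x)).
rewrite addrA subrK yE y'E => h3.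
by move: h1 h2 h3; rewrite yE y'E; lra.
Qed.

End Solve.

(** * Displacements along a field of right inverses *)

Lemma taylor_rem0 (R : realType) N (p : mpoly N R) x : taylor_rem p x 0 = 0.
Proof.
by rewrite /taylor_rem addr0 subrr big1 ?subrr // => i _; rewrite mxE mul0r.
Qed.

Section Displacement.
Variables (R : realType) (N P M : nat) (X : set 'rV[R]_N).
Variable A : 'rV[R]_N -> 'M[R]_(P, N).
Variable C : R.
Hypothesis bX : forall x, X x -> `|x| <= C.
Hypothesis bA : forall i j, blip X (fun x => A x i j).

Let Z := slab (W := 'rV[R]_P) X 1.

Lemma blip_fst f : blip X f -> blip Z (fun z => f z.1).
Proof.
apply: (blip_comp (h := fun z : 'rV[R]_N * 'rV[R]_P => z.1) (k := 1)).
  by move=> z [].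
by move=> z z' _ _; rewrite mul1r; exact: (norm_fst (z - z')).
Qed.

Lemma blip_snd j : blip Z (fun z => z.2 0 j).
Proof.
apply: (blip_comp (f := fun y : 'rV[R]_P => y 0 j) (A := [set y | `|y| <= 1])
  (h := fun z : 'rV[R]_N * 'rV[R]_P => z.2) (k := 1)).
- by move=> z [].
- by move=> z z' _ _; rewrite mul1r; exact: (norm_snd (z - z')).
by apply: (@blip_coord _ _ _ 1).
Qed.

Lemma blip_disp i : blip Z (fun z => (z.2 *m A z.1) 0 i).
Proof.
have h : blip Z (fun z => \sum_j z.2 0 j * A z.1 j i).
  apply: blip_sum => j; apply: blipM; first exact: blip_snd.
  exact: (blip_fst (bA j i)).
by apply: eq_blip h => z _; rewrite mxE.
Qed.

Lemma blip_move p : blip Z (fun z => pe p (z.1 + z.2 *m A z.1)).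
Proof.
apply: blip_pe => i.
have h : blip Z (fun z => z.1 0 i + (z.2 *m A z.1) 0 i).
  by apply: blipD; [exact: (blip_fst (blip_coord i bX))|exact: blip_disp].
by apply: eq_blip h => z _; rewrite [RHS]mxE.
Qed.

Lemma blip_base p : blip X (pe p).
Proof. by apply: (@blip_pe R _ X N p (fun x => x)) => i; exact: (blip_coord i bX). Qed.

(** The remainder of a product is a combination of the remainders of the
    factors and of a product of two terms that vanish with the displacement. *)
Lemma small_taylor p : small X (fun z => taylor_rem p z.1 (z.2 *m A z.1)).
Proof.
pose v (z : 'rV[R]_N * 'rV[R]_P) := z.2 *m A z.1.
pose d p z := \sum_i v z 0 i * pe (mderiv i p) z.1.
have bd q : blip Z (d q).
  apply: blip_sum => i; apply: blipM; first exact: blip_disp.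
  exact: (blip_fst (blip_base _)).
have d0 q x : d q (x, 0) = 0.
  by rewrite /d big1 // => i _; rewrite /v mul0mx mxE mul0r.
have s0 : small X (fun _ : 'rV[R]_N * 'rV[R]_P => 0 : R) by exact: small0.
elim/mpoly_ring_ind: p => [c|k|p q sp sq|p q sp sq].
- apply: eq_small s0 => z; rewrite /taylor_rem !peC subrr big1 ?subr0 //.
  by move=> i _; rewrite mderivC pe0 mulr0.
- apply: eq_small s0 => z; rewrite /taylor_rem !peX mxE.
  rewrite (bigD1 k) //= pe_mderivX eqxx mulr1 big1 => [|i ik]; first by ring.
  by rewrite pe_mderivX eq_sym (negbTE ik) mulr0.
- apply: eq_small (smallD sp sq) => z; rewrite /taylor_rem !peD.
  have -> : \sum_i (z.2 *m A z.1) 0 i * pe (mderiv i (p + q)) z.1 =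
            d p z + d q z.
    rewrite /d -big_split /=; apply: eq_bigr => i _.
    by rewrite mderivD peD mulrDr.
  by rewrite /d /v; ring.
have := smallD (smallD (small_blipM (blip_move q) sp)
  (small_blipM (blip_fst (blip_base p)) sq)) (smallD
  (small_vanish2 (bd p) (bd q) (d0 p) (d0 q)) (small_blipM (bd p) sq)).
apply: eq_small => z; rewrite /taylor_rem !peM.
have -> : \sum_i (z.2 *m A z.1) 0 i * pe (mderiv i (p * q)) z.1 =
          d p z * pe q z.1 + pe p z.1 * d q z.
  rewrite /d mulr_suml mulr_sumr -big_split /=; apply: eq_bigr => i _.
  by rewrite mderivM peD !peM /v; ring.
by rewrite /d /v; ring.
Qed.

(** When [A] is a right inverse of a differential, displacing [x] by
    [y *m A x] changes the functions by [y] to first order, so that [y] solves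
    an equation between functions exactly when it is a fixed point of a small
    system.  The displacement inherits the estimates of [y], with constants that
    remain as small as desired because [A] is bounded and Lipschitz. *)
Theorem displacement_solution (f : 'I_P -> 'rV[R]_N * 'rV[R]_P -> R)
    (u : 'I_M -> 'I_P -> 'rV[R]_N * 'rV[R]_P -> R) (k : R) :
  (forall j, small X (f j)) -> (forall j x, f j (x, 0) = 0) ->
  (forall a j, blip Z (u a j)) -> 0 < k ->
  exists2 e : R, 0 < e & forall k' : R, 0 < k' ->
  exists2 d : R, 0 < d & exists2 y : 'rV[R]_M -> 'rV[R]_N -> 'rV[R]_P,
    [/\ forall c x, `|c| <= d -> X x -> `|y c x| <= k' /\ `|y c x| <= e,
        forall c x, `|c| <= d -> X x -> small_system f u c x (y c x) = y c x &
        forall c x z, `|c| <= d -> X x -> `|z| <= e ->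
          small_system f u c x z = z -> z = y c x] &
    [/\ forall c x, `|c| <= d -> X x -> `|y c x *m A x| <= k,
        forall c x x', `|c| <= d -> X x -> X x' ->
          `|y c x *m A x - y c x' *m A x'| <= k * `|x - x'| &
        exists D, forall c c' x, `|c| <= d -> `|c'| <= d -> X x ->
          `|y c x *m A x - y c' x *m A x| <= D * `|c - c'|].
Proof.
move=> sf f0 bu k0.
have [B [B0 Ab Al]] := @blip_fin R _ X ('I_P * 'I_N)%type
  (fun i x => A x i.1 i.2) (fun i => bA i.1 i.2).
pose D := P%:R * B; have D0 : 0 <= D by rewrite mulr_ge0.
have D1 : 0 < 2 * D + 1 by rewrite ltr_wpDl // mulr_ge0.
pose k1 := k / (2 * D + 1); have k10 : 0 < k1 by rewrite divr_gt0.
have kE : k = k1 * (2 * D + 1) by rewrite divfK // gt_eqF.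
have [e e0 he] := small_system_solution sf f0 bu k10.
exists e => // k' k'0.
have k20 : 0 < Num.min k' k1 by rewrite lt_min k'0.
have [d d0 [y [yb ys yu] [yl [E yc]]]] := he _ k20.
have sumb (n : nat) (b : R) (F : 'I_n -> R) : (forall a, `|F a| <= b) ->
    `|\sum_a F a| <= n%:R * b.
  move=> h; apply: le_trans (ler_norm_sum _ _ _) _.
  apply: (@le_trans _ _ (\sum_(a < n) b)); first exact: ler_sum.
  by rewrite sumr_const card_ord mulr_natl.
have mulA_le (z : 'rV[R]_P) x : X x -> `|z *m A x| <= D * `|z|.
  move=> Xx; apply: normr_row_le => [|i]; first by rewrite mulr_ge0.
  rewrite mxE /D -mulrA; apply: sumb => j.
  by rewrite normrM mulrC ler_pM ?normr_coord // (Ab (j, i)).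
exists d => //; exists y; split=> //.
- move=> c x cd Xx; have [] := yb c x cd Xx; rewrite le_min => /andP[].
  by split.
- move=> c x cd Xx; have [] := yb c x cd Xx; rewrite le_min => /andP[_ h] _.
  by rewrite (le_trans (mulA_le _ _ Xx)) // kE; nra.
- move=> c x x' cd Xx Xx'; have := yl c x x' cd Xx Xx'.
  have [] := yb c x' cd Xx'; rewrite le_min => /andP[_ h1] _ h2.
  have -> : y c x *m A x - y c x' *m A x' =
            (y c x - y c x') *m A x + y c x' *m (A x - A x').
    by rewrite mulmxBl mulmxBr addrA subrK.
  apply: (@le_trans _ _ (D * (k1 * `|x - x'|) + P%:R * (k1 * (B * `|x - x'|)))).
    rewrite (le_trans (ler_normD _ _)) // lerD //.
      by rewrite (le_trans (mulA_le _ _ Xx)) // ler_wpM2l.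
    apply: normr_row_le => [|i].
      by rewrite mulr_ge0 // mulr_ge0 ?(ltW k10) // mulr_ge0.
    rewrite mxE; apply: sumb => j; rewrite normrM ler_pM //.
      exact: le_trans (normr_coord _ _) h1.
    by rewrite !mxE (Al (j, i)).
  have -> : D * (k1 * `|x - x'|) + P%:R * (k1 * (B * `|x - x'|)) =
    2 * D * k1 * `|x - x'| by rewrite /D; ring.
  by rewrite ler_wpM2r // kE; nra.
exists (D * E) => c c' x cd c'd Xx; rewrite -mulmxBl.
by rewrite (le_trans (mulA_le _ _ Xx)) // -[leRHS]mulrA ler_wpM2l ?yc.
Qed.

End Displacement.

(** * Homeomorphisms and ambient isotopies *)

Section ContinuityOn.
Implicit Types X Y Z : topologicalType.

(** Continuity on a subset, in a form that composes without subspace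
    topologies. *)
Definition cts_on X Y (A : set X) (f : X -> Y) : Prop :=
  forall x, A x -> forall U, nbhs (f x) U -> nbhs x [set z | A z -> U (f z)].

Lemma cts_onP X Y (A : set X) (f : X -> Y) :
  {within A, continuous f} <-> cts_on A f.
Proof. by rewrite subspace_continuousP; split=> h x Ax U; exact: h. Qed.

Lemma cts_on_comp X Y Z (A : set X) (B : set Y) (f : X -> Y) (g : Y -> Z) :
  (forall x, A x -> B (f x)) -> cts_on A f -> cts_on B g ->
  cts_on A (fun x => g (f x)).
Proof.
move=> AB cf cg x Ax U /(cg _ (AB _ Ax)) /(cf _ Ax).
by apply: filterS => z h Az; apply: (h Az); exact: AB.
Qed.

Lemma cts_on_continuous X Y (A : set X) (f : X -> Y) :
  continuous f -> cts_on A f.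
Proof.
move=> cf x _ U /cf h.
by apply: (@filterS _ (nbhs x) _ (f @^-1` U)); [move=> z h1 _; exact: h1|exact: h].
Qed.

Lemma cts_on_at X Y (A : set X) (f : X -> Y) :
  (forall x, A x -> {for x, continuous f}) -> cts_on A f.
Proof.
move=> cf x /cf h U /h hU.
by apply: (@filterS _ (nbhs x) _ (f @^-1` U)); [move=> z h1 _; exact: h1|exact: hU].
Qed.

Lemma cts_on_sub X Y (A B : set X) (f : X -> Y) :
  B `<=` A -> cts_on A f -> cts_on B f.
Proof.
move=> BA cf x /BA Ax U /(cf _ Ax); apply: filterS => z h /BA; exact: h.
Qed.

Lemma eq_cts_on X Y (A : set X) (f g : X -> Y) :
  (forall x, A x -> f x = g x) -> cts_on A f -> cts_on A g.
Proof.
move=> fg cf x Ax U; rewrite -fg // => /(cf _ Ax).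
by apply: filterS => z h Az; rewrite -fg //; exact: h.
Qed.

Lemma cts_on_pair X Y Z (A : set X) (f : X -> Y) (g : X -> Z) :
  cts_on A f -> cts_on A g -> cts_on A (fun x => (f x, g x)).
Proof.
move=> cf cg x Ax U [[B C] [/= nB nC] BC].
apply: filterS (filterI (cf _ Ax _ nB) (cg _ Ax _ nC)) => z [h1 h2] Az.
by apply: BC; split=> /=; [exact: h1|exact: h2].
Qed.

Lemma compact_homeo X Y (x0 : X) (A : set X) (B : set Y) (f : X -> Y) :
  hausdorff_space Y -> compact A -> cts_on A f ->
  (forall x, A x -> B (f x)) ->
  (forall x x', A x -> A x' -> f x = f x' -> x = x') ->
  (forall y, B y -> exists2 x, A x & f x = y) ->
  homeo_on A B f.
Proof.
move=> hY cA cf AB inj surj; split; first exact/cts_onP.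
have /choice[k hk] : forall y, exists x, B y -> A x /\ f x = y.
  move=> y.
  have [/surj[x Ax xy]|nB] := pselect (B y); first by exists x.
  by exists x0 => /nB.
have kf x : A x -> k (f x) = x.
  by move=> Ax; have [Ak fk] := hk _ (AB _ Ax); exact: inj.
exists k; split=> [|x Ax|y /hk//]; last by split; [exact: AB|exact: kf].
apply/continuous_closedP => C clC; apply/closed_subspaceP.
exists [set f x | x in A `&` C].
  apply: compact_closed => //; apply: continuous_compact.
    by apply/cts_onP; apply: cts_on_sub cf => x [].
  by apply: compact_closedI.
apply/seteqP; split=> y [].
  move=> [x [Ax Cx] <-] By; split=> //.
  by rewrite -[_ (f x)]/(C (k (f x))) kf.
by move=> /= Ck By; split=> //; have [Ak fk] := hk _ By; exists (k y).
Qed.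

Lemma homeo_on_sub_inj X Y (A : set X) (B : set Y) (f : X -> Y) :
  homeo_on A B f -> forall x x', A x -> A x' -> f x = f x' -> x = x'.
Proof.
move=> [_ [k [_ hk _]]] x x' /hk[_ e] /hk[_ e'] xx'.
by rewrite -e -e' xx'.
Qed.

End ContinuityOn.

Section AmbientIsotopic.
Variables (R : realType) (X : topologicalType) (S : set X).
Implicit Types A B C : set X.

Let unit := [set t : R | 0 <= t <= 1].
Let SI : set (X * R) := S `*` unit.

Lemma ambient_isotopic_refl A : ambient_isotopic R S A A.
Proof.
exists (fun x _ => x); split=> //.
- by apply/cts_onP; apply: cts_on_continuous => z; exact: cvg_fst.
- have cid : {within S, continuous (fun x => x)}.
    by apply/cts_onP; apply: cts_on_continuous => z; exact: cvg_id.
  by move=> t _; split=> //; exists (fun x => x); split.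
by rewrite image_id.
Qed.

Lemma homeo_on_comp (f g : X -> X) :
  homeo_on S S f -> homeo_on S S g -> homeo_on S S (g \o f).
Proof.
move=> [/cts_onP cf [k [/cts_onP ck hk kh]]] [/cts_onP cg [l [/cts_onP cl hl lh]]].
split.
  by apply/cts_onP; apply: (cts_on_comp (B := S)) cg => // x /hk[].
exists (k \o l); split=> [|x Sx|x Sx].
- by apply/cts_onP; apply: (cts_on_comp (B := S)) ck => // x /lh[].
- by have [Sf e] := hk _ Sx; have [Sg e'] := hl _ Sf; rewrite /= e' e.
by have [Sf e] := lh _ Sx; have [Sg e'] := kh _ Sf; rewrite /= e' e.
Qed.

Lemma homeo_on_inv (f k : X -> X) :
  {within S, continuous f} -> {within S, continuous k} ->
  (forall x, S x -> S (f x) /\ k (f x) = x) ->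
  (forall x, S x -> S (k x) /\ f (k x) = x) -> homeo_on S S k.
Proof. by move=> cf ck h1 h2; split=> //; exists f. Qed.

Lemma ambient_isotopic_sym A B : A `<=` S ->
  ambient_isotopic R S A B -> ambient_isotopic R S B A.
Proof.
move=> AS [H [/cts_onP cH hH H0 H1]].
have le01 : 0 <= (1 : R) <= (1 : R) by apply/andP; split; lra.
have [c1 [k [ck hk kh]]] := hH 1 le01.
have t01 t : 0 <= t <= 1 -> 0 <= 1 - t <= (1 : R).
  by move=> /andP[? ?]; apply/andP; split; lra.
exists (fun x t => H (k x) (1 - t)); split.
- apply/cts_onP; apply: (cts_on_comp (B := SI)
    (f := fun z : X * R => (k z.1, 1 - z.2))) cH.
    by move=> [x t] [/= Sx tI]; split=> /=; [have [] := kh _ Sx|exact: t01].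
  apply: cts_on_pair.
    move/cts_onP: ck; apply: cts_on_comp; last first.
      by apply: cts_on_continuous => z; exact: cvg_fst.
    by move=> z [].
  apply: cts_on_continuous => z; apply: cvgB; first exact: cvg_cst.
  exact: cvg_snd.
- move=> t tI; apply: (@homeo_on_comp k (H^~ (1 - t))).
    exact: (homeo_on_inv c1).
  by apply: hH; exact: t01.
- by move=> x Sx; rewrite subr0; have [] := kh _ Sx.
rewrite -H1 -[RHS]image_id image_comp; apply: eq_imagel => x Ax /=.
rewrite subrr; have [Sx e] := hk _ (AS _ Ax).
by rewrite e H0 //; exact: AS.
Qed.

Lemma ambient_isotopic_trans A B C :
  ambient_isotopic R S A B -> ambient_isotopic R S B C ->
  ambient_isotopic R S A C.
Proof.
move=> [H [/cts_onP cH hH H0 H1]] [K [/cts_onP cK hK K0 K1]].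
have HS t x : 0 <= t <= 1 -> S x -> S (H x t).
  by move=> tI Sx; have [_ [k [_ h _]]] := hH t tI; have [] := h _ Sx.
exists (fun x t => K (H x t) t); split.
- apply/cts_onP; apply: (cts_on_comp (B := SI)
    (f := fun z : X * R => (H z.1 z.2, z.2))) cK.
    by move=> [x t] [/= Sx tI]; split=> //=; exact: HS.
  apply: cts_on_pair => //.
  by apply: cts_on_continuous => z; exact: cvg_snd.
- by move=> t tI; apply: (@homeo_on_comp (H^~ t) (K^~ t)); [exact: hH|exact: hK].
- move=> x Sx; rewrite H0 // K0 //.
by rewrite -K1 -H1 image_comp.
Qed.

End AmbientIsotopic.

(** Connectedness of the unit interval, for a property that is locally
    constant. *)
Lemma interval_induction (R : realType) (Q : R -> Prop) : Q 0 ->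
  (forall s, 0 <= s <= 1 -> exists2 d : R, 0 < d &
     forall t, 0 <= t <= 1 -> `|t - s| <= d -> (Q s <-> Q t)) -> Q 1.
Proof.
move=> Q0 loc.
pose E := [set s : R | 0 <= s <= 1 /\ Q s].
have E0 : E 0 by split=> //; rewrite lexx ler01.
have ubE : has_ubound E by exists 1 => x [/andP[]].
have hsE : has_sup E by split=> //; exists 0.
have sI : 0 <= sup E <= 1.
  apply/andP; split; first exact: ub_le_sup.
  by apply: ge_sup; [exists 0|move=> x [/andP[]]].
have [d d0 hd] := loc _ sI.
have [s [sI' Qs] sd] := sup_adherent d0 hsE.
have ssup : s <= sup E by apply: ub_le_sup.
have Qsup : Q (sup E).
  by apply/(hd s) => //; rewrite ler_norml; apply/andP; split; lra.
pose t := Num.min (sup E + d) 1.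
have t1 : t <= 1 by rewrite ge_min lexx orbT.
have td : t <= sup E + d by rewrite ge_min lexx.
have [/andP[s0 s1]] := conj sI I => _.
have st : sup E <= t by rewrite le_min s1 andbT lerDl ltW.
have Qt : Q t.
  by apply/(hd t) => //; [apply/andP; split; lra|rewrite ger0_norm; lra].
have tE : t <= sup E by apply: ub_le_sup => //; split=> //; apply/andP; split; lra.
suff : t = 1 by move=> <-.
by move: tE; rewrite {1}/t /Num.min; case: ltP; [lra|move=> _ ?; lra].
Qed.

Section LipschitzContinuity.
Variable R : realType.
Implicit Types V W : normedModType R.

Lemma lip_cts_on V W (A : set V) (f : V -> W) (L : R) :
  (forall x y, A x -> A y -> `|f x - f y| <= L * `|x - y|) -> cts_on A f.
Proof.
move=> fL x Ax U /nbhs_ballP[e /= e0 eU]; apply/nbhs_ballP.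
have L1 : 0 < `|L| + 1 by rewrite ltr_wpDl.
exists (e / (`|L| + 1)); first by rewrite /= divr_gt0.
move=> y; rewrite -ball_normE /= => xy Ay; apply: eU.
rewrite -ball_normE /=; apply: le_lt_trans (fL _ _ Ax Ay) _.
apply: le_lt_trans (_ : (`|L| + 1) * `|x - y| < _).
  by rewrite ler_wpM2r //; have := ler_norm L; lra.
by rewrite mulrC -ltr_pdivlMr.
Qed.

Lemma lip_continuous V W (f : V -> W) (L : R) :
  (forall x y, `|f x - f y| <= L * `|x - y|) -> continuous f.
Proof.
move=> fL x U nU.
have h := @lip_cts_on V W setT f L (fun x y _ _ => fL x y) x I U nU.
by apply: (filterS _ h) => z; apply.
Qed.

Lemma blip_cts_on V (A : set V) (f : V -> R) : blip A f -> cts_on A f.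
Proof. by move=> [C [_ _ h]]; exact: (@lip_cts_on V R A f C). Qed.

End LipschitzContinuity.

(** * Star-shaped hypersurfaces and regular points *)

Section Regular.
Variables (R : realType) (N P : nat).
Implicit Types g : 'I_P -> mpoly N R.

Definition regular g (x : 'rV[R]_N) : Prop :=
  forall y : 'cV[R]_P, jac g x *m y = 0 -> y = 0.

Definition gram g x : 'M[R]_P := (jac g x)^T *m jac g x.

Lemma regular_gram g x : regular g x -> \det (gram g x) != 0.
Proof.
move=> rg; apply/eqP => /eqP/det0P[v v0 vG].
have : jac g x *m v^T = 0.
  have : trmx (jac g x *m trmx v) *m (jac g x *m trmx v) = 0.
    by rewrite trmx_mul trmxK -mulmxA (mulmxA (trmx (jac g x))) mulmxA vG mul0mx.
  set w := jac g x *m v^T => ww.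
  apply/matrixP => i j; rewrite ord1 [RHS]mxE.
  have := congr1 (fun A : 'M[R]_1 => A 0 0) ww; rewrite !mxE.
  under eq_bigr do rewrite mxE -expr2.
  move/eqP; rewrite psumr_eq0 => [/allP/(_ i)|k _]; last exact: sqr_ge0.
  by rewrite mem_index_enum /= sqrf_eq0 => /(_ isT)/eqP; rewrite /w mxE.
by move/rg => vT; move: v0; rewrite -[v]trmxK vT trmx0 eqxx.
Qed.

Lemma regularP g x : regular g x <-> (\rank (jac g x) = P)%N.
Proof.
rewrite -mxrank_tr; split=> [rg|/eqP rk y jy].
  apply/eqP; rewrite -/(row_free _) -kermx_eq0; apply/eqP/row_matrixP => i.
  rewrite row0; set v := row i _.
  have : v *m (jac g x)^T = 0 by apply/sub_kermxP; rewrite row_sub.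
  move/(congr1 trmx); rewrite trmx_mul trmxK trmx0 => /rg.
  by move/(congr1 trmx); rewrite trmxK trmx0.
apply: trmx_inj; rewrite trmx0; apply: (row_free_inj rk).
by rewrite -trmx_mul jy trmx0 mul0mx.
Qed.

(** The differential of a polynomial map is given by its partial derivatives,
    because the Taylor remainder is small. *)
Lemma jacobian_real_map g x : 'J (real_map g) x = jac g x.
Proof.
pose df : {linear 'rV[R]_N -> 'rV[R]_P} := mulmxr (jac g x).
have bX : forall y, [set z : 'rV[R]_N | z = x] y -> `|y| <= `|x| by move=> y ->.
pose C := \sum_i \sum_j `|jac g x i j|.
have C0 : 0 <= C by rewrite sumr_ge0 // => i _; rewrite sumr_ge0.
have cdf : continuous (df : 'rV[R]_N -> 'rV[R]_P).
  apply: (@lip_continuous _ _ _ _ C) => v w; rewrite -linearB /=.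
  apply: normr_row_le => [|j]; first by rewrite mulr_ge0.
  rewrite mxE (le_trans (ler_norm_sum _ _ _)) // /C mulr_suml ler_sum // => i _.
  rewrite normrM mulrC ler_pM ?normr_coord //.
  by rewrite (bigD1 j) //= lerDl sumr_ge0.
have -> : 'J (real_map g) x = lin1_mx df; last first.
  by apply/matrixP => i j; rewrite mxE /= -rowE mxE.
rewrite /jacobian; congr (lin1_mx _); apply: diff_unique => //.
apply/eqaddoP => e e0 /=.
have [d [d0 d1 _ hd]] := small_fin (fun j : 'I_P => small_taylor bX
  (A := fun=> 1%:M) (fun i j => blip_cst _ _) (g j)) e0.
near=> v.
apply: normr_row_le => [|j]; first by rewrite mulr_ge0 // ltW.
have s0 : slab (W := 'rV[R]_N) [set z | z = x] d (x, 0).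
  by split=> //=; rewrite normr0 ltW.
have sv : slab [set z | z = x] d (x, v).
  by split=> //=; near: v; apply/nbhs_ballP; exists d => // w;
    rewrite -ball_normE /= sub0r normrN => /ltW.
have := hd j (x, v) (x, 0) sv s0.
rewrite /= !mulmx1 taylor_rem0 subr0 /taylor_rem norm_pair /= subrr normr0 subr0 (max_idPr _) //.
congr (`|_| <= _).
rewrite !mxE /pe /= opprD addrA [v + x]addrC; congr (_ - _ - _).
by apply: eq_bigr => i _; rewrite mxE.
Unshelve. all: by end_near. Qed.

Lemma sing_setP g x : sing_set (real_map g) x <-> ~ regular g x.
Proof.
rewrite /sing_set /= jacobian_real_map regularP.
have := rank_leq_col (jac g x); rewrite leq_eqVlt => /orP[/eqP e|lt].
  by rewrite e ltnn; split=> [//|h]; case: h.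
by rewrite lt; split=> // _ e; rewrite e ltnn in lt.
Qed.

Lemma zero_setP g x : zero_set (real_map g) x <-> forall j, pe (g j) x = 0.
Proof.
split=> [/= h j|h].
  by have := congr1 (fun y : 'rV_P => y 0 j) h; rewrite !mxE.
by apply/rowP => j; rewrite !mxE; exact: h.
Qed.

Lemma blip_det (T : normedModType R) (A : set T) n (m : T -> 'M[R]_n) :
  (forall i j, blip A (fun t => m t i j)) -> blip A (fun t => \det (m t)).
Proof.
move=> bm; rewrite /determinant; apply: blip_sum => s; apply: blipM.
  exact: blip_cst.
by apply: blip_prod => i.
Qed.

Lemma blip_adj (T : normedModType R) (A : set T) n (m : T -> 'M[R]_n) i j :
  (forall i j, blip A (fun t => m t i j)) -> blip A (fun t => (\adj (m t)) i j).
Proof.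
move=> bm.
have h : blip A (fun t => cofactor (m t) j i).
  rewrite /cofactor; apply: blipM; first exact: blip_cst.
  apply: blip_det => k l.
  apply: eq_blip (bm (lift j k) (lift i l)) => t _.
  by rewrite !mxE.
by apply: eq_blip h => t _; rewrite mxE.
Qed.

Lemma blip_gram X C g i j : (forall x, X x -> `|x| <= C) ->
  blip X (fun x => gram g x i j).
Proof.
move=> bX.
have h : blip X (fun x => \sum_k jac g x k i * jac g x k j).
  apply: blip_sum => k; apply: blipM.
    by apply: eq_blip (blip_base bX (mderiv k (g i))) => x _; rewrite mxE.
  by apply: eq_blip (blip_base bX (mderiv k (g j))) => x _; rewrite mxE.
apply: eq_blip h => x _; rewrite [RHS]mxE.
by apply: eq_bigr => k _; rewrite [in RHS]mxE.
Qed.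

End Regular.

Section Star.
Variables (R : realType) (N : nat) (m : 'I_N -> nat).
Hypothesis m_gt0 : forall i, (0 < m i)%N.

Definition sqpoly : mpoly N R := \sum_i mpolyX R (mnm1 i) ^+ 2.
Definition wpoly : mpoly N R := \sum_i mpolyX R (mnm1 i) ^+ (2 * m i).
Definition star (a b : R) : mpoly N R := a *: sqpoly + b *: wpoly.

Lemma pe_exp (p : mpoly N R) k x : pe (p ^+ k) x = pe p x ^+ k.
Proof. by rewrite /pe rmorphXn. Qed.

Lemma pe_sqpoly x : pe sqpoly x = \sum_i x 0 i ^+ 2.
Proof. by rewrite /sqpoly pe_sum; apply: eq_bigr => i _; rewrite pe_exp peX. Qed.

Lemma pe_wpoly x : pe wpoly x = \sum_i x 0 i ^+ (2 * m i).
Proof. by rewrite /wpoly pe_sum; apply: eq_bigr => i _; rewrite pe_exp peX. Qed.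

Lemma pe_star a b x : pe (star a b) x = a * pe sqpoly x + b * pe wpoly x.
Proof. by rewrite /star peD !peZ. Qed.

Lemma even_pow_ge0 (t : R) k : 0 <= t ^+ (2 * k).
Proof. by rewrite exprM exprn_ge0 // sqr_ge0. Qed.

Lemma sqpoly_ge0 x : 0 <= pe sqpoly x.
Proof. by rewrite pe_sqpoly sumr_ge0 // => i _; exact: sqr_ge0. Qed.

Lemma wpoly_ge0 x : 0 <= pe wpoly x.
Proof. by rewrite pe_wpoly sumr_ge0 // => i _; exact: even_pow_ge0. Qed.

Lemma sqpoly_gt0 x : x != 0 -> 0 < pe sqpoly x.
Proof.
move=> x0; rewrite lt_def sqpoly_ge0 andbT pe_sqpoly psumr_eq0 => [|i _].
  apply: contraNN x0 => /allP h; apply/eqP/rowP => i; rewrite mxE.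
  by have := h i; rewrite mem_index_enum /= sqrf_eq0 => /(_ isT)/eqP.
exact: sqr_ge0.
Qed.

Lemma wpoly_gt0 x : x != 0 -> 0 < pe wpoly x.
Proof.
move=> x0; rewrite lt_def wpoly_ge0 andbT pe_wpoly psumr_eq0 => [|i _].
  apply: contraNN x0 => /allP h; apply/eqP/rowP => i; rewrite mxE.
  have := h i; rewrite mem_index_enum /= expf_eq0 => /(_ isT) /andP[_ /eqP].
  by [].
exact: even_pow_ge0.
Qed.

Lemma pe_mderiv_exp i k (j : 'I_N) x :
  pe (mderiv i (mpolyX R (mnm1 j) ^+ k.+1)) x =
  (j == i)%:R * (k.+1%:R * x 0 j ^+ k).
Proof.
elim: k => [|k ih]; first by rewrite expr1 pe_mderivX expr0 mulr1 mulr1.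
rewrite exprS mderivM peD !peM ih pe_mderivX pe_exp peX.
by rewrite -[k.+2]addn1 natrD exprS; ring.
Qed.

Lemma pe_mderiv_sqpoly i x : pe (mderiv i sqpoly) x = 2 * x 0 i.
Proof.
rewrite /sqpoly raddf_sum pe_sum (bigD1 i) //= pe_mderiv_exp eqxx mul1r expr1.
rewrite big1 ?addr0 // => j ji.
by rewrite pe_mderiv_exp (negbTE ji) mul0r.
Qed.

Lemma pe_mderiv_wpoly i x :
  pe (mderiv i wpoly) x = (2 * m i)%:R * x 0 i ^+ (2 * m i).-1.
Proof.
have E j : mpolyX R (mnm1 j) ^+ (2 * m j) =
           mpolyX R (mnm1 j) ^+ (2 * m j).-1.+1 :> mpoly N R.
  by rewrite prednK // muln_gt0 m_gt0.
rewrite /wpoly raddf_sum pe_sum (bigD1 i) //= E pe_mderiv_exp eqxx mul1r.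
rewrite prednK ?muln_gt0 ?m_gt0 // big1 ?addr0 // => j ji.
by rewrite E pe_mderiv_exp (negbTE ji) mul0r.
Qed.

Definition star_radial (a b : R) (x : 'rV[R]_N) : R :=
  \sum_i x 0 i * pe (mderiv i (star a b)) x.

(** Euler's identity for monomials of degree at least two. *)
Lemma star_radial_ge a b x : 0 <= a -> 0 <= b ->
  2 * pe (star a b) x <= star_radial a b x.
Proof.
move=> a0 b0; rewrite pe_star pe_sqpoly pe_wpoly mulrDr !mulr_sumr -big_split /=.
apply: ler_sum => i _.
rewrite /star mderivD !mderivZ peD !peZ pe_mderiv_sqpoly pe_mderiv_wpoly.
have -> : x 0 i ^+ (2 * m i) = x 0 i * x 0 i ^+ (2 * m i).-1.
  by rewrite -exprS prednK // muln_gt0 m_gt0.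
have h : 0 <= x 0 i * x 0 i ^+ (2 * m i).-1.
  by rewrite -exprS prednK ?muln_gt0 ?m_gt0 // even_pow_ge0.
have m1 : 1 <= (m i)%:R :> R by rewrite ler1n.
rewrite natrM; move: h; set t := _ ^+ _.-1; set u := x 0 i * t => h.
have -> : x 0 i * (a * (2 * x 0 i) + b * (2 * (m i)%:R * t)) =
          2 * (a * x 0 i ^+ 2) + 2 * (b * ((m i)%:R * u)) by rewrite /u; ring.
rewrite lerD2l ler_pM2l // ler_wpM2l //; exact: ler_peMl.
Qed.

Lemma star_scale_lt a b x (s t : R) : 0 <= a -> 0 <= b -> 0 < a + b ->
  x != 0 -> 0 <= s < t -> pe (star a b) (s *: x) < pe (star a b) (t *: x).
Proof.
move=> a0 b0 ab x0 /andP[s0 st].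
have t0 : 0 < t by apply: le_lt_trans st.
have le k : (0 < k)%N -> forall i, (s *: x) 0 i ^+ (2 * k) <= (t *: x) 0 i ^+ (2 * k).
  move=> k0 i; rewrite !mxE !exprMn ler_wpM2r ?even_pow_ge0 //.
  by rewrite lerXn2r ?nnegrE // ltW.
have [i xi] : exists i, x 0 i != 0.
  apply: contrapT => /forallNP h; move/eqP: x0; apply; apply/rowP => i.
  by rewrite mxE; apply/eqP; apply: contra_notT (h i).
have lti k : (0 < k)%N -> (s *: x) 0 i ^+ (2 * k) < (t *: x) 0 i ^+ (2 * k).
  move=> k0; rewrite !mxE !exprMn ltr_pM2r; last first.
    by rewrite exprM exprn_gt0 // exprn_even_gt0.
  by rewrite ltrXn2r ?nnegrE // ?ltW // -lt0n muln_gt0.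
have hq : pe sqpoly (s *: x) < pe sqpoly (t *: x).
  rewrite !pe_sqpoly (bigD1 i) //= [ltRHS](bigD1 i) //=.
  apply: ltr_leD; first exact: (lti 1%N).
  by apply: ler_sum => j _; exact: (le 1%N).
have hr : pe wpoly (s *: x) < pe wpoly (t *: x).
  rewrite !pe_wpoly (bigD1 i) //= [ltRHS](bigD1 i) //=.
  apply: ltr_leD; first exact: lti.
  by apply: ler_sum => j _; exact: le.
rewrite !pe_star; have [a1|a1] := ltP 0 a.
  by apply: ltr_leD; [rewrite ltr_pM2l|rewrite ler_wpM2l // ltW].
have b1 : 0 < b by lra.
by apply: ler_ltD; [rewrite ler_wpM2l // ltW|rewrite ltr_pM2l].
Qed.

(** The bound is uniform in coefficients that are not too small, so that all
    nearby level hypersurfaces lie in one ball. *)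
Lemma star_bounded a b c : 0 <= a -> 0 <= b -> 0 < a + b -> exists C,
  forall a' b' x, a / 2 <= a' -> b / 2 <= b' -> pe (star a' b') x <= c ->
    `|x| <= C.
Proof.
move=> a0 b0 ab.
pose t := Num.max 0 (c / (a / 2 + b / 2)) + 1.
have t1 : 1 <= t by rewrite /t lerDr le_max lexx.
exists t => a' b' x aa' bb' le.
have t0 : 0 <= t by lra.
apply: normr_row_le => [//|i]; rewrite leNgt; apply/negP => xt.
have x1 : 1 <= `|x 0 i| by lra.
have pw k : (0 < k)%N -> t <= x 0 i ^+ (2 * k).
  move=> k0; apply: le_trans (ltW xt) _.
  have -> : x 0 i ^+ (2 * k) = `|x 0 i| ^+ (2 * k).
    by rewrite -normrX ger0_norm // even_pow_ge0.
  rewrite -{1}[`|x 0 i|]expr1; apply: ler_weXn2l => //.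
  by rewrite muln_gt0.
have hq : t <= pe sqpoly x.
  rewrite pe_sqpoly (bigD1 i) //=; apply: le_trans (pw 1%N isT) _.
  by rewrite lerDl sumr_ge0 // => j _; exact: sqr_ge0.
have hr : t <= pe wpoly x.
  rewrite pe_wpoly (bigD1 i) //=; apply: le_trans (pw _ (m_gt0 i)) _.
  by rewrite lerDl sumr_ge0 // => j _; exact: even_pow_ge0.
have ab2 : 0 < a / 2 + b / 2 by lra.
have ct : c < (a / 2 + b / 2) * t.
  rewrite mulrC -ltr_pdivrMr // /t; set u := c / _.
  have : u <= Num.max 0 u by rewrite le_max lexx orbT.
  by move: (Num.max 0 u) => v; lra.
move: le; rewrite pe_star leNgt => /negP; apply.
apply: (lt_le_trans ct); move: hq hr; move: (pe sqpoly x) (pe wpoly x) => q r.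
by move=> hq hr; nra.
Qed.

End Star.

(** * Radial projection *)

Section Radial.
Variables (R : realType) (N : nat) (m : 'I_N -> nat).
Hypothesis m_gt0 : forall i, (0 < m i)%N.

Lemma pe_continuous n (p : mpoly n R) : continuous (pe p).
Proof.
elim/mpoly_ring_ind: p => [c|i|p q cp cq|p q cp cq].
- have -> : pe (mpolyC n c) = (fun=> c) by apply/funext => x; rewrite peC.
  exact: cst_continuous.
- have -> : pe (mpolyX R (mnm1 i)) = (fun x => x 0 i).
    by apply/funext => x; rewrite peX.
  exact: (@coord_continuous R 1 n 0 i).
- have -> : pe (p + q) = (pe p \+ pe q) by apply/funext => x; rewrite peD.
  by move=> x; apply: continuousD; [exact: cp|exact: cq].
have -> : pe (p * q) = (pe p \* pe q) by apply/funext => x; rewrite peM.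
by move=> x; apply: continuousM; [exact: cp|exact: cq].
Qed.

Definition enorm (x : 'rV[R]_N) : R := Num.sqrt (pe (sqpoly R N) x).

Definition radial (r : R) (x : 'rV[R]_N) : 'rV[R]_N := (r / enorm x) *: x.

Lemma sqpolyZ t (x : 'rV[R]_N) :
  pe (sqpoly R N) (t *: x) = t ^+ 2 * pe (sqpoly R N) x.
Proof.
by rewrite !pe_sqpoly mulr_sumr; apply: eq_bigr => i _; rewrite mxE exprMn.
Qed.

Lemma enorm_gt0 x : x != 0 -> 0 < enorm x.
Proof. by move=> x0; rewrite sqrtr_gt0 sqpoly_gt0. Qed.

Lemma esphereE (r : R) : @esphere R N r = [set x | pe (sqpoly R N) x = r ^+ 2].
Proof. by apply/funext => x; rewrite /esphere /= pe_sqpoly. Qed.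

Lemma radial_esphere r x : x != 0 -> esphere r (radial r x).
Proof.
move=> x0; rewrite esphereE /= sqpolyZ exprMn exprVn sqr_sqrtr ?sqpoly_ge0 //.
by rewrite mulfVK // gt_eqF // sqpoly_gt0.
Qed.

Lemma radial_id r x : 0 < r -> esphere r x -> radial r x = x.
Proof.
move=> r0; rewrite esphereE /= => xr.
by rewrite /radial /enorm xr sqrtr_sqr gtr0_norm // divff ?scale1r // gt_eqF.
Qed.

Lemma radial_continuous r x : x != 0 -> {for x, continuous (radial r)}.
Proof.
move=> x0; apply: (@continuousZ R _ _ (fun y => r / enorm y) id).
  apply: continuousM; first exact: cst_continuous.
  apply: continuousV; first by rewrite gt_eqF // enorm_gt0.
  apply: (@continuous_comp _ _ _ (pe (sqpoly R N)) Num.sqrt).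
    exact: pe_continuous.
  exact: sqrt_continuous.
exact: cvg_id.
Qed.

Lemma star0 (a b : R) : pe (star m a b) 0 = 0.
Proof.
rewrite pe_star pe_sqpoly pe_wpoly !big1 ?mulr0 ?addr0 // => i _.
  by rewrite mxE expr0n muln_eq0 /= gtn_eqF ?m_gt0.
by rewrite mxE expr0n.
Qed.

Section Level.
Variables a b : R.
Hypotheses (a0 : 0 <= a) (b0 : 0 <= b) (ab : 0 < a + b).

Definition level : set 'rV[R]_N := [set x | pe (star m a b) x = 1].

Lemma level_neq0 x : level x -> x != 0.
Proof.
by rewrite /level /= => l; apply/eqP => z; move/eqP: l; rewrite z star0
  eq_sym oner_eq0.
Qed.

Lemma level_compact : compact level.
Proof.
have [C hC] := star_bounded m_gt0 1 a0 b0 ab.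
apply: bounded_closed_compact.
  exists C; split; first exact: num_real.
  move=> M CM x lx; apply: ltW; apply: le_lt_trans CM.
  have h (t : R) : 0 <= t -> t / 2 <= t by move=> *; lra.
  by apply: (hC a b x (h _ a0) (h _ b0)); rewrite lx.
exact: (closed_preim (@pe_continuous _ (star m a b)) (@closed_eq R 1)).
Qed.

(** Along a ray a positive combination grows from [0] to infinity. *)
Lemma level_ray x : x != 0 -> exists2 t, 0 < t & level (t *: x).
Proof.
move=> x0.
have [C hC] := star_bounded m_gt0 1 a0 b0 ab.
have nx : 0 < `|x| by rewrite normr_gt0.
pose T := (`|C| + 1) / `|x|.
have T0 : 0 < T by rewrite divr_gt0 // ltr_wpDl.
have big : 1 <= pe (star m a b) (T *: x).
  rewrite leNgt; apply/negP => /ltW h.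
  have h' (t : R) : 0 <= t -> t / 2 <= t by move=> *; lra.
  have := hC a b _ (h' _ a0) (h' _ b0) h.
  rewrite normrZ gtr0_norm // divfK ?gt_eqF //.
  by have := ler_norm C; lra.
pose p : {poly R} := (a * pe (sqpoly R N) x) *: 'X^2 +
  \sum_i (b * x 0 i ^+ (2 * m i)) *: 'X^(2 * m i).
have pE t : p.[t] = pe (star m a b) (t *: x).
  rewrite /p hornerD hornerZ hornerXn horner_sum pe_star sqpolyZ pe_wpoly.
  rewrite mulr_sumr; congr (_ + _); first by ring.
  by apply: eq_bigr => i _; rewrite hornerZ hornerXn mxE exprMn; ring.
have pE1 t : (p - 1%:P).[t] = pe (star m a b) (t *: x) - 1.
  by rewrite hornerD hornerN hornerC pE.
have [|t /andP[t0 tT] /rootP] := poly_ivt (p := p - 1%:P) (ltW T0).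
  by rewrite !pE1 scale0r star0 sub0r subr_ge0 big lerN10.
rewrite pE1 => /eqP; rewrite subr_eq0 => /eqP e.
exists t => //; rewrite lt_def t0 andbT; apply/eqP => z.
by move/eqP: e; rewrite z scale0r star0 eq_sym oner_eq0.
Qed.

Lemma level_homeo r : 0 < r -> homeo_on level (@esphere R N r) (radial r).
Proof.
move=> r0; apply: (compact_homeo 0).
- exact: norm_hausdorff.
- exact: level_compact.
- by apply: cts_on_at => x /level_neq0; exact: radial_continuous.
- by move=> x /level_neq0; exact: radial_esphere.
- have key t x : level x -> level (t *: x) -> 0 < t -> t <= 1.
    move=> lx ltx t0; rewrite leNgt; apply/negP => t1.
    have x0 := level_neq0 lx.
    have : pe (star m a b) (1 *: x) < pe (star m a b) (t *: x).
      by apply: star_scale_lt => //; rewrite ler01.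
    by rewrite scale1r lx ltx ltxx.
  move=> x x' lx lx'; rewrite /radial => e.
  have x0 := level_neq0 lx; have x0' := level_neq0 lx'.
  pose t := enorm x' / enorm x.
  have t0 : 0 < t by rewrite divr_gt0 // enorm_gt0.
  have xE : x' = t *: x.
    have := congr1 (fun y => (r / enorm x')^-1 *: y) e.
    rewrite !scalerA mulVf ?scale1r; last first.
      by rewrite gt_eqF // divr_gt0 // enorm_gt0.
    move=> <-; congr (_ *: _); rewrite /t invf_div mulrA mulfVK //.
    by rewrite gt_eqF.
  have t1 : t <= 1 by apply: (key t x); rewrite -?xE.
  have t1' : t^-1 <= 1.
    apply: (key _ x') => //; rewrite ?invr_gt0 // xE scalerA mulVf ?scale1r //.
    by rewrite gt_eqF.
  have : t = 1.
    apply/eqP; rewrite eq_le t1 /=.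
    by rewrite -(invrK t) invf_ge1 ?invr_gt0.
  by move=> tE; rewrite xE tE scale1r.
move=> y yr.
have y0 : y != 0.
  apply/eqP => z; move: yr; rewrite esphereE /= z.
  have -> : 0 = 0 *: y by rewrite scale0r.
  rewrite sqpolyZ expr0n mul0r => /eqP.
  by rewrite eq_sym sqrf_eq0 gt_eqF.
have [t t0 lt] := level_ray y0; exists (t *: y) => //.
rewrite -[RHS](radial_id r0 yr) /radial scalerA; congr (_ *: _).
rewrite /enorm sqpolyZ sqrtrM ?sqr_ge0 // sqrtr_sqr gtr0_norm //.
have := enorm_gt0 y0; rewrite /enorm => s0.
by field; rewrite !gt_eqF.
Qed.

End Level.
End Radial.

(** * Deforming a level hypersurface together with a variety *)

Lemma compact_pos_lb (R : realType) (T : topologicalType) (A : set T)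
    (h : T -> R) : compact A -> cts_on A h -> (forall x, A x -> 0 < h x) ->
  exists2 c, 0 < c & forall x, A x -> c <= h x.
Proof.
move=> cA /cts_onP ch h0.
have [A0|/nonemptyPn A0] := pselect (A !=set0); last first.
  by exists 1 => // x Ax; rewrite A0 in Ax.
have [x /[!inE] Ax xmin] := compact_EVT_min A0 cA ch.
by exists (h x) => [|y Ay]; [exact: h0|apply: xmin; rewrite inE].
Qed.

Section PolyCons.
Variables (R : realType) (N P : nat).

Definition pcons (p : mpoly N R) (f : 'I_P -> mpoly N R) (j : 'I_P.+1) :
  mpoly N R := if unlift ord0 j is Some i then f i else p.

Lemma pcons0 p f : pcons p f ord0 = p.
Proof. by rewrite /pcons unlift_none. Qed.

Lemma pconsS p f i : pcons p f (lift ord0 i) = f i.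
Proof. by rewrite /pcons liftK. Qed.

End PolyCons.

Section LevelDeformation.
Variables (R : realType) (N P : nat) (m : 'I_N -> nat).
Hypothesis m_gt0 : forall i, (0 < m i)%N.
Variables (f e : 'I_P -> mpoly N R) (a b a' b' : R).
Hypotheses (a0 : 0 <= a) (b0 : 0 <= b) (ab : 0 < a + b).

Let phi := star m a b.
Let g := pcons phi f.
Let g' := pcons (star m a' b') e.

Definition level_variety (c : R) : set 'rV[R]_N :=
  [set x | (forall j, pe (f j + c *: e j) x = 0) /\
           level m (a + c * a') (b + c * b') x].

Hypothesis reg : forall x, (forall j, pe (f j) x = 0) -> level m a b x ->
  regular g x.

(** Small perturbations of a nonnegative coefficient that stay nonnegative keep
    at least half of it. *)
Lemma half_le (s s' : R) : 0 <= s -> exists2 d, 0 < d &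
  forall c, `|c| <= d -> 0 <= s + c * s' -> s / 2 <= s + c * s'.
Proof.
rewrite le_eqVlt => /predU1P[<-|s0].
  by exists 1 => // c _; rewrite mul0r.
have s1 : 0 < `|s'| + 1 by rewrite ltr_wpDl.
exists (s / 2 / (`|s'| + 1)); first by rewrite !divr_gt0.
move=> c cd _; rewrite -lerBlDl.
have h : `|c * s'| <= s / 2.
  rewrite normrM; apply: (@le_trans _ _ (`|c| * (`|s'| + 1))).
    by rewrite ler_wpM2l // lerDl.
  by rewrite -ler_pdivlMr.
by move: h; rewrite ler_norml => /andP[h _]; lra.
Qed.

Let del x := \det (gram g x).
Let radd x := star_radial m a b x.
Let theta x := del x ^+ 2 + \sum_j pe (f j) x ^+ 2.

Lemma blip_del X C : (forall x, X x -> `|x| <= C) -> blip X del.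
Proof. by move=> bX; apply: blip_det => i j; exact: blip_gram bX. Qed.

Lemma blip_del2 X C : (forall x, X x -> `|x| <= C) ->
  blip X (fun x => del x ^+ 2).
Proof.
move=> bX; apply: eq_blip (blipM (blip_del bX) (blip_del bX)) => x _.
by rewrite expr2.
Qed.

(** The Gram determinant does not vanish on the variety, which is compact
    within the level hypersurface; so where [f] is small the differential is
    uniformly surjective. *)
Lemma theta_lb : exists2 t, 0 < t & forall x, level m a b x -> t <= theta x.
Proof.
apply: compact_pos_lb; first exact: level_compact.
  have [C hC] := star_bounded m_gt0 1 a0 b0 ab.
  have bl x : level m a b x -> `|x| <= C.
    move=> lx; have h (t : R) : 0 <= t -> t / 2 <= t by move=> *; lra.
    by apply: (hC a b x (h _ a0) (h _ b0)); rewrite lx.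
  apply/blip_cts_on/blipD; first exact: blip_del2 bl.
  apply: blip_sum => j; apply: eq_blip (blip_base bl (f j ^+ 2)) => x _.
  by rewrite pe_exp.
move=> x lx.
have s0 : 0 <= \sum_j pe (f j) x ^+ 2 by rewrite sumr_ge0 // => j _; exact: sqr_ge0.
rewrite lt_def addr_ge0 ?sqr_ge0 // andbT paddr_eq0 ?sqr_ge0 // negb_and.
have [fz|nz] := pselect (forall j, pe (f j) x = 0).
  by rewrite sqrf_eq0 regular_gram //; exact: reg.
apply/orP; right; apply: contra_notN nz.
rewrite psumr_eq0 => [/allP h j|j _]; last exact: sqr_ge0.
by have := h j; rewrite mem_index_enum /= sqrf_eq0 => /(_ isT)/eqP.
Qed.

Section Frame.
Variable c0 : R.
Hypothesis c00 : 0 < c0.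

Let zeta x := (Num.max (del x ^+ 2) c0)^-1.

(** A right inverse of the differential of [g] where [del ^+ 2 >= c0]; its
    rows stay bounded where the differential degenerates. *)
Definition pinv (x : 'rV[R]_N) : 'M[R]_(P.+1, N) :=
  (del x * zeta x) *: (\adj (gram g x) *m (jac g x)^T).

Lemma pinv_jac x : pinv x *m jac g x = (del x ^+ 2 * zeta x)%:M.
Proof.
rewrite /pinv -scalemxAl -mulmxA -/(gram g x) mul_adj_mx -/(del x).
by rewrite scale_scalar_mx mulrAC expr2.
Qed.

(** The first row is radial, up to rows of [pinv], so that [phi] is controlled
    also where [f] is not. *)
Definition frame (x : 'rV[R]_N) : 'M[R]_(P.+1, N) :=
  \matrix_(j, i) if unlift ord0 j is Some k then pinv x j i
    else x 0 i / radd x - \sum_(k < P)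
      (\sum_l x 0 l / radd x * jac g x l (lift ord0 k)) * pinv x (lift ord0 k) i.

Lemma frame_jac0 x (y : 'rV[R]_P.+1) : radd x != 0 ->
  (y *m frame x *m jac g x) 0 ord0 = y 0 ord0.
Proof.
move=> rx; have pj k j : \sum_i pinv x k i * jac g x i j =
    (del x ^+ 2 * zeta x) *+ (k == j).
  by have := congr1 (fun A : 'M[R]_P.+1 => A k j) (pinv_jac x); rewrite !mxE.
rewrite -mulmxA mxE big_ord_recl big1 ?addr0 => [|k _].
  rewrite mxE.
  have -> : \sum_i frame x ord0 i * jac g x i ord0 = 1.
    under eq_bigr do rewrite mxE unlift_none mulrBl mulr_suml.
    rewrite big_split /= sumrN exchange_big /= [X in _ - X]big1 ?subr0.
      rewrite -(divff rx) {3}/radd /star_radial mulr_suml.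
      by apply: eq_bigr => i _; rewrite mxE /g pcons0 mulrAC.
    move=> k _; under eq_bigr do rewrite -mulrA.
    by rewrite -mulr_sumr pj mulr0.
  by rewrite mulr1.
rewrite mxE; under eq_bigr do rewrite mxE liftK.
by rewrite pj mulr0n mulr0.
Qed.

Lemma frame_jacS x (y : 'rV[R]_P.+1) k : c0 <= del x ^+ 2 ->
  (y *m frame x *m jac g x) 0 (lift ord0 k) = y 0 (lift ord0 k).
Proof.
move=> cd; have z1 : del x ^+ 2 * zeta x = 1.
  rewrite /zeta; have -> : Num.max (del x ^+ 2) c0 = del x ^+ 2.
    exact/max_idPl.
  by rewrite divff // gt_eqF // (lt_le_trans c00).
have pj l j : \sum_i pinv x l i * jac g x i j = (l == j)%:R.
  have := congr1 (fun A : 'M[R]_P.+1 => A l j) (pinv_jac x); rewrite !mxE z1.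
  by rewrite -mulr_natr mul1r.
rewrite -mulmxA mxE big_ord_recl.
have -> : (frame x *m jac g x) ord0 (lift ord0 k) = 0.
  rewrite mxE; under eq_bigr do rewrite mxE unlift_none mulrBl mulr_suml.
  rewrite big_split /= sumrN exchange_big /=.
  have -> : \sum_(j < P) \sum_(i < N) (\sum_l x 0 l / radd x *
      jac g x l (lift ord0 j)) * pinv x (lift ord0 j) i *
      jac g x i (lift ord0 k) = \sum_l x 0 l / radd x * jac g x l (lift ord0 k).
    rewrite (bigD1 k) //= [X in _ + X]big1 ?addr0 => [|j jk].
      under eq_bigr do rewrite -mulrA.
      by rewrite -mulr_sumr pj eqxx mulr1.
    under eq_bigr do rewrite -mulrA.
    by rewrite -mulr_sumr pj (inj_eq lift_inj) (negbTE jk) mulr0.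
  by rewrite subrr.
rewrite mulr0 add0r (bigD1 k) //= big1 ?addr0 => [|j jk].
  rewrite mxE; under eq_bigr do rewrite mxE liftK.
  by rewrite pj eqxx mulr1.
rewrite mxE; under eq_bigr do rewrite mxE liftK.
by rewrite pj (inj_eq lift_inj) (negbTE jk) mulr0.
Qed.

(** Cut-off: the equations of [f] are only imposed near the variety. *)
Definition cutoff (x : 'rV[R]_N) (j : 'I_P.+1) : R :=
  if unlift ord0 j is Some _ then
    Num.max (- Num.max (- (del x ^+ 2 / c0 - 1)) (-1)) 0 else 1.

Lemma cutoff0 x : cutoff x ord0 = 1.
Proof. by rewrite /cutoff unlift_none. Qed.

Lemma cutoffS x k : 2 * c0 <= del x ^+ 2 -> cutoff x (lift ord0 k) = 1.
Proof.
move=> le; rewrite /cutoff liftK.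
have h : 2 <= del x ^+ 2 / c0 by rewrite ler_pdivlMr.
have -> : Num.max (- (del x ^+ 2 / c0 - 1)) (-1) = -1 by apply/max_idPr; lra.
by rewrite opprK; apply/max_idPl; exact: ler01.
Qed.

Section FrameBounds.
Variables (X : set 'rV[R]_N) (C : R).
Hypothesis bX : forall x, X x -> `|x| <= C.
Hypothesis rX : forall x, X x -> 1 <= radd x.

Lemma blip_pinv j i : blip X (fun x => pinv x j i).
Proof.
have h : blip X (fun x => del x * zeta x *
    \sum_k (\adj (gram g x)) j k * jac g x i k).
  apply: blipM.
    apply: blipM; first exact: blip_del bX.
    apply: (@blipV _ _ _ _ c0) => // [x _|].
      by rewrite ger0_norm le_max ?lexx ?orbT // sqr_ge0.
    exact: blip_max (blip_del2 bX).
  apply: blip_sum => k; apply: blipM.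
    by apply: blip_adj => *; exact: blip_gram bX.
  by apply: eq_blip (blip_base bX (mderiv i (g k))) => x _; rewrite mxE.
apply: eq_blip h => x _; rewrite /pinv [RHS]mxE; congr (_ * _).
rewrite [RHS]mxE; apply: eq_bigr => k _; congr (_ * _).
by rewrite [RHS]mxE.
Qed.

Lemma blip_frame j i : blip X (fun x => frame x j i).
Proof.
have brad l : blip X (fun x => x 0 l / radd x).
  apply: blipM; first exact: (blip_coord l bX).
  apply: (@blipV _ _ _ _ 1) => // [x Xx|].
    have r1 := rX Xx; rewrite ger0_norm //.
    exact: le_trans ler01 r1.
  apply: blip_sum => k; apply: blipM; first exact: (blip_coord k bX).
  exact: (blip_base bX).
case: (unliftP ord0 j) => [k ->|->].
  by apply: eq_blip (blip_pinv (lift ord0 k) i) => x _; rewrite [RHS]mxE liftK.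
have h : blip X (fun x => x 0 i / radd x - \sum_(k < P)
    (\sum_l x 0 l / radd x * jac g x l (lift ord0 k)) * pinv x (lift ord0 k) i).
  apply: blipD; first exact: brad.
  apply/blipN/blip_sum => k; apply: blipM; last exact: blip_pinv.
  apply: blip_sum => l; apply: blipM; first exact: brad.
  by apply: eq_blip (blip_base bX (mderiv l (g (lift ord0 k)))) => x _; rewrite mxE.
by apply: eq_blip h => x _; rewrite [RHS]mxE unlift_none.
Qed.

Lemma blip_cutoff j : blip X (fun x => cutoff x j).
Proof.
case: (unliftP ord0 j) => [k ->|->].
  have h : blip X (fun x => Num.max (- Num.max (- (del x ^+ 2 / c0 - 1)) (-1)) 0).
    apply/blip_max/blipN/blip_max/blipN/blipD; last exact: blip_cst.
    by apply: blipM; [exact: blip_del2 bX|exact: blip_cst].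
  by apply: eq_blip h => x _; rewrite /cutoff liftK.
by apply: eq_blip (blip_cst X 1) => x _; rewrite cutoff0.
Qed.

End FrameBounds.
End Frame.
End LevelDeformation.

Section LocalIsotopy.
Variables (R : realType) (N P : nat) (m : 'I_N -> nat).
Hypothesis m_gt0 : forall i, (0 < m i)%N.
Variables (f e : 'I_P -> mpoly N R) (a b a' b' : R).
Hypotheses (a0 : 0 <= a) (b0 : 0 <= b) (ab : 0 < a + b).
Hypothesis reg : forall x, (forall j, pe (f j) x = 0) -> level m a b x ->
  regular (pcons (star m a b) f) x.

Let Z c := level_variety m f e a b a' b' c.
Let Q c := level m (a + c * a') (b + c * b').
Let adm d c := [/\ `|c| <= d, 0 <= a + c * a' & 0 <= b + c * b'].

Lemma pe_star_shift c x : pe (star m (a + c * a') (b + c * b')) x =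
  pe (star m a b) x + c * pe (star m a' b') x.
Proof. by rewrite !pe_star; ring. Qed.

(** The displacement [K c x = y *m frame x] is chosen so that the value of the
    perturbed [phi] at [x + K c x] is that of [phi] at [x], and likewise for the
    components of [f] where the cut-off is [1], that is near the variety.
    Being a contraction it makes [x + K c x] injective, and surjective by the
    fixed point theorem.  A point displaced into the perturbed variety has small
    values of [f], hence lies where the equations of [f] are imposed, and
    therefore on the variety. *)
Lemma level_deformation : exists2 d : R, 0 < d &
  exists K : R -> 'rV[R]_N -> 'rV[R]_N,
  [/\ forall c, adm d c -> 0 < a + c * a' + (b + c * b'),
      cts_on [set z : 'rV[R]_N * R | Q 0 z.1 /\ `|z.2| <= d]
        (fun z => z.1 + K z.2 z.1),
      forall x, Q 0 x -> K 0 x = 0 &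
   forall c, adm d c ->
   [/\ forall x, Q 0 x -> Q c (x + K c x),
       forall x x', Q 0 x -> Q 0 x' -> x + K c x = x' + K c x' -> x = x',
       forall z, Q c z -> exists2 x, Q 0 x & x + K c x = z,
       forall x, Z 0 x -> Z c (x + K c x) &
       forall x, Q 0 x -> Z c (x + K c x) -> Z 0 x]].
Proof.
pose phi := star m a b; pose g := pcons phi f; pose g' := pcons (star m a' b') e.
have [C hC] := star_bounded m_gt0 2 a0 b0 ab.
pose B := Num.max C 0 + 1.
have CB : C <= B - 1 by rewrite /B addrK le_max lexx.
pose X := [set x : 'rV[R]_N | `|x| <= B /\ 1 / 2 <= pe phi x].
have bX x : X x -> `|x| <= B by case.
pose Bd := [set x : 'rV[R]_N | `|x| <= B].
have [L [L0 _ Ll]] := blip_fin (fun j => blip_base (X := Bd) (fun x h => h) (g j)).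
have [B' [B'0 Bb _]] := blip_fin (fun j => blip_base (X := Bd) (fun x h => h) (g' j)).
have rX x : X x -> 1 <= star_radial m a b x.
  by move=> [_ px]; apply: le_trans (star_radial_ge m_gt0 x a0 b0); rewrite -/phi; lra.
have rX0 x : X x -> star_radial m a b x != 0.
  by move=> /rX h; rewrite gt_eqF // (lt_le_trans ltr01).
have [t t0 ht] := theta_lb m_gt0 a0 b0 ab reg.
pose c0 := t / 4; have c00 : 0 < c0 by rewrite divr_gt0.
pose A := frame m f a b c0; pose cut := cutoff m f a b c0.
have bA j i : blip X (fun x => A x j i) by exact: blip_frame bX rX j i.
have bc j : blip X (fun x => cut x j) by exact: blip_cutoff bX j.
pose tau := Num.min 1 (t / (2 * (P%:R + 1))).
have P1 : 0 < (P%:R + 1 : R) by rewrite ltr_wpDl.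
have tau0 : 0 < tau by rewrite lt_min ltr01 divr_gt0 // mulr_gt0.
have tau1 : tau <= 1 by rewrite ge_min lexx.
have tauP : P%:R * tau <= t / 2.
  have h : tau <= t / (2 * (P%:R + 1)) by rewrite ge_min lexx orbT.
  apply: (@le_trans _ _ ((P%:R + 1) * tau)); first by rewrite mulrDl mul1r lerDl ltW.
  apply: (@le_trans _ _ ((P%:R + 1) * (t / (2 * (P%:R + 1))))).
    by rewrite ler_pM2l.
  have -> // : (P%:R + 1) * (t / (2 * (P%:R + 1))) = t / 2.
  by field; rewrite gt_eqF.
pose s := Num.min (tau / 2) (1 / 4).
have s0 : 0 < s by rewrite lt_min !divr_gt0.
have st : s <= tau / 2 by rewrite ge_min lexx.
have s4 : s <= 1 / 4 by rewrite ge_min lexx orbT.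
have L1 : 0 < L + 1 by rewrite ltr_wpDl.
have B1 : 0 < B' + 1 by rewrite ltr_wpDl.
pose k := Num.min (1 / 2) (s / (L + 1)).
have k0 : 0 < k by rewrite lt_min !divr_gt0.
have k2 : k <= 1 / 2 by rewrite ge_min lexx.
have kL : L * k <= s.
  have h : k <= s / (L + 1) by rewrite ge_min lexx orbT.
  have hs : s = s / (L + 1) * (L + 1) by rewrite divfK // gt_eqF.
  by move: h hs; move: (s / _) => u h ->; nra.
pose fs j (z : 'rV[R]_N * 'rV[R]_P.+1) :=
  - cut z.1 j * taylor_rem (g j) z.1 (z.2 *m A z.1).
pose us (_ : 'I_1) j (z : 'rV[R]_N * 'rV[R]_P.+1) :=
  - cut z.1 j * pe (g' j) (z.1 + z.2 *m A z.1).
have sf j : small X (fs j).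
  apply: small_blipM; last exact: (small_taylor bX bA).
  exact: (@blip_fst R N P.+1 X (fun x => - cut x j) (blipN (bc j))).
have f0 j x : fs j (x, 0) = 0 by rewrite /fs /= mul0mx taylor_rem0 mulr0.
have bu i j : blip (slab X 1) (us i j).
  apply: blipM; first exact: (@blip_fst R N P.+1 X (fun x => - cut x j) (blipN (bc j))).
  exact: (blip_move bX bA).
have [ey ey0 hy] := displacement_solution bA sf f0 bu k0.
have [d1 d10 [y [yb ys yu] [Kb Kl [D KD]]]] := hy 1 ltr01.
have [da da0 hda] := half_le a' a0; have [db db0 hdb] := half_le b' b0.
pose d := Num.min (Num.min d1 (s / (B' + 1))) (Num.min da db).
have d0 : 0 < d by rewrite !lt_min d10 da0 db0 divr_gt0.
have [dd1 dB dda ddb] : [/\ d <= d1, d <= s / (B' + 1), d <= da & d <= db].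
  have := lexx d; rewrite {2}/d !le_min.
  by case/andP => /andP[-> ->] /andP[-> ->].
have dBs c u : `|c| <= d -> `|u| <= B' -> `|c * u| <= s.
  move=> cd uB; have hs : s = s / (B' + 1) * (B' + 1) by rewrite divfK // gt_eqF.
  rewrite normrM; apply: (@le_trans _ _ (s / (B' + 1) * (B' + 1))); last by rewrite -hs.
  apply: ler_pM => //; first exact: le_trans cd dB.
  by apply: le_trans uB _; rewrite lerDl.
pose K (c : R) x := y (const_mx c) x *m A x.
have nc (c : R) : `|const_mx c : 'rV[R]_1| <= `|c|.
  by apply: normr_row_le => // i; rewrite mxE.
have cd1 c : `|c| <= d -> `|const_mx c : 'rV[R]_1| <= d1.
  by move=> cd; apply: le_trans (nc c) (le_trans cd dd1).
have Q0E x : Q 0 x <-> pe phi x = 1.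
  by rewrite /Q !mul0r !addr0.
have half (u : R) : 0 <= u -> u / 2 <= u by move=> *; lra.
have QX x : Q 0 x -> X x.
  move=> /Q0E lx; split; last by rewrite lx; lra.
  have := hC a b x (half _ a0) (half _ b0); rewrite -/phi lx => h.
  have h12 : (1 : R) <= 2 by lra.
  by move: CB (h h12); lra.
have sysE c x : `|c| <= d -> X x -> forall j,
    y (const_mx c) x 0 j = - cut x j * (pe (g j) (x + K c x) - pe (g j) x -
      (K c x *m jac g x) 0 j + c * pe (g' j) (x + K c x)).
  move=> cd Xx j.
  have := congr1 (fun r : 'rV_P.+1 => r 0 j) (ys _ _ (cd1 _ cd) Xx).
  rewrite !mxE big_ord1 mxE /fs /us /= => <-.
  rewrite /taylor_rem -/(K c x).
  have -> : \sum_i K c x 0 i * pe (mderiv i (g j)) x =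
            \sum_i K c x 0 i * jac g x i j.
    by apply: eq_bigr => i _; congr (_ * _); rewrite mxE.
  by ring.
have phiE c x : `|c| <= d -> X x ->
    pe phi (x + K c x) + c * pe (star m a' b') (x + K c x) = pe phi x.
  move=> cd Xx; have := sysE c x cd Xx ord0.
  rewrite /cut cutoff0 frame_jac0 ?rX0 // /g /g' !pcons0 => h.
  by move: h; lra.
have fE c x j : `|c| <= d -> X x -> 2 * c0 <= \det (gram g x) ^+ 2 ->
    pe (f j) (x + K c x) + c * pe (e j) (x + K c x) = pe (f j) x.
  move=> cd Xx gx; have := sysE c x cd Xx (lift ord0 j).
  have gx' : c0 <= \det (gram g x) ^+ 2 by move: c00 gx; lra.
  rewrite /cut cutoffS // frame_jacS // /g /g' !pconsS => h.
  by move: h; lra.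
have gramE x : Q 0 x -> \sum_j pe (f j) x ^+ 2 <= t / 2 ->
    2 * c0 <= \det (gram g x) ^+ 2.
  by move=> /Q0E lx le; have := ht x lx; rewrite /c0 -/phi -/g; lra.
have QcX c z : adm d c -> Q c z -> `|z| <= B - 1 /\ `|pe phi z - 1| <= 1 / 4.
  move=> [cd ca cb] lz.
  have zB : `|z| <= B - 1.
    apply: le_trans CB; apply: (hC (a + c * a') (b + c * b')).
    - by apply: hda => //; exact: le_trans dda.
    - by apply: hdb => //; exact: le_trans ddb.
    by rewrite lz; lra.
  split=> //; move: lz; rewrite /Q /level /= pe_star_shift -/phi => lz.
  have -> : pe phi z - 1 = - (c * pe (star m a' b') z) by rewrite -lz; ring.
  rewrite normrN; apply: le_trans s4; apply: dBs => //.
  rewrite -(pcons0 (star m a' b') e) -/g'; apply: Bb.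
  by rewrite /Bd /=; move: zB; lra.
have Lphi x z : `|x| <= B -> `|z| <= B -> `|x - z| <= k ->
    `|pe phi x - pe phi z| <= s.
  move=> xB zB xz; have := Ll ord0 x z xB zB; rewrite /g pcons0 => /le_trans.
  by apply; apply: le_trans kL; rewrite ler_wpM2l.
have Lf x z j : `|x| <= B -> `|z| <= B -> `|x - z| <= k ->
    `|pe (f j) x - pe (f j) z| <= s.
  move=> xB zB xz; have := Ll (lift ord0 j) x z xB zB; rewrite /g pconsS.
  by move=> /le_trans; apply; apply: le_trans kL; rewrite ler_wpM2l.
exists d => //; exists K; split.
- move=> c [cd ca cb].
  have h1 := hda c (le_trans cd dda) ca; have h2 := hdb c (le_trans cd ddb) cb.
  by apply: lt_le_trans (lerD h1 h2); rewrite -mulrDl divr_gt0.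
- apply: (@lip_cts_on R _ _ _ _ (2 + `|D|)) => -[x c] [x' c'] /= [lx cd] [lx' c'd].
  have Xx := QX _ lx; have Xx' := QX _ lx'.
  have -> : x + K c x - (x' + K c' x') =
      (x - x') + (K c x - K c x') + (K c x' - K c' x').
    by rewrite opprD addrACA -[RHS]addrA; congr (_ + _); rewrite [RHS]addrA subrK.
  have h1 := Kl _ _ _ (cd1 _ cd) Xx Xx'.
  have h2 := KD _ _ _ (cd1 _ cd) (cd1 _ c'd) Xx'.
  have h3 : `|const_mx c - const_mx c' : 'rV[R]_1| <= `|c - c'|.
    by apply: normr_row_le => // i; rewrite !mxE.
  rewrite -/(K c x) -/(K c x') in h1; rewrite -/(K c x') -/(K c' x') in h2.
  rewrite norm_pair /=; set n := Num.max _ _.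
  have n1 : `|x - x'| <= n by rewrite le_max lexx.
  have n2 : `|c - c'| <= n by rewrite le_max lexx orbT.
  have h4 : `|K c x' - K c' x'| <= `|D| * n.
    apply: le_trans h2 _.
    apply: (@le_trans _ _ (`|D| * `|const_mx c - const_mx c' : 'rV[R]_1|)).
      by rewrite ler_wpM2r // ler_norm.
    by rewrite ler_wpM2l // (le_trans h3).
  apply: le_trans (ler_normD _ _) _; rewrite mulrDl lerD //.
  apply: le_trans (ler_normD _ _) _; rewrite mulr_natl mulr2n lerD //.
  by apply: le_trans h1 _; have := normr_ge0 (x - x'); nra.
- move=> x lx; rewrite /K; have c00' : `|const_mx 0 : 'rV[R]_1| <= d1.
    by apply: cd1; rewrite normr0 ltW.
  have <- : 0 = y (const_mx 0) x.
    apply: yu => //; [exact: QX|by rewrite normr0 ltW|].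
    apply/rowP => j; rewrite !mxE f0 add0r big1 // => i _.
    by rewrite mxE mul0r.
  by rewrite mul0mx.
move=> c adc; have [cd ca cb] := adc; split.
- move=> x lx; have Xx := QX _ lx.
  by rewrite /Q /level /= pe_star_shift -/phi phiE //; apply/Q0E.
- move=> x x' lx lx' xx'.
  have := Kl _ _ _ (cd1 _ cd) (QX _ lx) (QX _ lx').
  rewrite -/(K c x) -/(K c x').
  have -> : K c x - K c x' = x' - x.
    have -> : K c x = x' + K c x' - x by rewrite -xx' addrC addKr.
    by rewrite addrAC addrK.
  rewrite distrC => le.
  have : `|x - x'| <= 0 by have := normr_ge0 (x - x'); nra.
  by rewrite normr_le0 subr_eq0 => /eqP.
- move=> z lz; have [zB zphi] := QcX c z adc lz.
  have ballX x : `|x - z| <= k -> X x.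
    move=> xz; have xB : `|x| <= B.
      rewrite -(subrK z x); apply: le_trans (ler_normD _ _) _.
      by move: xz zB k2; lra.
    split=> //; have zB' : `|z| <= B by move: zB; lra.
    have := Lphi x z xB zB' xz; move: zphi s4; rewrite !ler_norml.
    by move=> /andP[? ?] ? /andP[? ?]; lra.
  have [||x|x x'|x xz xE] := @fixpoint_ball R _ (z : 'rV[R]_N) k (1 / 2)
    (fun x => z - K c x).
  + exact: ltW.
  + by apply/andP; split; lra.
  + move=> xz; rewrite addrAC subrr add0r normrN.
    by apply: Kb; [exact: cd1|exact: ballX].
  + move=> xz x'z; rewrite opprB addrC addrA subrK distrC.
    have := Kl _ _ _ (cd1 _ cd) (ballX _ xz) (ballX _ x'z).
    move/le_trans; apply; rewrite ler_wpM2r //.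
  have Xx := ballX _ xz.
  have xKz : x + K c x = z by rewrite -{1}xE subrK.
  exists x => //; apply/Q0E; rewrite -(phiE c x) // xKz.
  by rewrite /phi -pe_star_shift.
- move=> x [zx lx].
  have lx' : Q 0 x by [].
  have gx : 2 * c0 <= \det (gram g x) ^+ 2.
    apply: gramE => //; rewrite big1 ?divr_ge0 ?ltW // => j _.
    by have := zx j; rewrite peD peZ mul0r addr0 => ->; rewrite expr0n.
  have Xx := QX _ lx'; split.
    move=> j; rewrite peD peZ fE //.
    by have := zx j; rewrite peD peZ mul0r addr0.
  by rewrite /level /= pe_star_shift -/phi phiE //; apply/Q0E.
move=> x lx [zz lz]; have Xx := QX _ lx.
set z := x + K c x in zz lz *.
have [zB _] := QcX c z adc lz.
have xz : `|x - z| <= k.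
  by rewrite /z opprD addNKr normrN; apply: Kb => //; exact: cd1.
have zB' : `|z| <= B by move: zB; lra.
have fx j : `|pe (f j) x| <= tau.
  have h1 := Lf x z j (bX _ Xx) zB' xz.
  have h2 : `|c * pe (e j) z| <= s.
    by apply: dBs => //; rewrite -(pconsS (star m a' b') e j); apply: Bb.
  have := zz j; rewrite peD peZ => h3.
  have -> : pe (f j) x = (pe (f j) x - pe (f j) z) - c * pe (e j) z.
    by rewrite -addrA -opprD h3 subr0.
  by apply: le_trans (ler_normB _ _) _; move: h1 h2 st; lra.
have gx : 2 * c0 <= \det (gram g x) ^+ 2.
  apply: gramE => //; apply: le_trans tauP.
  rewrite mulr_natl -[P in X in _ <= X]card_ord -sumr_const; apply: ler_sum => j _.
  have -> : pe (f j) x ^+ 2 = `|pe (f j) x| ^+ 2.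
    by rewrite -normrX ger0_norm ?sqr_ge0.
  apply: (@le_trans _ _ (tau * 1)); last by rewrite mulr1.
  by rewrite expr2 ler_pM // (le_trans (fx j)).
split=> [j|//]; rewrite peD peZ mul0r addr0 -(fE c x j) //.
by have := zz j; rewrite peD peZ.
Qed.

End LocalIsotopy.

(** * Isotopies of links *)

Section IsotopyOfLinks.
Variables (R : realType) (N P : nat) (m : 'I_N -> nat).
Hypothesis m_gt0 : forall i, (0 < m i)%N.
Variable r : R.
Hypothesis r0 : 0 < r.

Let S := @esphere R N r.

Lemma esphere_level : S = level m (r ^- 2) 0.
Proof.
rewrite /S esphereE; apply/funext => x; apply/propext.
rewrite /level /= pe_star mul0r addr0.
have r2 : r ^+ 2 != 0 by rewrite sqrf_eq0 gt_eqF.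
split=> [->|h]; first by rewrite mulVf.
by rewrite -[LHS]mul1r -{1}(divff r2) -mulrA h mulr1.
Qed.

Lemma esphere_compact : compact S.
Proof.
have rr : 0 < r ^- 2 by rewrite invr_gt0 exprn_gt0.
by rewrite esphere_level; apply: level_compact; rewrite ?addr0 // ltW.
Qed.

Section Local.
Variables (f e : 'I_P -> mpoly N R) (a b a' b' : R).
Hypotheses (a0 : 0 <= a) (b0 : 0 <= b) (ab : 0 < a + b).
Hypothesis reg : forall x, (forall j, pe (f j) x = 0) -> level m a b x ->
  regular (pcons (star m a b) f) x.

Let Z c := level_variety m f e a b a' b' c.

(** Conjugate the near-identity maps by the radial projections of the level
    hypersurfaces, and let the parameter run from [0] to [c]. *)
Lemma local_isotopy : exists2 d : R, 0 < d & forall c, `|c| <= d ->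
  0 <= a + c * a' -> 0 <= b + c * b' ->
  ambient_isotopic R S [set radial r x | x in Z 0] [set radial r x | x in Z c].
Proof.
have [d d0 [K [pos cK K0 hK]]] := level_deformation m_gt0 e a' b' a0 b0 ab reg.
exists d => // c cd ca cb.
pose Q c := level m (a + c * a') (b + c * b').
have Q0 : Q 0 = level m a b by rewrite /Q !mul0r !addr0.
have [crad [p [/cts_onP cp hp kp]]] := level_homeo m_gt0 a0 b0 ab r0.
rewrite -Q0 in crad hp kp.
have adt t : 0 <= t <= 1 -> [/\ `|t * c| <= d, 0 <= a + t * c * a' &
    0 <= b + t * c * b'].
  move=> /andP[t0 t1]; split.
  - by rewrite normrM ger0_norm // (le_trans _ cd) // ler_piMl.
  - have -> : a + t * c * a' = (1 - t) * a + t * (a + c * a') by ring.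
    by rewrite addr_ge0 // mulr_ge0 // subr_ge0.
  have -> : b + t * c * b' = (1 - t) * b + t * (b + c * b') by ring.
  by rewrite addr_ge0 // mulr_ge0 // subr_ge0.
have rhom t : 0 <= t <= 1 -> homeo_on (Q (t * c)) S (radial r).
  move=> tI; have [h1 h2 h3] := adt t tI.
  by apply: level_homeo => //; exact: pos.
have HS x t : 0 <= t <= 1 -> S x -> Q (t * c) (p x + K (t * c) (p x)).
  move=> tI Sx; have [Qp _] := kp _ Sx.
  by have [h _ _ _ _] := hK _ (adt t tI); exact: h.
pose H x t := radial r (p x + K (t * c) (p x)).
have cH : cts_on (S `*` [set t : R | 0 <= t <= 1]) (fun z => H z.1 z.2).
  pose A := [set z : 'rV[R]_N * R | Q 0 z.1 /\ `|z.2| <= d].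
  have c1 : cts_on (S `*` [set t : R | 0 <= t <= 1])
      (fun z => (p z.1, z.2 * c)).
    apply: cts_on_pair.
      apply: (cts_on_comp (B := S)) cp; first by move=> z [].
      by apply: cts_on_continuous => z; exact: cvg_fst.
    apply: cts_on_continuous => z; apply: cvgM; last exact: cvg_cst.
    exact: cvg_snd.
  apply: (cts_on_comp (B := [set w : 'rV[R]_N | w != 0])
    (f := fun z : 'rV[R]_N * R => p z.1 + K (z.2 * c) (p z.1))
    (g := radial r)).
  - move=> [x t] [/= Sx tI]; have [h1 h2 h3] := adt t tI.
    by apply: level_neq0 (HS x t tI Sx).
  - have mapA z : (S `*` [set t : R | 0 <= t <= 1]) z -> A (p z.1, z.2 * c).
      case: z => x t [/= Sx tI].
      by split=> /=; [have [] := kp _ Sx|have [] := adt t tI].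
    exact: (cts_on_comp mapA c1 cK).
  by apply: cts_on_at => w; exact: radial_continuous.
exists H; split.
- exact/cts_onP.
- move=> t tI; have [hk [q [_ hq kq]]] := rhom t tI.
  have [K1 K2 K3 _ _] := hK _ (adt t tI).
  apply: (compact_homeo 0).
  + exact: norm_hausdorff.
  + exact: esphere_compact.
  + apply: (cts_on_comp (B := S `*` [set t : R | 0 <= t <= 1])
      (f := fun x => (x, t)) (g := fun z => H z.1 z.2)) cH => //.
    apply: cts_on_pair; last by apply: cts_on_continuous; exact: cst_continuous.
    by apply: cts_on_continuous => z; exact: cvg_id.
  + by move=> x Sx; have [] := hq _ (HS x t tI Sx).
  + move=> x x' Sx Sx' /(homeo_on_sub_inj (rhom t tI) (HS x t tI Sx)
      (HS x' t tI Sx')).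
    have [Qp e1] := kp _ Sx; have [Qp' e2] := kp _ Sx'.
    by move/(K2 _ _ Qp Qp') => pp; rewrite -e1 -e2 pp.
  move=> y Sy; have [Qy ye] := kq _ Sy.
  have [x Qx xe] := K3 _ Qy; exists (radial r x); first by have [] := hp _ Qx.
  by rewrite /H; have [_ ->] := hp _ Qx; rewrite xe.
- by move=> x Sx; have [Qp e1] := kp _ Sx; rewrite /H mul0r K0 // addr0.
have [] := hK c (And3 cd ca cb); rewrite -/(Q 0) -/(Q c) => K1 K2 K3 K4 K5.
apply/seteqP; split=> y.
  move=> [x [z Zz <-] <-].
  have Qz : Q 0 z by case: Zz.
  exists (z + K c z); first exact: K4.
  by rewrite /H mul1r; have [_ ->] := hp _ Qz.
move=> [w Zw <-]; have Qw : Q c w by case: Zw.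
have [x Qx xe] := K3 _ Qw.
exists (radial r x); first by exists x => //; apply: K5 => //; rewrite xe.
by rewrite /H mul1r; have [_ ->] := hp _ Qx; rewrite xe.
Qed.

End Local.

(** By the local statement the isotopy class is locally constant along the
    path. *)
Theorem isotopy_path (f0 f1 : 'I_P -> mpoly N R) (a0 b0 a1 b1 : R) :
  0 <= a0 -> 0 <= b0 -> 0 < a0 + b0 -> 0 <= a1 -> 0 <= b1 -> 0 < a1 + b1 ->
  (forall s x, 0 <= s <= 1 ->
     (forall j, pe (f0 j + s *: (f1 j - f0 j)) x = 0) ->
     level m (a0 + s * (a1 - a0)) (b0 + s * (b1 - b0)) x ->
     regular (pcons (star m (a0 + s * (a1 - a0)) (b0 + s * (b1 - b0)))
       (fun j => f0 j + s *: (f1 j - f0 j))) x) ->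
  ambient_isotopic R S
    [set radial r x | x in [set x | (forall j, pe (f0 j) x = 0) /\ level m a0 b0 x]]
    [set radial r x | x in [set x | (forall j, pe (f1 j) x = 0) /\ level m a1 b1 x]].
Proof.
move=> ha0 hb0 hab0 ha1 hb1 hab1 reg.
pose fs s j := f0 j + s *: (f1 j - f0 j).
pose as_ s := a0 + s * (a1 - a0); pose bs s := b0 + s * (b1 - b0).
pose Z s := [set radial r x | x in
  [set x | (forall j, pe (fs s j) x = 0) /\ level m (as_ s) (bs s) x]].
have Z0 : Z 0 = [set radial r x | x in [set x | (forall j, pe (f0 j) x = 0) /\ level m a0 b0 x]].
  rewrite /Z /as_ /bs !mul0r !addr0; congr (image _ _); apply/funext => x /=.
  by apply/propext; split=> -[h ?]; split=> // j; have := h j;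
    rewrite /fs scale0r addr0.
have Z1 : Z 1 = [set radial r x | x in [set x | (forall j, pe (f1 j) x = 0) /\ level m a1 b1 x]].
  rewrite /Z /as_ /bs !mul1r ![_ + (_ - _)]addrC !subrK; congr (image _ _).
  apply/funext => x /=; apply/propext; split=> -[h ?]; split=> // j;
    by have := h j; rewrite /fs scale1r addrC subrK.
have ZS s : 0 <= s <= 1 -> Z s `<=` S.
  move=> sI y [x [_ lx] <-]; apply: radial_esphere; exact: level_neq0 lx.
rewrite -Z0 -Z1.
apply: (interval_induction (Q := fun s => ambient_isotopic R S (Z 0) (Z s))).
  exact: ambient_isotopic_refl.
have cvx (u v s : R) : 0 <= u -> 0 <= v -> 0 <= s <= 1 -> 0 <= u + s * (v - u).
  move=> u0 v0 /andP[s0 s1]; have -> : u + s * (v - u) = (1 - s) * u + s * v by ring.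
  by rewrite addr_ge0 // mulr_ge0 // subr_ge0.
have abs s : 0 <= s <= 1 -> 0 < as_ s + bs s.
  move=> /andP[s0 s1]; rewrite /as_ /bs.
  have -> : a0 + s * (a1 - a0) + (b0 + s * (b1 - b0)) =
    (1 - s) * (a0 + b0) + s * (a1 + b1) by ring.
  have [->|s_neq] := eqVneq s 0; first by rewrite subr0 mul1r mul0r addr0.
  by rewrite ltr_wpDl ?mulr_ge0 ?subr_ge0 ?(ltW hab0) // mulr_gt0 // lt_def s_neq.
move=> s sI.
have [d d0 hd] := @local_isotopy (fs s) (fun j => f1 j - f0 j) (as_ s) (bs s)
  (a1 - a0) (b1 - b0) (cvx _ _ _ ha0 ha1 sI) (cvx _ _ _ hb0 hb1 sI) (abs s sI)
  (fun x => reg s x sI).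
exists d => // t tI ts.
have asE : as_ t = as_ s + (t - s) * (a1 - a0) by rewrite /as_; ring.
have bsE : bs t = bs s + (t - s) * (b1 - b0) by rewrite /bs; ring.
pose V c := level_variety m (fs s) (fun j => f1 j - f0 j) (as_ s) (bs s)
  (a1 - a0) (b1 - b0) c.
have V0 : V 0 = [set x | (forall j, pe (fs s j) x = 0) /\ level m (as_ s) (bs s) x].
  apply/funext => x /=; apply/propext; rewrite /V /level_variety /= !mul0r !addr0.
  by split=> -[h ?]; split=> // j; have := h j; rewrite scale0r addr0.
have Vt : V (t - s) =
    [set x | (forall j, pe (fs t j) x = 0) /\ level m (as_ t) (bs t) x].
  apply/funext => x /=; apply/propext; rewrite /V /level_variety /= -asE -bsE.
  have fE j : fs s j + (t - s) *: (f1 j - f0 j) = fs t j.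
    by rewrite /fs -addrA -scalerDl [s + _]addrC subrK.
  by split=> -[h ?]; split=> // j; have := h j; rewrite fE.
have iso : ambient_isotopic R S (Z s) (Z t).
  have := hd (t - s) ts; rewrite -asE -bsE -/(V 0) -/(V (t - s)) V0 Vt.
  by apply; [exact: cvx ha0 ha1 tI|exact: cvx hb0 hb1 tI].
split=> h; first exact: ambient_isotopic_trans h iso.
apply: ambient_isotopic_trans h _; apply: ambient_isotopic_sym iso.
exact: ZS.
Qed.

End IsotopyOfLinks.

(** * Weighted homogeneous polynomials *)

Section ChainRule.
Variables (R : realType) (N : nat).

Definition on_curve (g : 'I_N -> {poly R}) (p : mpoly N R) : {poly R} :=
  mmap (@polyC R) g p.

Lemma horner_on_curve g p t :
  (on_curve g p).[t] = meval (fun i => (g i).[t]) p.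
Proof.
rewrite /on_curve; elim/mpoly_ring_ind: p => [c|i|p q ihp ihq|p q ihp ihq].
- by rewrite mmapC hornerC mevalC.
- by rewrite mmapX mmap1U mevalXU.
- by rewrite raddfD hornerD /= ihp ihq mevalD.
by rewrite rmorphM hornerM /= ihp ihq mevalM.
Qed.

Lemma deriv_on_curve g p t : ((on_curve g p)^`()).[t] =
  \sum_i meval (fun i => (g i).[t]) (mderiv i p) * ((g i)^`()).[t].
Proof.
elim/mpoly_ring_ind: p => [c|k|p q ihp ihq|p q ihp ihq].
- rewrite /on_curve mmapC derivC horner0 big1 // => i _.
  by rewrite mderivC meval0 mul0r.
- rewrite /on_curve mmapX mmap1U (bigD1 k) //= big1 ?addr0 => [|i ik].
    have := @pe_mderivX R N k k (\row_i (g i).[t]); rewrite eqxx /pe.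
    have -> : (fun i => (\row_i (g i).[t]) 0 i) = (fun i => (g i).[t]).
      by apply/funext => i; rewrite mxE.
    by move=> ->; rewrite mul1r.
  have := @pe_mderivX R N i k (\row_i (g i).[t]).
  rewrite eq_sym (negbTE ik) /pe.
  have -> : (fun i => (\row_i (g i).[t]) 0 i) = (fun i => (g i).[t]).
    by apply/funext => j; rewrite mxE.
  by move=> ->; rewrite mul0r.
- rewrite /on_curve raddfD derivD hornerD /= -!/(on_curve _ _) ihp ihq.
  rewrite -big_split /=.
  by apply: eq_bigr => i _; rewrite mderivD mevalD mulrDl.
rewrite /on_curve rmorphM derivM hornerD !hornerM /= -!/(on_curve _ _) ihp ihq.
rewrite !horner_on_curve mulr_suml mulr_sumr -big_split /=.
by apply: eq_bigr => i _; rewrite mderivM mevalD !mevalM; ring.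
Qed.

Lemma poly_ext_pos (p q : {poly R}) : (forall t, 0 < t -> p.[t] = q.[t]) -> p = q.
Proof.
move=> h; apply/eqP; rewrite -subr_eq0; apply/negP => /negP nz.
have [e e0 he] := poly_neq0_near nz.
have e2 : 0 < e / 2 by rewrite divr_gt0.
have /he : 0 < e / 2 < e by apply/andP; split; lra.
by rewrite hornerD hornerN h // subrr eqxx.
Qed.

End ChainRule.

Lemma pe_mderiv_sum (R : realType) N (J : Type) (s : seq J)
    (F : J -> mpoly N R) i (y : 'rV[R]_N) :
  pe (mderiv i (\sum_(j <- s) F j)) y = \sum_(j <- s) pe (mderiv i (F j)) y.
Proof.
elim: s => [|j s ih]; first by rewrite !big_nil mderiv0 pe0.
by rewrite !big_cons mderivD peD ih.
Qed.

Section Weights.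
Variables (R : realType) (N : nat) (W : 'I_N -> nat).

Definition wscale (t : R) (x : 'rV[R]_N) : 'rV[R]_N := \row_i (t ^+ W i * x 0 i).

Definition whomog (k : nat) (p : mpoly N R) : Prop :=
  forall t x, 0 < t -> pe p (wscale t x) = t ^+ k * pe p x.

Lemma wscaleA s t x : wscale s (wscale t x) = wscale (s * t) x.
Proof. by apply/rowP => i; rewrite !mxE mulrA exprMn. Qed.

Lemma wscale1 x : wscale 1 x = x.
Proof. by apply/rowP => i; rewrite mxE expr1n mul1r. Qed.

Lemma wscaleK t x : 0 < t -> wscale t^-1 (wscale t x) = x.
Proof. by move=> t0; rewrite wscaleA mulVf ?gt_eqF // wscale1. Qed.

Lemma wscaleVK t x : 0 < t -> wscale t (wscale t^-1 x) = x.
Proof. by move=> t0; rewrite wscaleA mulfV ?gt_eqF // wscale1. Qed.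

(** Differentiate along the orbit of [x] at [t = 1]. *)
Lemma whomog_euler k p (x : 'rV[R]_N) : whomog k p ->
  \sum_i (W i)%:R * x 0 i * pe (mderiv i p) x = k%:R * pe p x.
Proof.
move=> hp; pose g i : {poly R} := x 0 i *: 'X^(W i).
have gE t : (fun i => (g i).[t]) = (fun i => wscale t x 0 i).
  by apply/funext => i; rewrite /g hornerZ hornerXn mxE mulrC.
have E : on_curve g p = (pe p x) *: 'X^k.
  apply: poly_ext_pos => t t0; rewrite horner_on_curve gE -/(pe p _) hp //.
  by rewrite hornerZ hornerXn mulrC.
have := congr1 (fun q : {poly R} => (q^`()).[1]) E.
rewrite deriv_on_curve gE wscale1 derivZ derivXn hornerZ hornerMn hornerXn.
rewrite expr1n => e; rewrite -[RHS]mulrC -[RHS]e; apply: eq_bigr => i _.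
rewrite /g derivZ derivXn hornerZ hornerMn hornerXn expr1n /pe.
by rewrite mulrC [_%:R * _]mulrC.
Qed.

(** Differentiate the homogeneity relation in the direction of the [i]-th
    axis. *)
Lemma whomog_mderiv k p i t (x : 'rV[R]_N) : whomog k p -> 0 < t ->
  t ^+ W i * pe (mderiv i p) (wscale t x) = t ^+ k * pe (mderiv i p) x.
Proof.
move=> hp t0.
pose g s j : {poly R} := (s ^+ W j) *: ((x 0 j)%:P + (j == i)%:R *: 'X).
pose e := \row_j (j == i)%:R : 'rV[R]_N.
have gE s u : (fun j => (g s j).[u]) = (fun j => wscale s (x + u *: e) 0 j).
  apply/funext => j; rewrite /g !mxE hornerZ hornerD hornerC hornerZ hornerX.
  by rewrite mulrC [u * _]mulrC mulrC.
have E : on_curve (g t) p = t ^+ k *: on_curve (g 1) p.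
  apply: poly_ext_pos => u u0.
  by rewrite hornerZ !horner_on_curve !gE -!/(pe p _) hp // wscale1.
have dg s j : ((g s j)^`()).[0] = s ^+ W j * (j == i)%:R.
  by rewrite /g derivZ derivD derivC add0r derivZ derivX !hornerZ hornerC mulr1.
have := congr1 (fun q : {poly R} => (q^`()).[0]) E.
rewrite derivZ hornerZ !deriv_on_curve !gE scale0r addr0 wscale1.
have sumE s (y : 'rV[R]_N) : \sum_j meval (fun j => y 0 j) (mderiv j p) * ((g s j)^`()).[0] =
    s ^+ W i * pe (mderiv i p) y :> R.
  rewrite (bigD1 i) //= big1 ?addr0 => [|j ji].
    by rewrite dg eqxx mulr1 mulrC.
  by rewrite dg (negbTE ji) !mulr0.
by rewrite !sumE expr1n mul1r.
Qed.

End Weights.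

Section SmallPerturbation.
Variables (R : realType) (N P L : nat).
Variables (W m : 'I_N -> nat) (M : nat) (D : 'I_P -> nat) (del : 'I_L -> nat).
Hypothesis M_gt0 : (0 < M)%N.
Hypothesis mW : forall i, (m i * W i = M)%N.
Variables (fw : 'I_P -> mpoly N R) (mm : 'I_L -> 'I_P -> mpoly N R).
Hypothesis hfw : forall j, whomog W (D j) (fw j).
Hypothesis hmm : forall a j, whomog W (D j + del a) (mm a j).

Lemma m_gt0 i : (0 < m i)%N.
Proof. by have := M_gt0; rewrite -(mW i) muln_gt0 => /andP[]. Qed.

Lemma W_gt0 i : (0 < W i)%N.
Proof. by have := M_gt0; rewrite -(mW i) muln_gt0 => /andP[]. Qed.

Definition gp (c : 'rV[R]_L) (j : 'I_P) : mpoly N R :=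
  fw j + \sum_a c 0 a *: mm a j.

(** The action of the dilations on the coefficients, see [pe_gp_scale]: terms
    of excess degree [del a > 0] fade away near the origin, those with
    [del a = 0] persist. *)
Definition coef_scale (t : R) (c : 'rV[R]_L) : 'rV[R]_L :=
  \row_a (c 0 a * t ^+ del a).

Lemma pe_gp c j x : pe (gp c j) x = pe (fw j) x + \sum_a c 0 a * pe (mm a j) x.
Proof.
by rewrite /gp peD pe_sum; congr (_ + _); apply: eq_bigr => a _; rewrite peZ.
Qed.

Lemma gp0 : gp 0 = fw.
Proof.
apply/funext => j; rewrite /gp big1 ?addr0 // => a _.
by rewrite mxE scale0r.
Qed.

Lemma pe_gp_scale c j t x : 0 < t ->
  pe (gp c j) (wscale W t x) = t ^+ D j * pe (gp (coef_scale t c) j) x.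
Proof.
move=> t0; rewrite !pe_gp hfw // mulrDr; congr (_ + _); rewrite mulr_sumr.
by apply: eq_bigr => a _; rewrite hmm // mxE exprD; ring.
Qed.

Lemma mderiv_gp_scale c j t x i : 0 < t ->
  t ^+ W i * pe (mderiv i (gp c j)) (wscale W t x) =
  t ^+ D j * pe (mderiv i (gp (coef_scale t c) j)) x.
Proof.
have dE c' y : pe (mderiv i (gp c' j)) y =
    pe (mderiv i (fw j)) y + \sum_a c' 0 a * pe (mderiv i (mm a j)) y.
  rewrite /gp mderivD peD pe_mderiv_sum; congr (_ + _).
  by apply: eq_bigr => a _; rewrite mderivZ peZ.
move=> t0; rewrite !dE !mulrDr (whomog_mderiv _ _ (hfw j)) //.
congr (_ + _); rewrite !mulr_sumr; apply: eq_bigr => a _.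
by rewrite mulrCA (whomog_mderiv _ _ (hmm a j)) // mxE exprD; ring.
Qed.

Lemma wpoly_homog : whomog W (2 * M) (wpoly R m).
Proof.
move=> t x t0; rewrite !pe_wpoly mulr_sumr; apply: eq_bigr => i _.
by rewrite mxE exprMn -exprM -(mW i); congr (t ^+ _ * _); lia.
Qed.

Lemma det_gram_regular p (g : 'I_p -> mpoly N R) x :
  \det (gram g x) != 0 -> regular g x.
Proof.
move=> d0 y jy; have : gram g x *m y = 0 by rewrite /gram -mulmxA jy mulmx0.
move/(congr1 (fun z => \adj (gram g x) *m z)).
rewrite mulmxA mul_adj_mx mulmx0 mul_scalar_mx => /eqP.
by rewrite scaler_eq0 (negbTE d0) => /eqP.
Qed.

Hypothesis fw_isolated : forall x, x != 0 -> (forall j, pe (fw j) x = 0) ->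
  regular fw x.

(** On the zero set of [fw] the weighted Euler field is tangent to the variety
    and transverse to the weighted spheres. *)
Lemma regular_fw x : x != 0 -> (forall j, pe (fw j) x = 0) ->
  regular (pcons (wpoly R m) fw) x.
Proof.
move=> x0 fx y jy.
pose E : 'rV[R]_N := \row_i ((W i)%:R * x 0 i).
have EJ k : (E *m jac (pcons (wpoly R m) fw) x) 0 k =
    \sum_i (W i)%:R * x 0 i * pe (mderiv i (pcons (wpoly R m) fw k)) x.
  by rewrite mxE; apply: eq_bigr => i _; rewrite !mxE.
have y00 : y ord0 0 = 0.
  have := congr1 (fun z : 'cV_N => (E *m z) 0 0) jy.
  rewrite mulmxA mulmx0 [RHS]mxE mxE big_ord_recl big1 ?addr0 => [|j _].
    rewrite EJ pcons0 (whomog_euler _ wpoly_homog) => /eqP.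
    rewrite mulf_eq0 mulf_eq0 pnatr_eq0 muln_eq0 /= gtn_eqF //=.
    by rewrite (gt_eqF (wpoly_gt0 m x0)) => /eqP.
  by rewrite EJ pconsS (whomog_euler _ (hfw j)) fx mulr0 mul0r.
pose y' : 'cV[R]_P := \col_j y (lift ord0 j) 0.
have y'0 : y' = 0.
  apply: (fw_isolated x0 fx); apply/colP => i; rewrite mxE [RHS]mxE.
  have := congr1 (fun z : 'cV_N => z i 0) jy.
  rewrite mxE [RHS]mxE big_ord_recl y00 mulr0 add0r => h.
  rewrite -[RHS]h; apply: eq_bigr => j _; congr (_ * _); last by rewrite mxE.
  by rewrite !mxE pconsS.
apply/colP => j; rewrite mxE; case: (unliftP ord0 j) => [k ->|->//].
by have := congr1 (fun z : 'cV_P => z k 0) y'0; rewrite !mxE.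
Qed.

Lemma star_w1 : star m 0 1 = wpoly R m.
Proof. by rewrite /star scale0r add0r scale1r. Qed.

(** The Gram determinant and the equations have no common zero on the unit
    weighted sphere at [c = 0]; by compactness they have none for small [c]. *)
Lemma regular_small : exists2 e : R, 0 < e & forall c u, `|c| <= e ->
  pe (wpoly R m) u = 1 -> (forall j, pe (gp c j) u = 0) ->
  regular (pcons (wpoly R m) (gp c)) u.
Proof.
pose K := level (R := R) m 0 1.
have ab : 0 < (0 : R) + 1 by rewrite add0r.
have [C hC] := star_bounded m_gt0 1 (lexx 0) (ler01) ab.
have KC u : K u -> `|u| <= C.
  move=> Ku; apply: (hC 0 1); rewrite ?mul0r //; last by rewrite Ku.
  by rewrite mul1r invf_le1 // ler1n.
have KE u : K u <-> pe (wpoly R m) u = 1.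
  by rewrite /K /level /= star_w1.
pose A : set ('rV[R]_L * 'rV[R]_N) := [set z | `|z.1| <= 1 /\ K z.2].
have bfst a : blip A (fun z => z.1 0 a).
  apply: (blip_comp (f := fun y : 'rV[R]_L => y 0 a) (A := [set y | `|y| <= 1])
    (h := fun z : 'rV[R]_L * 'rV[R]_N => z.1) (k := 1)).
  - by move=> z [].
  - by move=> z z' _ _; rewrite mul1r; exact: (norm_fst (z - z')).
  by apply: (@blip_coord _ _ _ 1).
have bsnd p : blip A (fun z => pe p z.2).
  apply: (blip_comp (f := pe p) (A := K)
    (h := fun z : 'rV[R]_L * 'rV[R]_N => z.2) (k := 1)).
  - by move=> z [].
  - by move=> z z' _ _; rewrite mul1r; exact: (norm_snd (z - z')).
  exact: (blip_base KC).
have bgp p (q : 'I_L -> mpoly N R) :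
    blip A (fun z => pe p z.2 + \sum_a z.1 0 a * pe (q a) z.2).
  apply: blipD => //; apply: blip_sum => a; exact: blipM.
pose G c := pcons (wpoly R m) (gp c).
have bjac i j : blip A (fun z => jac (G z.1) z.2 i j).
  case: (unliftP ord0 j) => [k ->|->].
    apply: eq_blip (bgp (mderiv i (fw k)) (fun a => mderiv i (mm a k))) => z _.
    rewrite mxE /G pconsS /gp mderivD peD pe_mderiv_sum.
    by congr (_ + _); apply: eq_bigr => a _; rewrite mderivZ peZ.
  by apply: eq_blip (bsnd (mderiv i (wpoly R m))) => z _; rewrite mxE /G pcons0.
have bgram i j : blip A (fun z => gram (G z.1) z.2 i j).
  have h : blip A (fun z => \sum_k jac (G z.1) z.2 k i * jac (G z.1) z.2 k j).
    by apply: blip_sum => k; apply: blipM.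
  apply: eq_blip h => z _; rewrite [RHS]mxE.
  by apply: eq_bigr => k _; rewrite [in RHS]mxE.
pose T (z : 'rV[R]_L * 'rV[R]_N) :=
  \det (gram (G z.1) z.2) ^+ 2 + \sum_j pe (gp z.1 j) z.2 ^+ 2.
have bT : blip A T.
  have bd : blip A (fun z => \det (gram (G z.1) z.2)) by exact: blip_det.
  apply: blipD; first by apply: eq_blip (blipM bd bd) => z _; rewrite expr2.
  apply: blip_sum => j.
  have h : blip A (fun z => pe (gp z.1 j) z.2).
    by apply: eq_blip (bgp (fw j) (mm^~ j)) => z _; rewrite pe_gp.
  by apply: eq_blip (blipM h h) => z _; rewrite expr2.
have [B [B0 _ Bl]] := bT.
have [t t0 ht] : exists2 t, 0 < t & forall u, K u -> t <= T (0, u).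
  apply: compact_pos_lb.
  - exact: (level_compact m_gt0 (lexx 0) ler01 ab).
  - apply/blip_cts_on; apply: (blip_comp (A := A) (f := T)
      (h := fun u : 'rV[R]_N => (0 : 'rV[R]_L, u)) (k := 1)) => //.
      by move=> u Ku; split=> //=; rewrite normr0.
    move=> u v _ _; rewrite mul1r norm_pair /= subrr normr0.
    by rewrite ge_max normr_ge0 lexx.
  move=> u Ku; rewrite /T /= gp0.
  have u0 : u != 0 by apply: (level_neq0 m_gt0 Ku).
  have s0 : 0 <= \sum_j pe (fw j) u ^+ 2.
    by rewrite sumr_ge0 // => j _; exact: sqr_ge0.
  rewrite lt_def addr_ge0 ?sqr_ge0 // andbT paddr_eq0 ?sqr_ge0 // negb_and.
  have [fz|nz] := pselect (forall j, pe (fw j) u = 0).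
    by rewrite sqrf_eq0 /G gp0 regular_gram //; exact: regular_fw.
  apply/orP; right; apply: contra_notN nz.
  rewrite psumr_eq0 => [/allP h j|j _]; last exact: sqr_ge0.
  by have := h j; rewrite mem_index_enum /= sqrf_eq0 => /(_ isT)/eqP.
have B1 : 0 < B + 1 by rewrite ltr_wpDl.
exists (Num.min 1 (t / 2 / (B + 1))).
  by rewrite lt_min ltr01 !divr_gt0.
move=> c u; rewrite le_min => /andP[c1 ct] /KE Ku gz.
apply: det_gram_regular; apply/eqP => dz.
have Au : A (c, u) by [].
have A0 : A (0, u) by split=> //=; rewrite normr0.
have := Bl _ _ A0 Au; rewrite /T /= -/(G c) dz expr0n add0r.
rewrite [X in _ - X]big1 ?subr0 => [|j _]; last by rewrite gz expr0n.
rewrite norm_pair /= subrr normr0 sub0r normrN => h.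
have := ht _ Ku; rewrite /T /= => h'.
have h2 : Num.max `|c| 0 <= t / 2 / (B + 1).
  by rewrite ge_max ct !divr_ge0 // ltW.
have tE : t / 2 = t / 2 / (B + 1) * (B + 1) by rewrite divfK // gt_eqF.
have h3 : B * Num.max `|c| 0 <= t / 2.
  apply: (@le_trans _ _ (B * (t / 2 / (B + 1)))); first exact: ler_wpM2l.
  have u0 : 0 <= t / 2 / (B + 1) by rewrite !divr_ge0 // ltW.
  by move: tE u0; move: (t / 2 / (B + 1)) => v -> v0; nra.
have := le_trans (ler_norm _) (le_trans h h3).
by move: h'; lra.
Qed.

End SmallPerturbation.

(** * Weighted radius *)

Section WeightedRadius.
Variables (R : realType) (N : nat) (W m : 'I_N -> nat) (M : nat).
Hypothesis M_gt0 : (0 < M)%N.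
Hypothesis mW : forall i, (m i * W i = M)%N.

Definition wrad (x : 'rV[R]_N) : R := pe (wpoly R m) x `^ ((2 * M)%:R^-1).

Lemma wrad_ge0 x : 0 <= wrad x.
Proof. exact: powR_ge0. Qed.

Lemma wradX x : wrad x ^+ (2 * M) = pe (wpoly R m) x.
Proof.
rewrite -powR_mulrn ?wrad_ge0 // /wrad -powRrM mulVf ?powRr1 ?wpoly_ge0 //.
by rewrite pnatr_eq0 muln_eq0 /= -lt0n.
Qed.

Let M2 : (0 < 2 * M)%N.
Proof. by rewrite muln_gt0. Qed.

Lemma expr_inj_ge0 (s t : R) : 0 <= s -> 0 <= t ->
  s ^+ (2 * M) = t ^+ (2 * M) -> s = t.
Proof.
move=> s0 t0 e; apply/eqP; rewrite -(eqrXn2 M2 s0 t0); exact/eqP.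
Qed.

Lemma wrad_gt0 x : x != 0 -> 0 < wrad x.
Proof. by move=> x0; apply: powR_gt0; exact: wpoly_gt0. Qed.

Lemma wrad0 : wrad 0 = 0.
Proof.
apply: expr_inj_ge0; rewrite ?wrad_ge0 // wradX -star_w1 star0 //.
  by rewrite expr0n eqn0Ngt M2.
exact: (m_gt0 M_gt0 mW).
Qed.

Lemma wrad_scale t x : 0 < t -> wrad (wscale W t x) = t * wrad x.
Proof.
move=> t0; apply: expr_inj_ge0; rewrite ?wrad_ge0 ?mulr_ge0 ?wrad_ge0 ?ltW //.
by rewrite exprMn !wradX (wpoly_homog M_gt0 mW).
Qed.

Lemma wpoly_unit x : x != 0 -> pe (wpoly R m) (wscale W (wrad x)^-1 x) = 1.
Proof.
move=> x0; have r0 := wrad_gt0 x0.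
by rewrite -wradX wrad_scale ?invr_gt0 // mulVf ?expr1n // gt_eqF.
Qed.

Lemma subX_le (s t : R) k : 0 <= s <= t -> (t - s) ^+ k.+1 <= t ^+ k.+1 - s ^+ k.+1.
Proof.
move=> /andP[s0 st]; have t0 := le_trans s0 st.
have ts : 0 <= t - s by rewrite subr_ge0.
elim: k => [|k ih]; first by rewrite !expr1.
rewrite exprS; apply: le_trans (ler_wpM2l ts ih) _.
rewrite -subr_ge0.
have -> : t ^+ k.+2 - s ^+ k.+2 - (t - s) * (t ^+ k.+1 - s ^+ k.+1) =
  s * (t ^+ k.+1 - s ^+ k.+1) + s ^+ k.+1 * (t - s) by rewrite !exprS; ring.
by rewrite addr_ge0 // mulr_ge0 ?exprn_ge0 // subr_ge0 lerXn2r ?nnegrE.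
Qed.

(** Roots are controlled by [subX_le]: close powers have close roots. *)
Lemma wrad_continuous : continuous wrad.
Proof.
move=> x U /nbhs_ballP[e /= e0 eU].
have e2 : 0 < e ^+ (2 * M) by rewrite exprn_gt0.
have nb : nbhs x [set y | ball (pe (wpoly R m) x) (e ^+ (2 * M)) (pe (wpoly R m) y)].
  exact: (@pe_continuous R N (wpoly R m) x _ (nbhsx_ballx _ _ e2)).
apply: filterS nb => y; rewrite -ball_normE /= => h.
apply: eU; rewrite -ball_normE /= ltNge; apply/negP => le.
move: h; rewrite ltNge => /negP; apply; rewrite -!wradX.
have dist (s t : R) : 0 <= s -> 0 <= t -> `|s - t| ^+ (2 * M) <= `|s ^+ (2 * M) - t ^+ (2 * M)|.
  wlog st : s t / s <= t.
    move=> w s0 t0; have [st|/ltW ts] := leP s t; first exact: w.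
    by rewrite distrC [leRHS]distrC w.
  move=> s0 t0; rewrite distrC [leRHS]distrC ger0_norm ?subr_ge0 //.
  rewrite ger0_norm ?subr_ge0 ?lerXn2r ?nnegrE //.
  by rewrite -(prednK M2); apply: subX_le; rewrite s0.
apply: le_trans (dist _ _ (wrad_ge0 x) (wrad_ge0 y)).
by rewrite lerXn2r ?nnegrE // ltW.
Qed.

Lemma coord_le_wrad (x : 'rV[R]_N) i : `|x 0 i| <= wrad x ^+ W i.
Proof.
have mi := m_gt0 M_gt0 mW i; rewrite leNgt; apply/negP => lt.
have : (wrad x ^+ W i) ^+ (2 * m i) < `|x 0 i| ^+ (2 * m i).
  by rewrite ltrXn2r ?nnegrE ?exprn_ge0 ?wrad_ge0 // -lt0n muln_gt0 mi.
rewrite -exprM (_ : W i * (2 * m i) = 2 * M)%N; last by rewrite -(mW i); lia.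
rewrite wradX pe_wpoly (bigD1 i) //= -normrX ger0_norm ?even_pow_ge0 //.
rewrite ltNge lerDl sumr_ge0 // => j _; exact: even_pow_ge0.
Qed.

Lemma norm_le_wrad x : wrad x <= 1 -> `|x| <= wrad x.
Proof.
move=> r1; apply: normr_row_le => [|i]; first exact: wrad_ge0.
apply: le_trans (coord_le_wrad x i) _; rewrite -[leRHS]expr1.
apply: ler_wiXn2l => //; first exact: wrad_ge0.
by have := W_gt0 M_gt0 mW i.
Qed.

Lemma nbhs0_wpoly (e : R) : 0 < e ->
  nbhs (0 : 'rV[R]_N) [set x | pe (wpoly R m) x < e].
Proof.
move=> e0; have w0 : pe (wpoly R m) 0 = 0.
  by rewrite -star_w1 star0 //; exact: (m_gt0 M_gt0 mW).
have nb : nbhs (0 : 'rV[R]_N)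
    [set y | ball (pe (wpoly R m) 0) e (pe (wpoly R m) y)].
  exact: (@pe_continuous R N (wpoly R m) 0 _ (nbhsx_ballx _ _ e0)).
apply: filterS nb => x.
rewrite -ball_normE /= w0 sub0r normrN => h.
exact: le_lt_trans (ler_norm _) h.
Qed.

End WeightedRadius.

(** * Transversality of a variety to the two families of spheres *)

Section Transversality.
Variables (R : realType) (N P : nat) (m : 'I_N -> nat).
Variable g : 'I_P -> mpoly N R.

Lemma regular_tail p x : regular (pcons p g) x -> regular g x.
Proof.
move=> rg y jy.
pose z : 'cV[R]_P.+1 := \col_j if unlift ord0 j is Some k then y k 0 else 0.
have z0 : z = 0.
  apply: rg; apply/colP => i; rewrite mxE [RHS]mxE big_ord_recl.
  rewrite [z ord0 0]mxE unlift_none mulr0 add0r.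
  have := congr1 (fun u : 'cV_N => u i 0) jy; rewrite mxE [RHS]mxE => h.
  rewrite -[RHS]h; apply: eq_bigr => k _; rewrite [z _ _]mxE liftK; congr (_ * _).
  by rewrite !mxE pconsS.
apply/colP => k; have := congr1 (fun u : 'cV_P.+1 => u (lift ord0 k) 0) z0.
by rewrite mxE liftK => ->; rewrite !mxE.
Qed.

(** If a positive combination of the two gradients were normal to the variety
    arbitrarily near the origin, there would be a sequence of such points, and
    along an ultrafilter they contradict [no_opposite_gradients]. *)
Lemma transverse_near0 (h0 : R) : 0 < h0 ->
  (forall x, x != 0 -> pe (wpoly R m) x < h0 -> (forall j, pe (g j) x = 0) ->
     regular (pcons (wpoly R m) g) x) ->
  exists2 h : R, 0 < h & forall x a b, x != 0 -> pe (sqpoly R N) x < h ->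
    pe (wpoly R m) x < h -> (forall j, pe (g j) x = 0) ->
    0 <= a -> 0 <= b -> 0 < a + b -> regular (pcons (star m a b) g) x.
Proof.
move=> h00 wreg; apply: contrapT => none.
pose bad (h : R) (x : 'rV[R]_N) (c : R) (mu : 'I_P -> R) :=
  [/\ x != 0 /\ 0 <= c, pe (sqpoly R N) x < h, pe (wpoly R m) x < h,
    forall j, pe (g j) x = 0 &
    forall i, pe (mderiv i (sqpoly R N)) x = - c * pe (mderiv i (wpoly R m)) x +
      \sum_j mu j * pe (mderiv i (g j)) x].
have exbad h : 0 < h -> exists x c mu, bad h x c mu.
  move=> h1; apply: contrapT => nb; apply: none.
  exists (Num.min h h0); first by rewrite lt_min h1.
  move=> x a b x0; rewrite !lt_min => /andP[qh _] /andP[wh wh0] gx a0 b0 ab y jy.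
  have reg := wreg x x0 wh0 gx.
  have jE i : y ord0 0 * (a * pe (mderiv i (sqpoly R N)) x +
      b * pe (mderiv i (wpoly R m)) x) +
      \sum_j y (lift ord0 j) 0 * pe (mderiv i (g j)) x = 0.
    have := congr1 (fun u : 'cV_N => u i 0) jy; rewrite mxE [RHS]mxE => yE.
    rewrite -[RHS]yE big_ord_recl mxE pcons0 /star mderivD !mderivZ peD !peZ mulrC.
    by congr (_ + _); apply: eq_bigr => j _; rewrite mxE pconsS mulrC.
  have fromw (z : 'I_P -> R) t : (forall i, t * pe (mderiv i (wpoly R m)) x +
      \sum_j z j * pe (mderiv i (g j)) x = 0) -> t = 0 /\ forall j, z j = 0.
    move=> tz; pose u : 'cV[R]_P.+1 :=
      \col_j if unlift ord0 j is Some k then z k else t.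
    have u0 : u = 0.
      apply: reg; apply/colP => i; rewrite mxE [RHS]mxE big_ord_recl -[RHS](tz i).
      rewrite [u _ _]mxE unlift_none mxE pcons0 mulrC; congr (_ + _).
      by apply: eq_bigr => j _; rewrite [u _ _]mxE liftK mxE pconsS mulrC.
    split=> [|j].
      by have := congr1 (fun u : 'cV_P.+1 => u ord0 0) u0; rewrite !mxE unlift_none.
    have := congr1 (fun u : 'cV_P.+1 => u (lift ord0 j) 0) u0.
    by rewrite !mxE liftK.
  have [a00|a_neq] := eqVneq a 0.
    have [] := fromw (fun j => y (lift ord0 j) 0) (y ord0 0 * b).
      by move=> i; rewrite -[RHS](jE i) a00 mul0r add0r mulrA.
    move=> /eqP; rewrite mulf_eq0 => /orP[/eqP y0 yj|/eqP b00]; last first.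
      by move: ab; rewrite a00 b00 addr0 ltxx.
    apply/colP => j; rewrite [RHS]mxE.
    by case: (unliftP ord0 j) => [k ->|->].
  have [y0|y_neq] := eqVneq (y ord0 0) 0.
    have [] := fromw (fun j => y (lift ord0 j) 0) 0.
      by move=> i; rewrite -[RHS](jE i) y0 !mul0r.
    move=> _ yj; apply/colP => j; rewrite [RHS]mxE.
    by case: (unliftP ord0 j) => [k ->|->].
  exfalso; apply: nb; exists x, (b / a),
    (fun j => - (y (lift ord0 j) 0 / (y ord0 0 * a))); split=> //.
    by split=> //; rewrite divr_ge0.
  move=> i; have yE := jE i.
  have -> : \sum_j - (y (lift ord0 j) 0 / (y ord0 0 * a)) * pe (mderiv i (g j)) x =
      - (\sum_j y (lift ord0 j) 0 * pe (mderiv i (g j)) x) / (y ord0 0 * a).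
    rewrite mulNr mulr_suml -sumrN; apply: eq_bigr => j _.
    by field; rewrite a_neq y_neq.
  move/eqP: yE; rewrite addr_eq0 => /eqP <-.
  by field; rewrite a_neq y_neq.
pose e (k : nat) : R := k.+1%:R^-1.
have e0 k : 0 < e k by rewrite invr_gt0.
have /choice[x /choice[c /choice[mu hbad]]] :
    forall k, exists x c mu, bad (e k) x c mu.
  by move=> k; exact: exbad.
have [U [UU sU]] := @ultraFilterLemma nat (\oo : set_system nat) _.
have small (v : nat -> R) : (forall k, v k < e k) ->
    forall t, 0 < t -> U [set k | v k < t].
  move=> ve t t0; apply: sU.
  have [n hn] : exists n : nat, e n < t.
    exists (Num.truncn t^-1); rewrite /e invf_plt ?posrE //.
    by have := truncnS_gt t^-1.
  exists n => // k /= nk; apply: lt_le_trans (ve k) _; apply: le_trans (ltW hn).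
  by rewrite lef_pV2 ?posrE // ler_nat ltnS.
pose X k (i : 'I_N) := x k 0 i.
apply: (@no_opposite_gradients R nat U UU N X P g (sqpoly R N) (wpoly R m) c mu).
- by move=> k j; have [_ _ _ h _] := hbad k; exact: h.
- by move=> k; have [[x0 _] _ _ _ _] := hbad k; exact: sqpoly_gt0.
- by move=> k; have [[x0 _] _ _ _ _] := hbad k; exact: wpoly_gt0.
- by apply: small => k; have [_ h _ _ _] := hbad k; exact: h.
- by apply: small => k; have [_ _ h _ _] := hbad k; exact: h.
- by move=> k; have [[_ c0] _ _ _ _] := hbad k.
by move=> k i; have [_ _ _ _ h] := hbad k; exact: h.
Qed.

End Transversality.

(** * Links of small perturbations *)

Section LinkIsotopy.
Variables (R : realType) (N P L : nat).
Variables (W m : 'I_N -> nat) (M : nat) (D : 'I_P -> nat) (del : 'I_L -> nat).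
Hypothesis M_gt0 : (0 < M)%N.
Hypothesis mW : forall i, (m i * W i = M)%N.
Variables (fw : 'I_P -> mpoly N R) (mm : 'I_L -> 'I_P -> mpoly N R).
Hypothesis hfw : forall j, whomog W (D j) (fw j).
Hypothesis hmm : forall a j, whomog W (D j + del a) (mm a j).

Let m0 := m_gt0 M_gt0 mW.

(** Only the terms that do not fade away under dilations need to be small. *)
Definition tame (e : R) (c : 'rV[R]_L) : Prop :=
  forall a, del a = 0%N -> `|c 0 a| <= e.

Lemma coef_scale_le e (c : 'rV[R]_L) t : 0 <= e -> tame e c -> 0 < t <= 1 ->
  `|c| * t <= e -> `|coef_scale del t c| <= e.
Proof.
move=> e0 tc /andP[t0 t1] ct; apply: normr_row_le => [//|a].
rewrite mxE normrM; case E : (del a) => [|k].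
  by rewrite expr0 normr1 mulr1 tc.
rewrite [X in _ * X]ger0_norm ?exprn_ge0 ?(ltW t0) //.
have tk : t ^+ k.+1 <= t by rewrite exprS ler_piMr ?(ltW t0) // exprn_ile1 // ltW.
have ca := normr_coord c a; have tk0 : 0 <= t ^+ k.+1 by rewrite exprn_ge0 // ltW.
by apply: le_trans ct; apply: ler_pM.
Qed.

Lemma coef_scale_small e (c : 'rV[R]_L) : 0 < e -> tame e c ->
  exists2 h : R, 0 < h & forall t, 0 < t <= h -> `|coef_scale del t c| <= e.
Proof.
move=> e0 tc; have c1 : 0 < `|c| + 1 by rewrite ltr_wpDl.
exists (Num.min 1 (e / (`|c| + 1))); first by rewrite lt_min ltr01 divr_gt0.
move=> t /andP[t0]; rewrite le_min => /andP[t1]; rewrite ler_pdivlMr // => tc'.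
apply: coef_scale_le => //; [exact: ltW|by rewrite t0|].
by apply: le_trans tc'; rewrite mulrC ler_pM2l // lerDl.
Qed.

(** Rank is invariant under the dilations, which rescale rows and columns. *)
Lemma regular_scale (c : 'rV[R]_L) t (x : 'rV[R]_N) : 0 < t ->
  regular (pcons (wpoly R m) (gp fw mm (coef_scale del t c))) x ->
  regular (pcons (wpoly R m) (gp fw mm c)) (wscale W t x).
Proof.
move=> t0 rg y jy.
pose w (j : 'I_P.+1) := if unlift ord0 j is Some k then D k else (2 * M)%N.
have jE i j : t ^+ W i * jac (pcons (wpoly R m) (gp fw mm c)) (wscale W t x) i j =
    t ^+ w j * jac (pcons (wpoly R m) (gp fw mm (coef_scale del t c))) x i j.
  rewrite !mxE /w; case: (unliftP ord0 j) => [k ->|->].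
    by rewrite !pconsS (mderiv_gp_scale hfw hmm).
  by rewrite !pcons0 (whomog_mderiv _ _ (wpoly_homog M_gt0 mW)).
pose z : 'cV[R]_P.+1 := \col_j (t ^+ w j * y j 0).
have z0 : z = 0.
  apply: rg; apply/colP => i; rewrite mxE [RHS]mxE.
  have := congr1 (fun u : 'cV_N => t ^+ W i * u i 0) jy.
  rewrite [(0 : 'cV_N) i 0]mxE mulr0 mxE mulr_sumr => h.
  rewrite -[RHS]h; apply: eq_bigr => j _.
  by rewrite [z _ _]mxE [RHS]mulrA jE; ring.
apply/colP => j; have := congr1 (fun u : 'cV_P.+1 => u j 0) z0.
rewrite !mxE => /eqP; rewrite mulf_eq0 expf_eq0 (gt_eqF t0) andbF /=.
by move/eqP.
Qed.

(** The constant of [regular_small]. *)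
Variable e : R.
Hypothesis e_gt0 : 0 < e.
Hypothesis e_regular : forall (c : 'rV[R]_L) (u : 'rV[R]_N), `|c| <= e -> pe (wpoly R m) u = 1 ->
  (forall j, pe (gp fw mm c j) u = 0) ->
  regular (pcons (wpoly R m) (gp fw mm c)) u.

Lemma regular_at (c : 'rV[R]_L) (x : 'rV[R]_N) : x != 0 -> `|coef_scale del (wrad m M x) c| <= e ->
  (forall j, pe (gp fw mm c j) x = 0) ->
  regular (pcons (wpoly R m) (gp fw mm c)) x.
Proof.
move=> x0 ce gx; have r0 := wrad_gt0 m M x0.
rewrite -(wscaleVK W x r0); apply: regular_scale => //.
apply: e_regular => //; first exact: (wpoly_unit M_gt0 mW).
move=> j; have := gx j; rewrite -{1}(wscaleVK W x r0).
rewrite (pe_gp_scale hfw hmm) // => /eqP.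
by rewrite mulf_eq0 expf_eq0 (gt_eqF r0) andbF /= => /eqP.
Qed.

Lemma wrad_le t (x : 'rV[R]_N) : 0 < t -> pe (wpoly R m) x <= t ^+ (2 * M) -> wrad m M x <= t.
Proof.
move=> t0; rewrite -(wradX m M_gt0) => h.
by rewrite -(@ler_pXn2r _ (2 * M)) ?nnegrE ?wrad_ge0 ?(ltW t0) // muln_gt0.
Qed.

Lemma regular_near0 (c : 'rV[R]_L) : tame e c -> exists2 h : R, 0 < h & forall x, x != 0 ->
  pe (wpoly R m) x < h -> (forall j, pe (gp fw mm c j) x = 0) ->
  regular (pcons (wpoly R m) (gp fw mm c)) x.
Proof.
move=> tc; have [t t0 ht] := coef_scale_small e_gt0 tc.
exists (t ^+ (2 * M)); first exact: exprn_gt0.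
move=> x x0 /ltW xt; apply: regular_at => //; apply: ht.
by rewrite wrad_gt0 //= wrad_le.
Qed.

Lemma tame_has_link (c : 'rV[R]_L) : tame e c -> has_link (real_map (gp fw mm c)).
Proof.
move=> tc; have [h h0 hh] := regular_near0 tc.
have := nbhs0_wpoly M_gt0 mW h0; apply: filterS => x /= xh [sx zx].
apply/eqP; rewrite -[_ == _]negbK; apply/negP => x0.
move/sing_setP: sx; apply; apply: (@regular_tail _ _ _ _ (wpoly R m)).
by apply: hh => //; apply/zero_setP.
Qed.

Lemma regular_pcons_scale (s : R) p (g : 'I_P -> mpoly N R) (x : 'rV[R]_N) : s != 0 ->
  regular (pcons p g) x -> regular (pcons (s *: p) g) x.
Proof.
move=> s0 rg y jy.
pose z : 'cV[R]_P.+1 := \col_j (if j == ord0 then s * y j 0 else y j 0).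
have z0 : z = 0.
  apply: rg; rewrite -[RHS]jy; apply/colP => i; rewrite mxE [RHS]mxE.
  apply: eq_bigr => j _; case: (unliftP ord0 j) => [k ->|->].
    by rewrite [z _ _]mxE lift_eqF !mxE !pconsS.
  by rewrite [z _ _]mxE eqxx !mxE !pcons0 mderivZ peZ; ring.
apply/colP => j; have := congr1 (fun u : 'cV_P.+1 => u j 0) z0.
rewrite !mxE; case: (unliftP ord0 j) => [k ->|->]; first by rewrite lift_eqF.
by rewrite eqxx => /eqP; rewrite mulf_eq0 (negbTE s0) => /eqP.
Qed.

(** The variety is transverse to the whole family of hypersurfaces that
    interpolates between a small round sphere and a small weighted one: each of
    their points has small Euclidean radius or small weighted radius, hence
    both. *)
Lemma round_to_weighted (c : 'rV[R]_L) : tame e c -> exists2 t : R, 0 < t &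
  forall s, t <= s -> exists2 r0 : R, 0 < r0 & forall r, 0 < r < r0 ->
  ambient_isotopic R (@esphere R N r)
    (link (real_map (gp fw mm c)) r)
    [set radial r x | x in
       [set x | (forall j, pe (gp fw mm c j) x = 0) /\ level m 0 s x]].
Proof.
move=> tc; have [h1 h10 hh1] := regular_near0 tc.
have [h h0 hh] := transverse_near0 h10 hh1.
have sq_small (u : R) : 0 < u -> exists2 v : R, 0 < v & forall x : 'rV[R]_N,
    pe (wpoly R m) x <= v -> pe (sqpoly R N) x < u.
  move=> u0.
  have nb : nbhs (0 : 'rV[R]_N) [set x | pe (sqpoly R N) x < u].
    have z0 : pe (sqpoly R N) 0 = 0.
      by rewrite pe_sqpoly big1 // => i _; rewrite mxE expr0n.
    have nb : nbhs (0 : 'rV[R]_N) [set y | ball (pe (sqpoly R N) 0) u (pe (sqpoly R N) y)].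
      exact: (@pe_continuous R N (sqpoly R N) 0 _ (nbhsx_ballx _ _ u0)).
    apply: filterS nb => x; rewrite -ball_normE /= z0 sub0r normrN.
    exact: le_lt_trans (ler_norm _).
  move/nbhs_ballP: nb => [d /= d0 hd].
  pose d' := Num.min d 1 / 2.
  have d'0 : 0 < d' by rewrite divr_gt0 // lt_min d0 ltr01.
  have dd : d' < d /\ d' <= 1.
    have : Num.min d 1 <= d by rewrite ge_min lexx.
    have : Num.min d 1 <= 1 by rewrite ge_min lexx orbT.
    by move: d'0; rewrite /d'; split; lra.
  exists (d' ^+ (2 * M)); first exact: exprn_gt0.
  move=> x /(wrad_le d'0) xr; apply: hd; rewrite -ball_normE /= sub0r normrN.
  have r1 : wrad m M x <= 1 by move: xr dd; lra.
  by apply: le_lt_trans (norm_le_wrad M_gt0 mW r1) _; move: xr dd; lra.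
have w_small (u : R) : 0 < u -> exists2 v : R, 0 < v & forall x : 'rV[R]_N,
    pe (sqpoly R N) x <= v -> pe (wpoly R m) x < u.
  move=> u0; have := nbhs0_wpoly M_gt0 mW u0 => /nbhs_ballP[d /= d0 hd].
  exists ((d / 2) ^+ 2); first by rewrite exprn_gt0 // divr_gt0.
  move=> x xd; apply: hd; rewrite -ball_normE /= sub0r normrN.
  apply: (@le_lt_trans _ _ (d / 2)); last by lra.
  apply: normr_row_le => [|i]; first by rewrite divr_ge0 // ltW.
  rewrite -(@ler_pXn2r _ 2) ?nnegrE ?divr_ge0 ?(ltW d0) //.
  apply: le_trans xd; rewrite pe_sqpoly (bigD1 i) //= -normrX ger0_norm ?sqr_ge0 //.
  by rewrite lerDl sumr_ge0 // => j _; exact: sqr_ge0.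
have [v v0 hv] := sq_small _ h0; have [v' v'0 hv'] := w_small _ h0.
exists ((Num.min v (h / 2))^-1); first by rewrite invr_gt0 lt_min v0 divr_gt0.
move=> s ts.
have s0 : 0 < s by apply: lt_le_trans ts; rewrite invr_gt0 lt_min v0 divr_gt0.
have sv : s^-1 <= v /\ s^-1 < h.
  have : s^-1 <= Num.min v (h / 2).
    rewrite -[leRHS]invrK lef_pV2 ?posrE // invr_gt0 lt_min v0 divr_gt0 //.
  by rewrite le_min => /andP[-> ?]; split=> //; lra.
pose r1 := Num.min 1 (Num.min v' h / 2).
have mv : 0 < Num.min v' h by rewrite lt_min v'0.
have r10 : 0 < r1 by rewrite lt_min ltr01 divr_gt0.
exists r1 => // r /andP[r0 rr1].
have rq : r ^+ 2 <= v' /\ r ^+ 2 < h.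
  have : r1 <= 1 by rewrite ge_min lexx.
  have : r1 <= Num.min v' h / 2 by rewrite ge_min lexx orbT.
  have : Num.min v' h <= v' by rewrite ge_min lexx.
  have : Num.min v' h <= h by rewrite ge_min lexx orbT.
  by move: mv rr1 r0; move: (Num.min v' h) => mm'; rewrite expr2; split; nra.
have r2 : 0 < r ^- 2 by rewrite invr_gt0 exprn_gt0.
have linkE : link (real_map (gp fw mm c)) r = [set radial r x | x in
    [set x | (forall j, pe (gp fw mm c j) x = 0) /\ level m (r ^- 2) 0 x]].
  rewrite -esphere_level //; apply/seteqP; split=> x.
    move=> [/zero_setP zx Sx]; exists x => //; exact: radial_id.
  move=> [y [zy Sy] <-]; rewrite radial_id //.
  by split=> //; apply/zero_setP.
rewrite linkE; apply: isotopy_path => //; rewrite ?addr0 ?add0r ?(ltW r2) ?(ltW s0) //.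
move=> u x /andP[u0 u1].
have fE : (fun j => gp fw mm c j + u *: (gp fw mm c j - gp fw mm c j)) = gp fw mm c.
  by apply/funext => j; rewrite subrr scaler0 addr0.
rewrite fE => gx lx; have gx' j : pe (gp fw mm c j) x = 0.
  by have := gx j; rewrite subrr scaler0 addr0.
have aE : r ^- 2 + u * - r ^- 2 = (1 - u) * r ^- 2 by ring.
have bE : 0 + u * (s - 0) = u * s by ring.
rewrite aE bE in lx *.
have a0 : 0 <= (1 - u) * r ^- 2 by rewrite mulr_ge0 ?subr_ge0 // ltW.
have b0 : 0 <= u * s by rewrite mulr_ge0 // ltW.
have ab : 0 < (1 - u) * r ^- 2 + u * s.
  have [->|u_neq] := eqVneq u 0; first by rewrite subr0 mul1r mul0r addr0.
  by apply: ltr_wpDl => //; rewrite mulr_gt0 // lt_def u_neq.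
have x0 : x != 0 by exact: (level_neq0 m0 lx).
move: (lx); rewrite /level /= pe_star => lxE.
have qw : pe (sqpoly R N) x <= r ^+ 2 \/ pe (wpoly R m) x <= s^-1.
  have [le|lt] := leP (pe (sqpoly R N) x) (r ^+ 2); [by left|right].
  rewrite leNgt; apply/negP => lt'.
  have h3 : 1 < r ^- 2 * pe (sqpoly R N) x.
    by rewrite mulrC -ltr_pdivrMr ?mul1r // invrK.
  have h4 : 1 < s * pe (wpoly R m) x by rewrite mulrC -ltr_pdivrMr ?mul1r // div1r.
  move: lxE h3 h4; rewrite -!mulrA; set q := r ^- 2 * _; set w := s * _.
  move=> e1 h3 h4; have [qw|/ltW qw] := leP q w.
    have := mulr_ge0 u0 (_ : 0 <= w - q); rewrite subr_ge0 => /(_ qw) h5.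
    by move: e1 h5; rewrite mulrBl mulrBr mul1r; lra.
  have := mulr_ge0 (_ : 0 <= 1 - u) (_ : 0 <= q - w).
  rewrite !subr_ge0 => /(_ u1 qw) h5.
  by move: e1 h5; rewrite !mulrBl !mulrBr !mul1r; lra.
have [qh wh] : pe (sqpoly R N) x < h /\ pe (wpoly R m) x < h.
  case: qw => le.
    split; first by apply: le_lt_trans le _; case: rq.
    by apply: hv'; apply: le_trans le _; case: rq.
  split; last by apply: le_lt_trans le _; case: sv.
  by apply: hv; apply: le_trans le _; case: sv.
exact: hh.
Qed.

(** From the round sphere to a weighted sphere for [c], along the segment from
    [c] to [c'] on that weighted sphere, and back to the round sphere. *)
Theorem tame_link_isotopic (c : 'rV[R]_L)  (c' : 'rV[R]_L) : tame e c -> tame e c' ->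
  exists2 r0 : R, 0 < r0 & forall r, 0 < r < r0 ->
  ambient_isotopic R (@esphere R N r) (link (real_map (gp fw mm c)) r)
    (link (real_map (gp fw mm c')) r).
Proof.
move=> tc tc'.
have [t t0 ht] := round_to_weighted tc; have [t' t'0 ht'] := round_to_weighted tc'.
have [u u0 hu] := coef_scale_small e_gt0 tc; have [u' u'0 hu'] := coef_scale_small e_gt0 tc'.
pose v := Num.min u u'; have v0 : 0 < v by rewrite lt_min u0.
pose s := Num.max (Num.max t t') (v ^- (2 * M)).
have s0 : 0 < s by rewrite !lt_max t0.
have [r1 r10 hr1] : exists2 r0 : R, 0 < r0 & forall r, 0 < r < r0 ->
  ambient_isotopic R (@esphere R N r)
    (link (real_map (gp fw mm c)) r)
    [set radial r x | x in
       [set x | (forall j, pe (gp fw mm c j) x = 0) /\ level m 0 s x]].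
  by apply: ht; rewrite !le_max lexx.
have [r2 r20 hr2] : exists2 r0 : R, 0 < r0 & forall r, 0 < r < r0 ->
  ambient_isotopic R (@esphere R N r)
    (link (real_map (gp fw mm c')) r)
    [set radial r x | x in
       [set x | (forall j, pe (gp fw mm c' j) x = 0) /\ level m 0 s x]].
  by apply: ht'; rewrite !le_max lexx orbT.
exists (Num.min r1 r2); first by rewrite lt_min r10.
move=> r /andP[r0]; rewrite lt_min => /andP[rr1 rr2].
have h1 := hr1 r; rewrite r0 rr1 in h1; have {}h1 := h1 isT.
have h2 := hr2 r; rewrite r0 rr2 in h2; have {}h2 := h2 isT.
apply: ambient_isotopic_trans h1 _.
apply: (@ambient_isotopic_trans _ _ _ _ _ _ _ (ambient_isotopic_sym _ h2)); last first.
  by move=> x [].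
apply: isotopy_path => //; rewrite ?add0r ?(ltW s0) //.
move=> w x /andP[w0 w1].
pose cw := c + w *: (c' - c).
have fE : (fun j => gp fw mm c j + w *: (gp fw mm c' j - gp fw mm c j)) =
    gp fw mm cw.
  apply/funext => j; rewrite /gp opprD addrACA subrr add0r -addrA; congr (_ + _).
  rewrite -sumrB scaler_sumr -big_split /=; apply: eq_bigr => a _.
  by rewrite -scalerBl scalerA -scalerDl !mxE.
have gE j : gp fw mm c j + w *: (gp fw mm c' j - gp fw mm c j) = gp fw mm cw j.
  by have := congr1 (fun f => f j) fE.
rewrite fE !subrr !oppr0 !mulr0 !addr0 => gx lx.
rewrite /star scale0r add0r; apply: regular_pcons_scale; first by rewrite gt_eqF.
have x0 : x != 0 by exact: (level_neq0 m0 lx).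
have wx : pe (wpoly R m) x = s^-1.
  move: lx; rewrite /level /= pe_star mul0r add0r => lx.
  by rewrite -[LHS]mul1r -(mulVf (x := s)) ?gt_eqF // -mulrA lx mulr1.
have xv : wrad m M x <= v.
  apply: wrad_le => //; rewrite wx -[leRHS]invrK lef_pV2 ?posrE //.
    by rewrite le_max lexx orbT.
  by rewrite invr_gt0 exprn_gt0.
apply: regular_at => //; last by move=> j; rewrite -gE.
have r0x := wrad_gt0 m M x0.
have cs1 : `|coef_scale del (wrad m M x) c| <= e.
  by apply: hu; rewrite r0x /= (le_trans xv) // ge_min lexx.
have cs2 : `|coef_scale del (wrad m M x) c'| <= e.
  by apply: hu'; rewrite r0x /= (le_trans xv) // ge_min lexx orbT.
have -> : coef_scale del (wrad m M x) cw = (1 - w) *: coef_scale del (wrad m M x) c +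
    w *: coef_scale del (wrad m M x) c' by apply/rowP => a; rewrite !mxE; ring.
apply: le_trans (ler_normD _ _) _; rewrite !normrZ !ger0_norm ?subr_ge0 //.
apply: (@le_trans _ _ ((1 - w) * e + w * e)); last by rewrite -mulrDl subrK mul1r.
by rewrite lerD // ler_wpM2l // subr_ge0.
Qed.

End LinkIsotopy.

(** * Displacements on a weighted shell *)

Section WeightedShell.
Variables (R : realType) (N : nat) (W m : 'I_N -> nat) (M : nat).
Hypothesis M_gt0 : (0 < M)%N.
Hypothesis mW : forall i, (m i * W i = M)%N.

Let m0 := m_gt0 M_gt0 mW.

(** A fundamental annulus, with room to compare points whose weighted radii
    have a ratio up to [4]. *)
Definition shell : set 'rV[R]_N := [set x | 1 / 4 <= wrad m M x <= 4].

Definition unit_sphere : set 'rV[R]_N := [set x | pe (wpoly R m) x = 1].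

Definition wdir (x : 'rV[R]_N) := wscale W (wrad m M x)^-1 x.

Lemma wrad_unit (x : 'rV[R]_N) : unit_sphere x <-> wrad m M x = 1.
Proof.
split=> h; last by rewrite /unit_sphere /= -(wradX m M_gt0) h expr1n.
apply: (expr_inj_ge0 M_gt0); rewrite ?wrad_ge0 //.
by rewrite (wradX m M_gt0) h expr1n.
Qed.

Lemma wrad_neq0 (x : 'rV[R]_N) : 0 < wrad m M x -> x != 0.
Proof. by move=> h; apply: contraTneq h => ->; rewrite (wrad0 _ M_gt0 mW) ltxx. Qed.

Lemma shell_gt0 (x : 'rV[R]_N) : shell x -> 0 < wrad m M x.
Proof. by move=> /andP[h _]; apply: lt_le_trans h; rewrite divr_gt0. Qed.

Lemma unit_shell (x : 'rV[R]_N) : unit_sphere x -> shell x.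
Proof. by move=> /wrad_unit; rewrite /shell /= => ->; apply/andP; split; lra. Qed.

Lemma shell_bounded : exists C : R, forall x : 'rV[R]_N, shell x -> `|x| <= C.
Proof.
exists (\sum_i 4 ^+ W i : R) => x /andP[_ x4]; apply: normr_row_le => [|i].
  by rewrite sumr_ge0 // => i _; rewrite exprn_ge0.
apply: le_trans (coord_le_wrad M_gt0 mW x i) _.
apply: (@le_trans _ _ (4 ^+ W i : R)); first by rewrite lerXn2r ?nnegrE ?wrad_ge0.
by rewrite (bigD1 i) //= lerDl sumr_ge0 // => j _; rewrite exprn_ge0.
Qed.

(** The converse of [subX_le], away from zero. *)
Lemma subX_ge (s t c : R) k : 0 <= c -> c <= t -> t <= s ->
  c ^+ k * (s - t) <= s ^+ k.+1 - t ^+ k.+1.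
Proof.
move=> c0 ct ts; have t0 := le_trans c0 ct; have s0 := le_trans t0 ts.
have -> : s ^+ k.+1 - t ^+ k.+1 = s ^+ k * (s - t) + t * (s ^+ k - t ^+ k).
  by rewrite !exprS; ring.
have h1 : c ^+ k * (s - t) <= s ^+ k * (s - t).
  by rewrite ler_wpM2r ?subr_ge0 // lerXn2r ?nnegrE // (le_trans ct).
by rewrite (le_trans h1) // lerDl mulr_ge0 // subr_ge0 lerXn2r ?nnegrE.
Qed.

Lemma blip_wrad : blip shell (wrad m M).
Proof.
have [C bX] := shell_bounded; have [B [B0 _ Bl]] := blip_base bX (wpoly R m).
pose c : R := (1 / 4) ^+ (2 * M).-1; have c0 : 0 < c by rewrite exprn_gt0 // divr_gt0.
have M2 : (0 < 2 * M)%N by rewrite muln_gt0.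
exists (4 + c^-1 * B); split=> [|x /andP[_ x4]|x y Xx Xy].
- by rewrite addr_ge0 // mulr_ge0 // invr_ge0 ltW.
- rewrite ger0_norm ?wrad_ge0 //; apply: le_trans x4 _.
  by rewrite lerDl mulr_ge0 // invr_ge0 ltW.
have key (u v : R) : 1 / 4 <= u -> 1 / 4 <= v ->
    c * `|u - v| <= `|u ^+ (2 * M) - v ^+ (2 * M)|.
  wlog vu : u v / v <= u.
    move=> w u4 v4; have [vu|/ltW uv] := leP v u; first exact: w.
    by rewrite distrC [leRHS]distrC w.
  move=> u4 v4; rewrite ger0_norm ?subr_ge0 //.
  rewrite ger0_norm ?subr_ge0 ?lerXn2r ?nnegrE //; try lra.
  rewrite -{1 2}(prednK M2); by apply: subX_ge => //; lra.
have /andP[x4 _] := Xx; have /andP[y4 _] := Xy.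
have := le_trans (key _ _ x4 y4) (_ : _ <= B * `|x - y|).
rewrite !(wradX m M_gt0) => /(_ (Bl _ _ Xx Xy)) h.
apply: (@le_trans _ _ (c^-1 * B * `|x - y|)).
  by rewrite -mulrA mulrC ler_pdivlMr // mulrC.
by rewrite ler_wpM2r // lerDr.
Qed.

Lemma blipX (V : normedModType R) (A : set V) (f : V -> R) k :
  blip A f -> blip A (fun x => f x ^+ k).
Proof.
move=> bf; elim: k => [|k ih]; first exact: blip_cst.
by apply: eq_blip (blipM bf ih) => x _; rewrite exprS.
Qed.

Lemma blip_wradV : blip shell (fun x => (wrad m M x)^-1).
Proof.
apply: (@blipV _ _ _ _ (1 / 4)) blip_wrad; first by rewrite divr_gt0.
by move=> x /andP[h _]; rewrite ger0_norm ?wrad_ge0.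
Qed.

Lemma blip_wdir i : blip shell (fun x => wdir x 0 i).
Proof.
have [C bX] := shell_bounded.
have h := blipM (blipX (W i) blip_wradV) (blip_coord i bX).
by apply: eq_blip h => x _; rewrite mxE.
Qed.

Lemma wdir_unit (x : 'rV[R]_N) : shell x -> unit_sphere (wdir x).
Proof. by move/shell_gt0/wrad_neq0 => x0; exact: (wpoly_unit M_gt0 mW). Qed.

Lemma wdirK (x : 'rV[R]_N) : 0 < wrad m M x -> wscale W (wrad m M x) (wdir x) = x.
Proof. by move=> r0; rewrite wscaleVK. Qed.

Lemma wdir_scale t (x : 'rV[R]_N) : 0 < t -> wdir (wscale W t x) = wdir x.
Proof.
move=> t0; rewrite /wdir (wrad_scale M_gt0 mW) // wscaleA invfM.
by rewrite -mulrA mulrCA mulVf ?mulr1 // gt_eqF.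
Qed.

(** Uniform continuity of the weighted radius on bounded sets. *)
Lemma unit_sphere_near : exists2 r : R, 0 < r & forall x y : 'rV[R]_N,
  unit_sphere x -> `|y - x| <= r -> 3 / 4 <= wrad m M y <= 4 / 3.
Proof.
have [C bX] := shell_bounded.
pose B := [set x : 'rV[R]_N | `|x| <= Num.max C 0 + 1].
have [L [L0 _ Ll]] := blip_base (X := B) (fun x h => h) (wpoly R m).
pose a : R := 1 - (3 / 4) ^+ (2 * M); pose b : R := (4 / 3) ^+ (2 * M) - 1.
have M2 : (0 < 2 * M)%N by rewrite muln_gt0.
have a0 : 0 < a by rewrite subr_gt0 exprn_ilt1 -?lt0n //; lra.
have b0 : 0 < b by rewrite subr_gt0 exprn_egt1 -?lt0n //; lra.
have L1 : 0 < L + 1 by rewrite ltr_wpDl.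
pose r := Num.min 1 (Num.min a b / (L + 1)).
have r0 : 0 < r by rewrite lt_min ltr01 divr_gt0 // lt_min a0.
exists r => // x y ux yx.
have r1 : r <= 1 by rewrite ge_min lexx.
have Lr : L * r <= Num.min a b.
  have h : r <= Num.min a b / (L + 1) by rewrite ge_min lexx orbT.
  apply: (@le_trans _ _ ((L + 1) * r)); first by rewrite ler_wpM2r ?(ltW r0) // lerDl.
  by rewrite mulrC -ler_pdivlMr.
have xC : `|x| <= Num.max C 0.
  by apply: le_trans (bX _ (unit_shell ux)) _; rewrite le_max lexx.
have Bx : B x by rewrite /B /=; lra.
have By : B y.
  rewrite /B /= -(subrK x y); apply: le_trans (ler_normD _ _) _.
  by move: xC yx r1; lra.
have := Ll _ _ By Bx; rewrite ux => h.
have {}h : `|pe (wpoly R m) y - 1| <= Num.min a b.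
  apply: le_trans h (le_trans _ Lr); exact: ler_wpM2l.
move: h; rewrite le_min !ler_norml -(wradX m M_gt0) /a /b.
move=> /andP[/andP[h1 _] /andP[_ h2]].
by apply/andP; split; rewrite -(@ler_pXn2r _ (2 * M)) ?nnegrE ?wrad_ge0 //; lra.
Qed.

End WeightedShell.


Section ShellDisplacement.
Variables (R : realType) (N P L : nat).
Variables (W m : 'I_N -> nat) (M : nat) (D : 'I_P -> nat) (del : 'I_L -> nat).
Hypothesis M_gt0 : (0 < M)%N.
Hypothesis mW : forall i, (m i * W i = M)%N.
Variables (fw : 'I_P -> mpoly N R) (mm : 'I_L -> 'I_P -> mpoly N R).
Hypothesis hfw : forall j, whomog W (D j) (fw j).
Hypothesis hmm : forall a j, whomog W (D j + del a) (mm a j).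
Hypothesis fw_submersion : forall x : 'rV[R]_N, x != 0 -> regular fw x.

Let m0 := m_gt0 M_gt0 mW.
Let rad := wrad (R := R) m M.
Let dir := wdir (R := R) W m M.
Let X : set 'rV[R]_N := shell m M.

Definition unit_frame (u : 'rV[R]_N) : 'M[R]_(P, N) :=
  (\det (gram fw u))^-1 *: (\adj (gram fw u) *m (jac fw u)^T).

(** A right inverse of the differential of [fw], made equivariant under the
    weighted dilations. *)
Definition shell_frame (x : 'rV[R]_N) : 'M[R]_(P, N) :=
  \matrix_(j, i) ((rad x)^-1 ^+ D j * unit_frame (dir x) j i * rad x ^+ W i).

Lemma unit_frame_jac (u : 'rV[R]_N) : u != 0 -> unit_frame u *m jac fw u = 1%:M.
Proof.
move=> u0; rewrite /unit_frame -scalemxAl -mulmxA -/(gram fw u) mul_adj_mx.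
by rewrite scale_scalar_mx mulVf // regular_gram //; exact: fw_submersion.
Qed.

Lemma shell_frame_jac (x : 'rV[R]_N) : x != 0 -> shell_frame x *m jac fw x = 1%:M.
Proof.
move=> x0; have r0 : 0 < rad x by exact: wrad_gt0.
have d0 : dir x != 0.
  apply: (wrad_neq0 M_gt0 mW); have : unit_sphere m (dir x) by exact: (wpoly_unit M_gt0 mW).
  by move/(wrad_unit m M_gt0) ->.
apply/matrixP => j k.
have := congr1 (fun A : 'M[R]_P => A j k) (unit_frame_jac d0).
rewrite mxE [RHS]mxE => h.
rewrite mxE [RHS]mxE; transitivity ((rad x)^-1 ^+ D j * rad x ^+ D k *
    \sum_i unit_frame (dir x) j i * jac fw (dir x) i k).
  rewrite mulr_sumr; apply: eq_bigr => i _; rewrite [shell_frame _ _ _]mxE.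
  have := whomog_mderiv i (dir x) (hfw k) r0.
  rewrite (wdirK W r0) => h'.
  rewrite -!mulrA; congr (_ * _); rewrite [RHS]mulrCA; congr (_ * _).
  by rewrite !mxE h'.
rewrite h; have [->|jk] := eqVneq j k; last by rewrite mulr0.
by rewrite mulr1 -exprMn mulVf ?expr1n // gt_eqF.
Qed.

Lemma shell_frame_scale t (x : 'rV[R]_N) j i : 0 < t ->
  shell_frame (wscale W t x) j i = t ^- D j * shell_frame x j i * t ^+ W i.
Proof.
move=> t0; rewrite [LHS]mxE [shell_frame x _ _]mxE /rad (wrad_scale M_gt0 mW) // /dir (wdir_scale M_gt0 mW) //.
by rewrite invfM !exprMn !exprVn; ring.
Qed.

Lemma blip_unit_frame j i : blip (unit_sphere m) (fun u => unit_frame u j i).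
Proof.
have [C bX] := shell_bounded R M_gt0 mW.
have bU u : unit_sphere m u -> `|u| <= C by move/(unit_shell M_gt0)/bX.
have bd : blip (unit_sphere m) (fun u => \det (gram fw u)).
  by apply: blip_det => k l; exact: blip_gram bU.
have [t t0 ht] : exists2 t, 0 < t & forall u, unit_sphere m u -> t <= `|\det (gram fw u)|.
  apply: compact_pos_lb.
  - have h : unit_sphere (R := R) m = level m 0 1 by rewrite /unit_sphere -star_w1.
    by rewrite h; apply: (level_compact m0) => //; rewrite add0r.
  - apply: (cts_on_comp (B := setT)) (blip_cts_on bd) _ => //.
    by apply: cts_on_continuous; exact: norm_continuous.
  move=> u uu; rewrite normr_gt0 regular_gram //; apply: fw_submersion.
  by apply: (wrad_neq0 M_gt0 mW); move/(wrad_unit m M_gt0): uu => ->.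
have h : blip (unit_sphere m) (fun u => (\det (gram fw u))^-1 *
    \sum_k (\adj (gram fw u)) j k * jac fw u i k).
  apply: blipM; first exact: (blipV t0 ht).
  apply: blip_sum => k; apply: blipM.
    by apply: blip_adj => a b; exact: blip_gram bU.
  by apply: eq_blip (blip_base bU (mderiv i (fw k))) => u _; rewrite mxE.
apply: eq_blip h => u _; rewrite [RHS]mxE [X in _ = _ * X]mxE; congr (_ * _).
by apply: eq_bigr => k _; congr (_ * _); rewrite [RHS]mxE.
Qed.

Lemma blip_shell_frame j i : blip X (fun x => shell_frame x j i).
Proof.
have h : blip X (fun x => (rad x)^-1 ^+ D j * unit_frame (dir x) j i * rad x ^+ W i).
  apply: blipM; last by apply: blipX; exact: (blip_wrad R M_gt0 mW).
  apply: blipM; first by apply: blipX; exact: (blip_wradV R M_gt0 mW).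
  have [c [c0 _ cl]] := blip_fin (fun i => blip_wdir R M_gt0 mW i).
  apply: (blip_comp (A := unit_sphere m) (f := fun u => unit_frame u j i) (k := c)).
  - by move=> x; exact: (wdir_unit M_gt0 mW).
  - move=> x y Xx Xy; apply: normr_row_le => [|l]; first by rewrite mulr_ge0.
    have -> : (dir x - dir y) 0 l = dir x 0 l - dir y 0 l by rewrite mxE [X in _ + X]mxE.
    exact: cl.
  exact: blip_unit_frame.
by apply: eq_blip h => x _; rewrite [RHS]mxE.
Qed.

(** The two values [gp s (x + v)] and [gp t x] agree for [v = y *m shell_frame x]
    exactly when [y] is a fixed point of a small system with coefficients
    [(- s, t)].  The dilations carry solutions to solutions, by the choice of
    the frame, so uniqueness of the solution makes [K] equivariant. *)
Theorem shell_displacement (k : R) : 0 < k -> exists2 d : R, 0 < d &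
  exists K : 'rV[R]_L -> 'rV[R]_L -> 'rV[R]_N -> 'rV[R]_N,
  [/\ forall s t x, `|s| <= d -> `|t| <= d -> X x -> `|K s t x| <= k,
      forall s t x x', `|s| <= d -> `|t| <= d -> X x -> X x' ->
        `|K s t x - K s t x'| <= k * `|x - x'|,
      cts_on [set z : 'rV[R]_L * 'rV[R]_L * 'rV[R]_N |
        [/\ `|z.1.1| <= d, `|z.1.2| <= d & X z.2]] (fun z => K z.1.1 z.1.2 z.2),
      forall s t x j, `|s| <= d -> `|t| <= d -> X x ->
        pe (gp fw mm s j) (x + K s t x) = pe (gp fw mm t j) x &
      forall l s t x, 1 / 4 <= l <= 4 -> X x -> X (wscale W l x) ->
        `|s| <= d -> `|t| <= d ->
        `|coef_scale del l s| <= d -> `|coef_scale del l t| <= d ->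
        K s t (wscale W l x) = wscale W l (K (coef_scale del l s) (coef_scale del l t) x)].
Proof.
move=> k0; have [C bX] := shell_bounded R M_gt0 mW.
have bA := blip_shell_frame; pose A := shell_frame.
pose fs j (z : 'rV[R]_N * 'rV[R]_P) := - taylor_rem (fw j) z.1 (z.2 *m A z.1).
pose us (a : 'I_(L + L)) j (z : 'rV[R]_N * 'rV[R]_P) := match fintype.split a with
  | inl b => - pe (mm b j) (z.1 + z.2 *m A z.1)
  | inr b => pe (mm b j) z.1 end.
have sf j : small X (fs j) by apply: smallN; exact: (small_taylor bX bA).
have f0 j x : fs j (x, 0) = 0 by rewrite /fs /= mul0mx taylor_rem0 oppr0.
have bu a j : blip (slab X 1) (us a j).
  rewrite /us; case: fintype.split => b; first by apply: blipN; exact: (blip_move bX bA).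
  apply: (@blip_fst R N P X (fun x => pe (mm b j) x)); exact: (blip_base bX).
have [e e0 he] := displacement_solution bA sf f0 bu k0.
pose q : R := \prod_j 4 ^+ D j; have q0 : 0 < q by rewrite prodr_gt0 // => j _; rewrite exprn_gt0.
have qD j : 4 ^+ D j <= q.
  rewrite /q (bigD1 j) //= ler_peMr ?exprn_ge0 //.
  by apply: (big_ind (fun v : R => 1 <= v)) => [|v v' v1 v'1|i _]; rewrite ?mulr_ege1 ?exprn_ege1 ?ler1n.
have [d d0 [y [yb ys yu] [Kb Kl [c0 Kc]]]] := he _ (divr_gt0 e0 q0).
exists d => //; pose K s t x := y (row_mx s t) x *m A x; exists K.
have rn (s t : 'rV[R]_L) (r : R) : 0 <= r -> `|s| <= r -> `|t| <= r -> `|row_mx s t| <= r.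
  move=> r0 sr tr; apply: normr_row_le => // a; rewrite mxE.
  by case: fintype.split => b; apply: le_trans (normr_coord _ _) _.
have rd (s t : 'rV[R]_L) : `|s| <= d -> `|t| <= d -> `|row_mx s t| <= d by apply: rn; exact: ltW.
have sysE s t x (z : 'rV[R]_P) j : X x ->
    small_system fs us (row_mx s t) x z 0 j = z 0 j -
      (pe (gp fw mm s j) (x + z *m A x) - pe (gp fw mm t j) x).
  move=> /(shell_gt0)/(wrad_neq0 M_gt0 mW) x0.
  rewrite mxE big_split_ord /= /fs /taylor_rem /= !pe_gp.
  have -> : \sum_i (z *m A x) 0 i * pe (mderiv i (fw j)) x = z 0 j.
    have : (z *m A x *m jac fw x) 0 j = z 0 j.
      by rewrite -mulmxA shell_frame_jac // mulmx1.
    rewrite mxE => h; rewrite -[RHS]h; apply: eq_bigr => i _; congr (_ * _).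
    by rewrite mxE.
  have -> : \sum_a row_mx s t 0 (lshift L a) * us (lshift L a) j (x, z) =
      - \sum_a s 0 a * pe (mm a j) (x + z *m A x).
    rewrite -sumrN; apply: eq_bigr => a _; rewrite row_mxEl /us.
    by rewrite -/(unsplit (inl a)) (unsplitK (inl a)) mulrN.
  have -> : \sum_a row_mx s t 0 (rshift L a) * us (rshift L a) j (x, z) =
      \sum_a t 0 a * pe (mm a j) x.
    apply: eq_bigr => a _; rewrite row_mxEr /us.
    by rewrite -/(unsplit (inr a)) (unsplitK (inr a)).
  by ring.
have KE s t x j : `|s| <= d -> `|t| <= d -> X x ->
    pe (gp fw mm s j) (x + K s t x) = pe (gp fw mm t j) x.
  move=> sd td Xx; have := congr1 (fun r : 'rV_P => r 0 j) (ys _ _ (rd _ _ sd td) Xx).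
  by rewrite sysE // -/(K s t x) => h; move: h; lra.
split=> //.
- by move=> s t x sd td Xx; apply: Kb => //; exact: rd.
- by move=> s t x x' sd td Xx Xx'; apply: Kl => //; exact: rd.
- apply: (@lip_cts_on R _ _ _ _ (k + `|c0|)) => -[[s t] x] [[s' t'] x'] /= [sd td Xx] [sd' td' Xx'].
  have -> : K s t x - K s' t' x' = (K s t x - K s t x') + (K s t x' - K s' t' x').
    by rewrite addrA subrK.
  have h1 := Kl _ _ _ (rd _ _ sd td) Xx Xx'.
  have h2 := Kc _ _ _ (rd _ _ sd td) (rd _ _ sd' td') Xx'.
  rewrite -/(K s t x) -/(K s t x') in h1; rewrite -/(K s t x') -/(K s' t' x') in h2.
  rewrite norm_pair /= norm_pair /=; set n := Num.max _ _.
  have n1 : `|x - x'| <= n by rewrite le_max lexx orbT.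
  have n2 : `|row_mx s t - row_mx s' t'| <= n.
    rewrite opp_row_mx add_row_mx; apply: rn.
    - by apply: le_trans n1.
    - by rewrite !le_max lexx.
    by rewrite !le_max lexx orbT.
  apply: le_trans (ler_normD _ _) _; rewrite mulrDl lerD //.
    by apply: le_trans h1 _; rewrite ler_wpM2l // ltW.
  apply: le_trans h2 _; apply: (@le_trans _ _ (`|c0| * `|row_mx s t - row_mx s' t'|)).
    by rewrite ler_wpM2r // ler_norm.
  exact: ler_wpM2l.
move=> l s t x /andP[l4 l4'] Xx Xlx sd td sd' td'.
have l0 : 0 < l by apply: lt_le_trans l4; rewrite divr_gt0.
set s' := coef_scale del l s; set t' := coef_scale del l t.
pose z := y (row_mx s' t') x; pose z' : 'rV[R]_P := \row_j (l ^+ D j * z 0 j).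
have zA : z' *m A (wscale W l x) = wscale W l (K s' t' x).
  apply/rowP => i; rewrite [RHS]mxE !(mxE, mulmxE) mulr_sumr; apply: eq_bigr => j _.
  rewrite [z' _ _]mxE [A _ _ _]shell_frame_scale //.
  rewrite -[X in _ = _ * X]/(z 0 j * A x j i) /A.
  have lD : l ^+ D j != 0 by rewrite expf_neq0 // gt_eqF.
  by field.
have zE : z' = y (row_mx s t) (wscale W l x).
  apply: yu => //; first exact: rd.
    apply: normr_row_le => [|j]; first exact: ltW.
    have [zq _] := yb _ _ (rd _ _ sd' td') Xx.
    rewrite mxE normrM ger0_norm ?exprn_ge0 ?(ltW l0) //.
    have -> : e = q * (e / q) by rewrite mulrC divfK // gt_eqF.
    apply: ler_pM; rewrite ?exprn_ge0 ?(ltW l0) //.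
      by apply: le_trans (qD j); rewrite lerXn2r ?nnegrE ?(ltW l0).
    by apply: le_trans (normr_coord _ _) zq.
  apply/rowP => j; rewrite sysE // zA.
  have -> : wscale W l x + wscale W l (K s' t' x) = wscale W l (x + K s' t' x).
    by apply/rowP => i; rewrite !mxE mulrDr.
  by rewrite !(pe_gp_scale hfw hmm) // KE // subrr subr0.
by rewrite /K -zE zA.
Qed.

End ShellDisplacement.

(** * Trivialising homeomorphisms *)

Section CtsOnReal.
Variables (R : realType) (X : topologicalType) (A : set X).
Implicit Types f g : X -> R.

Lemma cts_onD f g : cts_on A f -> cts_on A g -> cts_on A (fun x => f x + g x).
Proof.
move=> cf cg x Ax; apply: (@cvgD _ R^o _ (within A (nbhs x)) _ f g (f x) (g x)).
  exact: cf. exact: cg.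
Qed.

Lemma cts_onM f g : cts_on A f -> cts_on A g -> cts_on A (fun x => f x * g x).
Proof.
move=> cf cg x Ax; apply: (@cvgM _ _ (within A (nbhs x)) _ f g (f x) (g x)).
  exact: cf. exact: cg.
Qed.

Lemma cts_onX f k : cts_on A f -> cts_on A (fun x => f x ^+ k).
Proof.
move=> cf; elim: k => [|k ih]; first by apply: cts_on_continuous => x; exact: cvg_cst.
by apply: eq_cts_on (cts_onM cf ih) => x _; rewrite exprS.
Qed.

Lemma cts_onV f : (forall x, A x -> f x != 0) -> cts_on A f ->
  cts_on A (fun x => (f x)^-1).
Proof.
move=> f0 cf x Ax; apply: (@cvgV _ _ (within A (nbhs x)) _ f (f x)) (f0 _ Ax) _.
exact: cf.
Qed.

Lemma cts_on_row n (f : X -> 'rV[R]_n) :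
  (forall i, cts_on A (fun x => f x 0 i)) -> cts_on A f.
Proof.
move=> cf x Ax U /nbhs_ballP[e /= e0 eU].
have e2 : 0 < e / 2 by rewrite divr_gt0.
have nb : nbhs x [set z | forall i, A z -> ball (f x 0 i) (e / 2) (f z 0 i)].
  apply: filter_forall => i; exact: cf (nbhsx_ballx _ _ e2).
apply: filterS nb => z h Az; apply: eU; rewrite -ball_normE /=.
apply: (@le_lt_trans _ _ (e / 2)); last by lra.
apply: normr_row_le => [|i]; first exact: ltW.
by have := h i Az; rewrite -ball_normE /= !mxE => /ltW.
Qed.

Lemma cts_on_coord n (f : X -> 'rV[R]_n) i : cts_on A f -> cts_on A (fun x => f x 0 i).
Proof.
move=> cf; apply: (cts_on_comp (B := setT) (g := fun y : 'rV[R]_n => y 0 i) _ cf) => //.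
by apply: cts_on_continuous => x; exact: coord_continuous.
Qed.

End CtsOnReal.

Section Ratios.
Variable R : realType.
Implicit Types a b c : R.

Lemma ratio_neq0 a : 3 / 4 * a <= 0 -> 0 < a -> False.
Proof. lra. Qed.

Lemma le_4_16 a : 0 < a -> 4 * a <= 16 * a.
Proof. lra. Qed.

Lemma half_le_le0 a : a <= 1 / 2 * a -> a <= 0.
Proof. lra. Qed.

Lemma ratio_le4 a b c : 0 <= a -> 3 / 4 * a <= c -> c <= 4 / 3 * a ->
  3 / 4 * b <= c -> c <= 4 / 3 * b -> 1 / 4 * a <= b <= 4 * a.
Proof. by move=> *; apply/andP; split; lra. Qed.

End Ratios.

Section Triviality.
Variables (R : realType) (N P L : nat).
Variables (W m : 'I_N -> nat) (M : nat) (D : 'I_P -> nat) (del : 'I_L -> nat).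
Hypothesis M_gt0 : (0 < M)%N.
Hypothesis mW : forall i, (m i * W i = M)%N.
Variables (fw : 'I_P -> mpoly N R) (mm : 'I_L -> 'I_P -> mpoly N R).
Hypothesis hfw : forall j, whomog W (D j) (fw j).
Hypothesis hmm : forall a j, whomog W (D j + del a) (mm a j).
Hypothesis D_gt0 : forall j, (0 < D j)%N.

Let rad := wrad (R := R) m M.
Let dir := wdir (R := R) W m M.
Let X : set 'rV[R]_N := shell m M.
Let cs := coef_scale (R := R) del.

(** As provided by [unit_sphere_near] and [shell_displacement]. *)
Variables (r d : R) (K : 'rV[R]_L -> 'rV[R]_L -> 'rV[R]_N -> 'rV[R]_N).
Hypothesis d_gt0 : 0 < d.
Hypothesis r_gt0 : 0 < r.
Hypothesis hr : forall x y : 'rV[R]_N, unit_sphere m x -> `|y - x| <= r ->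
  3 / 4 <= rad y <= 4 / 3.
Hypothesis K_small : forall s t x, `|s| <= d -> `|t| <= d -> X x -> `|K s t x| <= r.
Hypothesis K_lip : forall s t x x', `|s| <= d -> `|t| <= d -> X x -> X x' ->
  `|K s t x - K s t x'| <= 1 / 2 * `|x - x'|.
Hypothesis K_cts : cts_on [set z : 'rV[R]_L * 'rV[R]_L * 'rV[R]_N |
  [/\ `|z.1.1| <= d, `|z.1.2| <= d & X z.2]] (fun z => K z.1.1 z.1.2 z.2).
Hypothesis K_eq : forall s t x j, `|s| <= d -> `|t| <= d -> X x ->
  pe (gp fw mm s j) (x + K s t x) = pe (gp fw mm t j) x.
Hypothesis K_scale : forall l s t x, 1 / 4 <= l <= 4 -> X x -> X (wscale W l x) ->
  `|s| <= d -> `|t| <= d -> `|cs l s| <= d -> `|cs l t| <= d ->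
  K s t (wscale W l x) = wscale W l (K (cs l s) (cs l t) x).

Let d' := Num.min 1 d.

(** Displace the direction of [x] on the unit weighted sphere, with the
    coefficients seen at the scale of [x], and return to that scale. *)
Definition triv c c' (x : 'rV[R]_N) : 'rV[R]_N := if x == 0 then 0 else
  wscale W (rad x) (dir x + K (cs (rad x) c) (cs (rad x) c') (dir x)).

Lemma cs_cs s t c : cs s (cs t c) = cs (t * s) c.
Proof. by apply/rowP => a; rewrite !mxE exprMn mulrA. Qed.

Lemma gp_at0 c j : pe (gp fw mm c j) 0 = 0.
Proof.
have w0 : wscale W 2 0 = 0 :> 'rV[R]_N by apply/rowP => i; rewrite !mxE mulr0.
have h k p : (0 < k)%N -> whomog W k p -> pe p 0 = 0 :> R.
  move=> k0 hp; have := hp 2 0 (ltr0Sn _ _); rewrite w0 => /eqP.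
  rewrite -{1}[pe p 0]mul1r -subr_eq0 -mulrBl mulf_eq0 subr_eq0.
  by rewrite eq_sym gt_eqF /= ?exprn_egt1 -?lt0n ?ltr1n // => /eqP.
rewrite pe_gp (h (D j)) // add0r big1 // => a _.
by rewrite (h (D j + del a)%N) ?mulr0 // addn_gt0 D_gt0.
Qed.

Section Coefficients.
Variables c c' : 'rV[R]_L.
Hypotheses (tc : tame del d c) (tc' : tame del d c').

Let C := `|c| + `|c'| + 1.

Lemma C_gt0 : 0 < C.
Proof. by rewrite /C ltr_wpDl // addr_ge0. Qed.

Lemma cs_le t : 0 < t -> t * C <= d' -> `|cs t c| <= d /\ `|cs t c'| <= d.
Proof.
move=> t0 tC; have C0 := C_gt0.
have t1 : t <= 1.
  have : t * C <= 1 by apply: le_trans tC _; rewrite ge_min lexx.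
  apply: le_trans; rewrite ler_peMr ?(ltW t0) // /C lerDr addr_ge0 //.
have tCd : t * C <= d by apply: le_trans tC _; rewrite ge_min lexx orbT.
split; apply: coef_scale_le; rewrite ?t0 ?(ltW d_gt0) //;
  apply: le_trans tCd; rewrite mulrC ler_pM2l // /C.
  by rewrite -addrA lerDl addr_ge0.
by rewrite addrAC lerDr addr_ge0.
Qed.

Lemma dirX x : x != 0 -> X (dir x).
Proof.
by move=> x0; apply: (unit_shell M_gt0); exact: (wpoly_unit M_gt0 mW).
Qed.

(** By equivariance of [K] the scale need not be that of the point: in the chart
    at scale [t], all points of the shell are displaced by one and the same
    Lipschitz map. *)
Lemma triv_scale t v : 0 < t -> 4 * t * C <= d' -> X v ->
  triv c c' (wscale W t v) = wscale W t (v + K (cs t c) (cs t c') v).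
Proof.
move=> t0 tC Xv; have v0 := shell_gt0 Xv; rewrite -/(rad v) in v0.
have vn := wrad_neq0 M_gt0 mW v0.
have tv : rad (wscale W t v) = t * rad v by exact: (wrad_scale M_gt0 mW).
have tvn : wscale W t v != 0.
  by apply: (wrad_neq0 M_gt0 mW); rewrite -/(rad _) tv mulr_gt0.
have /andP[v4 v4'] := Xv; rewrite -/(rad v) in v4 v4'; have C0 := C_gt0.
rewrite /triv (negbTE tvn) tv /dir (wdir_scale M_gt0 mW) // -/(dir v).
have h1 : t * C <= d' by apply: le_trans tC; nra.
have h2 : t * rad v * C <= d'.
  by apply: le_trans tC; rewrite ler_wpM2r ?(ltW C0) // mulrC ler_wpM2r // ltW.
have [a1 a2] := cs_le t0 h1; have [a3 a4] := cs_le (mulr_gt0 t0 v0) h2.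
rewrite -wscaleA; congr wscale.
have vE : wscale W (rad v) (dir v) = v by exact: wdirK.
have -> : v + K (cs t c) (cs t c') v =
    wscale W (rad v) (dir v) + K (cs t c) (cs t c') (wscale W (rad v) (dir v)).
  by rewrite vE.
have h14 : 1 / 4 <= rad v <= 4 by rewrite v4.
have Xd : X (dir v) by exact: dirX.
have Xdv : X (wscale W (rad v) (dir v)) by rewrite vE.
rewrite (K_scale h14 Xd Xdv a1 a2) ?cs_cs //.
by apply/rowP => i; rewrite !mxE mulrDr.
Qed.

Lemma triv_near x : x != 0 -> rad x * C <= d' ->
  3 / 4 <= rad (dir x + K (cs (rad x) c) (cs (rad x) c') (dir x)) <= 4 / 3.
Proof.
move=> x0 xC; have r0 : 0 < rad x by exact: wrad_gt0.
have [a1 a2] := cs_le r0 xC.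
apply: (hr (x := dir x)); first exact: (wpoly_unit M_gt0 mW).
by rewrite addrAC subrr add0r; apply: K_small => //; exact: dirX.
Qed.

Lemma triv_rad x : rad x * C <= d' ->
  3 / 4 * rad x <= rad (triv c c' x) <= 4 / 3 * rad x.
Proof.
rewrite /triv; have [->|x0] := eqVneq x 0.
  by rewrite /rad (wrad0 _ M_gt0 mW) !mulr0 lexx.
move=> xC; have r0 : 0 < rad x by exact: wrad_gt0.
have /andP[h1 h2] := triv_near x0 xC.
have -> : rad (wscale W (rad x) (dir x + K (cs (rad x) c) (cs (rad x) c') (dir x))) =
    rad (dir x + K (cs (rad x) c) (cs (rad x) c') (dir x)) * rad x.
  by rewrite mulrC; exact: (wrad_scale M_gt0 mW).
by rewrite !ler_pM2r // h1.
Qed.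

Lemma triv_eq x j : rad x * C <= d' ->
  pe (gp fw mm c j) (triv c c' x) = pe (gp fw mm c' j) x.
Proof.
rewrite /triv; have [->|x0] := eqVneq x 0; first by rewrite !gp_at0.
move=> xC; have r0 : 0 < rad x by exact: wrad_gt0.
have [a1 a2] := cs_le r0 xC.
rewrite (pe_gp_scale hfw hmm) // K_eq //; last exact: dirX.
by rewrite -(pe_gp_scale hfw hmm) // (wdirK W r0).
Qed.

(** Points with the same image have comparable radii, hence lie in one chart,
    where the displacement is a contraction. *)
Lemma triv_inj x x' : 16 * rad x * C <= d' -> 16 * rad x' * C <= d' ->
  triv c c' x = triv c c' x' -> x = x'.
Proof.
move=> xC x'C xx'; have C0 := C_gt0.
have le1 y : 16 * rad y * C <= d' -> rad y * C <= d'.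
  have y0 : 0 <= rad y by exact: wrad_ge0.
  by apply: le_trans; rewrite ler_wpM2r ?(ltW C0) //; lra.
have /andP[h1 h2] := triv_rad (le1 _ xC); have /andP[h3 h4] := triv_rad (le1 _ x'C).
have [x0|x0] := eqVneq x 0.
  rewrite -xx' /triv x0 eqxx /rad (wrad0 _ M_gt0 mW) -/(rad x') in h3.
  apply/eqP; rewrite x0 eq_sym -[_ == _]negbK; apply/negP => x'0.
  have r'0 : 0 < rad x' by exact: wrad_gt0.
  by apply: ratio_neq0 h3 r'0.
have r0 : 0 < rad x by exact: wrad_gt0.
pose t := rad x; pose v := wscale W t^-1 x'.
have x'E : x' = wscale W t v by rewrite wscaleVK.
have xE : x = wscale W t (dir x) by rewrite wdirK.
have Xv : X v.
  rewrite /X /shell /= /v (wrad_scale M_gt0 mW) ?invr_gt0 // -/(rad x').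
  rewrite [t^-1 * _]mulrC ler_pdivlMr // ler_pdivrMr // /t.
  by apply: (ratio_le4 (ltW r0) h1 h2); rewrite xx'.
have tC : 4 * t * C <= d'.
  apply: le_trans xC; rewrite ler_wpM2r ?(ltW C0) // /t.
  exact: le_4_16.
have Xd := dirX x0.
have [a1 a2] := cs_le r0 (le1 _ xC).
move: xx'; rewrite {1}xE x'E triv_scale // triv_scale // => /(congr1 (wscale W t^-1)).
rewrite !wscaleK // -/t => vv; have := K_lip a1 a2 Xd Xv.
have -> : K (cs t c) (cs t c') (dir x) - K (cs t c) (cs t c') v = v - dir x.
  have -> : K (cs t c) (cs t c') (dir x) = v + K (cs t c) (cs t c') v - dir x.
    by rewrite -vv addrC addKr.
  by rewrite addrAC addrK.
rewrite distrC => le; have : `|dir x - v| <= 0.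
  exact: half_le_le0.
by rewrite normr_le0 subr_eq0 => /eqP dv; rewrite xE dv -x'E.
Qed.

(** The fixed point theorem in the chart at the scale of [z]. *)
Lemma triv_surj z : 32 * rad z * C < d' ->
  exists2 x, 16 * rad x * C < d' & triv c c' x = z.
Proof.
move=> zC; have C0 := C_gt0.
have [->|z0] := eqVneq z 0.
  exists 0; last by rewrite /triv eqxx.
  by rewrite /rad (wrad0 _ M_gt0 mW) mulr0 mul0r lt_min ltr01.
have r0 : 0 < rad z by exact: wrad_gt0.
set t := rad z in zC r0; pose w := dir z.
have uw : unit_sphere m w by exact: (wpoly_unit M_gt0 mW).
have wX u : `|u - w| <= r -> X u.
  by move=> uw'; have /andP[h1 h2] := hr uw uw'; apply/andP; rewrite -/(rad u); split; lra.
have tC : 4 * t * C <= d' by apply: ltW; apply: le_lt_trans zC; rewrite ler_wpM2r ?(ltW C0) //; lra.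
have [a1 a2] : `|cs t c| <= d /\ `|cs t c'| <= d.
  by apply: cs_le => //; apply: le_trans tC; rewrite ler_wpM2r ?(ltW C0) //; lra.
have [||u|u v|u ur uE] := @fixpoint_ball R _ (w : 'rV[R]_N) r (1 / 2)
    (fun u => w - K (cs t c) (cs t c') u).
- exact: ltW.
- by apply/andP; split; lra.
- by move=> ur; rewrite addrAC subrr add0r normrN; apply: K_small => //; exact: wX.
- move=> ur vr; rewrite opprB addrC addrA subrK distrC.
  by apply: K_lip => //; exact: wX.
exists (wscale W t u).
  rewrite /rad (wrad_scale M_gt0 mW) // -/(rad u); have /andP[_ h2] := hr uw ur.
  apply: le_lt_trans zC; rewrite ler_wpM2r ?(ltW C0) //.
  by have := ler_wpM2l (ltW r0) h2; lra.
rewrite triv_scale //; last exact: wX.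
by rewrite -{1}uE subrK; exact: wdirK.
Qed.

End Coefficients.
Section Family.
Variables (E : topologicalType) (e0 : E) (c : E -> 'rV[R]_L) (T : set E).
Hypothesis T_open : open T.
Hypothesis c_cts : continuous c.
Hypothesis c_tame : forall e, T e -> tame del d (c e).
Hypothesis c0_tame : tame del d (c e0).

Let V (z : E * 'rV[R]_N) := rad z.2 * (`|c z.1| + `|c e0| + 1).
Let W0 : set (E * 'rV[R]_N) := [set z | T z.1 /\ 8 * V z < d'].
Let h (e : E) := triv (c e) (c e0).

Lemma cts_c1 (A : set (E * 'rV[R]_N)) : cts_on A (fun z => c z.1).
Proof.
apply: (cts_on_comp (B := setT) (f := fun z : E * 'rV[R]_N => z.1) (g := c)) => //.
  by apply: cts_on_continuous => z; exact: cvg_fst.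
exact: cts_on_continuous.
Qed.

Lemma cts_snd (A : set (E * 'rV[R]_N)) : cts_on A (fun z => z.2).
Proof. by apply: cts_on_continuous => z; exact: cvg_snd. Qed.

Lemma cts_rad2 (A : set (E * 'rV[R]_N)) (f : E * 'rV[R]_N -> 'rV[R]_N) :
  cts_on A f -> cts_on A (fun z => rad (f z)).
Proof.
move=> cf; apply: (cts_on_comp (B := setT) (g := rad) _ cf) => //.
by apply: cts_on_continuous; exact: (wrad_continuous M_gt0).
Qed.

Lemma cts_weight (A : set (E * 'rV[R]_N)) (f : E * 'rV[R]_N -> 'rV[R]_N) :
  cts_on A f -> cts_on A (fun z => V (z.1, f z)).
Proof.
move=> cf; apply: cts_onM; first exact: cts_rad2.
apply: cts_onD; last by apply: cts_on_continuous => z; exact: cvg_cst.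
apply: cts_onD; last by apply: cts_on_continuous => z; exact: cvg_cst.
apply: (cts_on_comp (B := setT) (g := fun y : 'rV[R]_L => `|y|) _ (@cts_c1 A)) => //.
by apply: cts_on_continuous; exact: norm_continuous.
Qed.

Lemma cts_on_lt (Y : topologicalType) (A : set Y) (f : Y -> R) (b : R) z :
  cts_on A f -> A z -> f z < b -> nbhs z [set z' | A z' -> f z' < b].
Proof.
move=> cf Az fb; have b0 : 0 < b - f z by rewrite subr_gt0.
have nb := cf z Az _ (nbhsx_ballx (f z) (b - f z) b0).
apply: filterS nb => z' hz Az'; have := hz Az'.
by rewrite -ball_normE /= distrC => /(le_lt_trans (ler_norm _)); lra.
Qed.

Lemma W0_open : open W0.
Proof.
rewrite openE => z [Tz Vz]; rewrite /interior.
have nT : nbhs z [set z' | T z'.1].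
  have := cvg_fst (F := nbhs z.1) (G := nbhs z.2); apply.
  exact: open_nbhs_nbhs.
have c8 : cts_on setT (fun z' => 8 * V (z'.1, z'.2)).
  apply: cts_onM; first by apply: cts_on_continuous => ?; exact: cvg_cst.
  by apply: cts_weight; exact: cts_snd.
have nV : nbhs z [set z' | setT z' -> 8 * V (z'.1, z'.2) < d'].
  by apply: cts_on_lt => //; case: (z) Vz.
apply: filterS (filterI nT nV) => -[e x] [/= Te Vx].
by split=> //; exact: Vx.
Qed.

Lemma W0_le z : W0 z -> rad z.2 * (`|c z.1| + `|c e0| + 1) <= d'.
Proof.
move=> [_ /ltW]; apply: le_trans; rewrite ler_peMl //; last by lra.
by rewrite mulr_ge0 ?addr_ge0 //; exact: wrad_ge0.
Qed.

(** At the origin because the weighted radius of the image is comparable to that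
    of the point, elsewhere by composition. *)
Lemma triv_cts : cts_on W0 (fun z => h z.1 z.2).
Proof.
move=> z Wz; have [z0|z0] := eqVneq z.2 0.
  move=> U; rewrite {1}z0 /h {1}/triv eqxx => /nbhs_ballP[b /= b0 bU].
  pose b' := Num.min 1 b / 2.
  have mb : 0 < Num.min 1 b by rewrite lt_min ltr01.
  have b'0 : 0 < b' by rewrite divr_gt0.
  have nb : nbhs z [set z' | W0 z' -> rad z'.2 < b'].
    apply: cts_on_lt => //; first by apply: cts_rad2; exact: cts_snd.
    by rewrite z0 /rad (wrad0 _ M_gt0 mW).
  apply: filterS nb => z' hz Wz'; apply: bU; rewrite -ball_normE /= sub0r normrN.
  have /andP[_ h1] := triv_rad (c_tame Wz'.1) c0_tame (W0_le Wz').
  have h2 := hz Wz'.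
  have m1 : Num.min 1 b <= 1 by rewrite ge_min lexx.
  have m2 : Num.min 1 b <= b by rewrite ge_min lexx orbT.
  have h3 : rad (h z'.1 z'.2) < Num.min 1 b.
    by move: h1 h2; rewrite /h /b'; lra.
  apply: le_lt_trans (lt_le_trans h3 m2).
  apply: (norm_le_wrad M_gt0 mW); apply: ltW; exact: lt_le_trans h3 m1.
pose W1 := [set z | W0 z /\ z.2 != 0].
have n0 : nbhs z [set z' | z'.2 != 0].
  have cr : cts_on setT (fun z : E * 'rV[R]_N => (-1) * rad z.2).
    apply: cts_onM; first by apply: cts_on_continuous => ?; exact: cvg_cst.
    by apply: cts_rad2; exact: cts_snd.
  have nb : nbhs z [set z' | setT z' -> (-1) * rad z'.2 < 0].
    by apply: cts_on_lt => //; rewrite mulN1r oppr_lt0; exact: wrad_gt0.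
  apply: filterS nb => z' /(_ I); rewrite mulN1r oppr_lt0.
  exact: (wrad_neq0 M_gt0 mW).
suff cW1 : cts_on W1 (fun z => h z.1 z.2).
  move=> U /(cW1 z (conj Wz z0)) nU.
  by apply: filterS (filterI n0 nU) => z' [z'0 hz] Wz'; apply: hz.
have cr : cts_on W1 (fun z => rad z.2) by apply: cts_rad2; exact: cts_snd.
have cd : cts_on W1 (fun z => dir z.2).
  apply: cts_on_row => i; apply: (eq_cts_on (f := fun z => (rad z.2)^-1 ^+ W i * z.2 0 i)).
    by move=> z' _; rewrite mxE.
  apply: cts_onM; last by apply: cts_on_coord; exact: cts_snd.
  apply: cts_onX; apply: cts_onV => // z' [_ z'0].
  by rewrite gt_eqF //; exact: wrad_gt0.
have ccs (f : E * 'rV[R]_N -> 'rV[R]_L) : cts_on W1 f -> cts_on W1 (fun z => cs (rad z.2) (f z)).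
  move=> cf; apply: cts_on_row => a.
  apply: (eq_cts_on (f := fun z => f z 0 a * rad z.2 ^+ del a)).
    by move=> z' _; rewrite mxE.
  by apply: cts_onM; [exact: cts_on_coord|exact: cts_onX].
have cK : cts_on W1 (fun z => K (cs (rad z.2) (c z.1)) (cs (rad z.2) (c e0)) (dir z.2)).
  apply: (cts_on_comp (f := fun z : E * 'rV[R]_N =>
    ((cs (rad z.2) (c z.1), cs (rad z.2) (c e0)), dir z.2)) _ _ K_cts).
    move=> z' [Wz' z'0].
    have [] := cs_le (c_tame Wz'.1) c0_tame (wrad_gt0 m M z'0) (W0_le Wz').
    by split=> //; exact: dirX.
  apply: cts_on_pair => //; apply: cts_on_pair; apply: ccs; first exact: cts_c1.
  by apply: cts_on_continuous => ?; exact: cvg_cst.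
apply: cts_on_row => i; apply: (eq_cts_on (f := fun z => rad z.2 ^+ W i *
    (dir z.2 0 i + K (cs (rad z.2) (c z.1)) (cs (rad z.2) (c e0)) (dir z.2) 0 i))).
  by move=> z' [_ z'0]; rewrite /h /triv (negbTE z'0) [RHS]mxE [in RHS]mxE.
apply: cts_onM; first exact: cts_onX.
by apply: cts_onD; exact: cts_on_coord.
Qed.

Lemma compact_wball (b : R) : compact [set x : 'rV[R]_N | rad x <= b].
Proof.
apply: bounded_closed_compact.
  exists (\sum_i (`|b| ^+ W i)); split; first exact: num_real.
  move=> B bB x xb; apply: ltW; apply: le_lt_trans bB.
  apply: normr_row_le => [|i]; first by rewrite sumr_ge0 // => i _; rewrite exprn_ge0.
  apply: le_trans (coord_le_wrad M_gt0 mW x i) _.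
  apply: (@le_trans _ _ (`|b| ^+ W i)).
    by rewrite lerXn2r ?nnegrE ?wrad_ge0 // (le_trans xb) // ler_norm.
  by rewrite (bigD1 i) //= lerDl sumr_ge0 // => j _; rewrite exprn_ge0.
rewrite -[X in closed X]/(rad @^-1` [set y | y <= b]).
apply: preimage_closed; last exact: closed_le.
by move=> x _; exact: (wrad_continuous M_gt0).
Qed.

(** The source of the germ at [e] is cut out so that its image is a weighted
    ball, onto which the map is a homeomorphism by compactness. *)
Theorem family_trivial :
  topologically_trivial e0 (fun e => real_map (gp fw mm (c e))) T.
Proof.
pose W1 := [set z | W0 z /\ (16 * V (z.1, z.2) < d' /\ 32 * V (z.1, h z.1 z.2) < d')].
have d'0 : 0 < d' by rewrite lt_min ltr01.
have Cp e : 0 < `|c e| + `|c e0| + 1 by exact: C_gt0.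
have h0 e : h e 0 = 0 by rewrite /h /triv eqxx.
have rad00 : rad 0 = 0 by exact: (wrad0 _ M_gt0 mW).
have c32 : cts_on W0 (fun z => 32 * V (z.1, h z.1 z.2)).
  apply: cts_onM; first by apply: cts_on_continuous => ?; exact: cvg_cst.
  by apply: cts_weight; exact: triv_cts.
have c16 : cts_on W0 (fun z => 16 * V (z.1, z.2)).
  apply: cts_onM; first by apply: cts_on_continuous => ?; exact: cvg_cst.
  by apply: cts_weight; exact: cts_snd.
exists W1, h; split.
- rewrite openE => z [Wz [Vz Vhz]]; rewrite /interior.
  have nW : nbhs z W0 by apply: open_nbhs_nbhs; split=> //; exact: W0_open.
  have n1 := cts_on_lt c16 Wz Vz; have n2 := cts_on_lt c32 Wz Vhz.
  by apply: filterS (filterI nW (filterI n1 n2)) => z' [Wz' [/(_ Wz') ? /(_ Wz')]].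
- by move=> e Te; rewrite /W1 /W0 /V /= h0 rad00 !mul0r !mulr0.
- by apply/cts_onP; apply: cts_on_sub triv_cts => z [[]].
move=> e Te; split=> //; last first.
  move=> x [Wx _]; apply/rowP => j; rewrite !mxE.
  by have := triv_eq (c_tame Te) c0_tame j (W0_le Wx); rewrite /pe => ->.
pose C := `|c e| + `|c e0| + 1; have C0 : 0 < C by exact: Cp.
pose U := [set z : 'rV[R]_N | 32 * rad z * C < d'].
pose A := [set x : 'rV[R]_N | rad x <= d' / (16 * C)].
have AE x : A x <-> 16 * rad x * C <= d'.
  by rewrite /A /= ler_pdivlMr ?mulr_gt0 // mulrA [rad x * 16]mulrC.
have AW x : A x -> W0 (e, x).
  move=> /AE Ax; split=> //; rewrite /V /= -/C mulrA.
  have [x0|x0] := eqVneq (rad x) 0; first by rewrite x0 mulr0 mul0r.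
  apply: lt_le_trans Ax; rewrite ltr_pM2r // ltr_pM2r; first lra.
  by rewrite lt_def x0; exact: wrad_ge0.
have WA x : W1 (e, x) -> A x.
  by move=> [_ [/ltW Vx _]]; apply/AE; rewrite -mulrA.
have Uh x : W1 (e, x) -> U (h e x) by move=> [_ [_]]; rewrite /U /V /= mulrA.
have inj x x' : A x -> A x' -> h e x = h e x' -> x = x'.
  by move=> /AE Ax /AE Ax'; exact: (triv_inj (c_tame Te)).
have surj y : U y -> exists2 x, W1 (e, x) & h e x = y.
  move=> Uy; have [x xC xy] := triv_surj (c_tame Te) c0_tame Uy; exists x => //.
  split; first by apply: AW; apply/AE; exact: ltW.
  by split; rewrite /V /= mulrA //; rewrite /h xy.
have [ch [k [ck kh hk]]] : homeo_on A [set h e x | x in A] (h e).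
  apply: (compact_homeo 0) => //.
  - exact: compact_wball.
  - apply: (cts_on_comp (f := fun x : 'rV[R]_N => (e, x)) _ _ triv_cts) => //.
    apply: (cts_on_pair (f := fun=> e) (g := id)); apply: cts_on_continuous.
      exact: cst_continuous.
    by move=> x; exact: cvg_id.
  - by move=> x Ax; exists x.
exists U.
  rewrite openE => z Uz; rewrite /interior.
  have cU : cts_on setT (fun z : 'rV[R]_N => 32 * rad z * C).
    apply: cts_onM; last by apply: cts_on_continuous; exact: cst_continuous.
    apply: cts_onM; first by apply: cts_on_continuous; exact: cst_continuous.
    by apply: cts_on_continuous; exact: (wrad_continuous M_gt0).
  by apply: filterS (cts_on_lt cU I Uz) => z' /(_ I).
split.
  by move/cts_onP: ch => ch; apply/cts_onP; apply: cts_on_sub ch => x /WA.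
exists k; split.
- move/cts_onP: ck => ck; apply/cts_onP; apply: cts_on_sub ck => y /surj[x /WA Ax <-].
  by exists x.
- by move=> x Wx; split; [exact: Uh|have [] := kh _ (WA _ Wx)].
move=> y /surj[x Wx <-]; have [_ ->] := kh _ (WA _ Wx).
by split.
Qed.

End Family.
End Triviality.

Theorem tame_trivial (R : realType) (N P L : nat) (W m : 'I_N -> nat) (M : nat)
    (D : 'I_P -> nat) (del : 'I_L -> nat)
    (fw : 'I_P -> mpoly N R) (mm : 'I_L -> 'I_P -> mpoly N R) :
  (0 < M)%N -> (forall i, (m i * W i = M)%N) ->
  (forall j, whomog W (D j) (fw j)) ->
  (forall a j, whomog W (D j + del a) (mm a j)) ->
  (forall j, (0 < D j)%N) ->
  (forall x : 'rV[R]_N, x != 0 -> regular fw x) ->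
  exists2 d : R, 0 < d & forall (E : topologicalType) (e0 : E)
    (c : E -> 'rV[R]_L) (T : set E),
    open T -> continuous c -> (forall e, T e -> tame del d (c e)) ->
    tame del d (c e0) ->
    topologically_trivial e0 (fun e => real_map (gp fw mm (c e))) T.
Proof.
move=> M0 mW hfw hmm D0 sub.
have [r r0 hr] := unit_sphere_near R M0 mW.
have k0 : 0 < Num.min r (1 / 2) by rewrite lt_min r0 divr_gt0.
have [d d0 [K [Kb Kl Kc Ke Ks]]] := shell_displacement M0 mW hfw hmm sub k0.
exists d => // E e0 c T oT cc ct c0t.
apply: (@family_trivial R N P L W m M D del M0 mW fw mm hfw hmm D0 r d K) => //.
- by move=> s t x sd td Xx; apply: le_trans (Kb _ _ _ sd td Xx) _; rewrite ge_min lexx.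
- move=> s t x x' sd td Xx Xx'; apply: le_trans (Kl _ _ _ _ sd td Xx Xx') _.
  by rewrite ler_wpM2r // ge_min lexx orbT.
Qed.

(** * Real-analytic families *)

Section Multinomials.
Variables (R : realType) (k : nat).
Implicit Types (m : multinom k) (x v : 'rV[R]_k).

Lemma monomZ m (t : R) v : monom m (t *: v) = t ^+ mdeg m * monom m v.
Proof.
rewrite /monom mdegE -prodrXr -big_split /=; apply: eq_bigr => i _.
by rewrite mxE exprMn.
Qed.

Lemma monom_const m (t : R) : monom m (const_mx t) = t ^+ mdeg m.
Proof. by rewrite /monom mdegE -prodrXr; apply: eq_bigr => i _; rewrite mxE. Qed.

Lemma monom_le m x (r : R) : `|x| <= r -> `|monom m x| <= r ^+ mdeg m.
Proof.
move=> xr; rewrite /monom mdegE -prodrXr normr_prod; apply: ler_prod => i _.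
rewrite normr_ge0 normrX /=; have xi := normr_coord x i.
by rewrite lerXn2r ?nnegrE ?(le_trans _ xr) // (le_trans xi).
Qed.

Lemma sum_bmultinom_deg (V : nmodType) (F : multinom k -> V) j n : (j < n)%N ->
  \sum_(m : bmultinom k n | mdeg m == j) F m =
  \sum_(m : bmultinom k j.+1 | mdeg m == j) F m.
Proof.
case: n => // n jn; pose h (m : bmultinom k j.+1) : bmultinom k n.+1 := insubd (@bm0 k n) (bmnm m).
pose h' (m : bmultinom k n.+1) : bmultinom k j.+1 := insubd (@bm0 k j) (bmnm m).
have hE (m : bmultinom k j.+1) : bmnm (h m) = bmnm m.
  by rewrite /h val_insubd (leq_trans (bmdeg m) jn).
have h'E (m : bmultinom k n.+1) : mdeg m == j -> bmnm (h' m) = bmnm m.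
  by move=> /eqP e; rewrite /h' val_insubd e ltnSn.
rewrite (reindex_onto h h') => [|m mj]; last by apply: val_inj; rewrite /= hE h'E.
apply: eq_big => [m|m _]; last by rewrite hE.
rewrite hE; case E : (_ == j) => //=; apply/eqP/val_inj => /=.
by rewrite h'E hE.
Qed.

Lemma sum_bmultinom (F : multinom k -> R) (t : R) n :
  \sum_(m : bmultinom k n) F m * t ^+ mdeg m =
  \sum_(j < n) (\sum_(m : bmultinom k j.+1 | mdeg m == j) F m) * t ^+ j.
Proof.
rewrite (partition_big (fun m : bmultinom k n => Ordinal (bmdeg m)) xpredT) //=.
apply: eq_bigr => j _; rewrite -(sum_bmultinom_deg _ (ltn_ord j)) mulr_suml.
by apply: eq_big => [m|m /eqP <-//]; rewrite -val_eqE.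
Qed.

End Multinomials.

Section RealAnalyticFunctions.
Variables (R : realType) (k : nat).

Lemma lim_dist_le (u : nat -> R) (l c b : R) : u @ \oo --> l ->
  (forall n, `|u n.+1 - c| <= b) -> `|l - c| <= b.
Proof.
move=> ul ub; rewrite leNgt; apply/negP => lt.
have e0 : 0 < `|l - c| - b by rewrite subr_gt0.
have /cvgrPdist_lt/(_ _ e0) [n _ hn] := ul.
have := hn n.+1 (leqnSn n); rewrite /= => h1; have h2 := ub n.
have : `|l - c| <= `|l - u n.+1| + `|u n.+1 - c|.
  by rewrite -[l - c](subrKA (u n.+1)) ler_normD.
by move: h1 h2; lra.
Qed.

Lemma cvg_bounded (u : nat -> R) : cvg (u @ \oo) -> exists2 S, 0 <= S &
  forall n, `|u n| <= S.
Proof.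
move=> /cvg_seq_bounded [B [_ hB]]; exists (`|B| + 1); first by rewrite addr_ge0.
move=> n; apply: (hB (`|B| + 1)) => //.
by apply: le_lt_trans (ler_norm _) _; rewrite ltrDl.
Qed.

(** Compare with the absolutely convergent series at a nearby point all of whose
    coordinates have been increased by [r]. *)
Lemma analytic_continuous (u : 'rV[R]_k -> R) : real_analytic u -> continuous u.
Proof.
move=> hu a U /nbhs_ballP[b /= b0 bU].
have [c /nbhs_ballP[e /= e0 he]] := hu a.
pose r := e / 2; have r0 : 0 < r by rewrite divr_gt0.
have x1 : ball a e (a + const_mx r).
  rewrite -ball_normE /= opprD addNKr normrN.
  apply: (@le_lt_trans _ _ r); last by rewrite /r; lra.
  by apply: normr_row_le => [|i]; rewrite ?mxE ?ger0_norm // ltW.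
have [/cvg_bounded[S S0 hS] _] := he _ x1.
have {}hS n : \sum_(m : bmultinom k n) `|c m| * r ^+ mdeg m <= S.
  apply: le_trans (hS n); rewrite ger0_norm ?sumr_ge0 // ler_sum // => m _.
  rewrite addrAC subrr add0r normrM monom_const ler_wpM2l // ger0_norm //.
  by rewrite exprn_ge0 // ltW.
have key t x : 0 <= t <= 1 -> ball a e x -> `|x - a| <= t * r ->
    `|u x - c mnm0| <= t * S.
  move=> /andP[t0 t1] /he[_ ux] xr.
  apply: (lim_dist_le ux) => n; rewrite (bigD1 (@bm0 k n)) //=.
  have -> : monom mnm0 (x - a) = 1.
    by rewrite /monom big1 // => i _; rewrite mnm0E expr0.
  rewrite mulr1 addrAC subrr add0r; apply: le_trans (ler_norm_sum _ _ _) _.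
  apply: (@le_trans _ _ (t * \sum_(m : bmultinom k n.+1) `|c m| * r ^+ mdeg m)); last first.
    exact: ler_wpM2l.
  rewrite [X in _ <= _ * X](bigD1 (@bm0 k n)) //= mulrDr ler_wpDl //.
    by rewrite !mulr_ge0 // exprn_ge0 // ltW.
  rewrite mulr_sumr ler_sum // => m m0; rewrite normrM mulrCA ler_wpM2l //.
  apply: le_trans (monom_le _ xr) _; rewrite exprMn ler_wpM2r ?exprn_ge0 ?(ltW r0) //.
  have : mdeg m != 0%N.
    by rewrite mdeg_eq0; apply: contra m0 => /eqP mz; apply/eqP/val_inj.
  by case: (mdeg m) => // q _; rewrite exprS ler_piMr // exprn_ile1.
have S1 : 0 < 2 * S + 1 by rewrite ltr_wpDl // mulr_ge0.
pose t := Num.min 1 (b / (2 * S + 1)); have t0 : 0 < t by rewrite lt_min ltr01 divr_gt0.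
have t1 : t <= 1 by rewrite ge_min lexx.
have tb : t * (2 * S) < b.
  apply: (@lt_le_trans _ _ (t * (2 * S + 1))); first by rewrite ltr_pM2l // ltrDl.
  by rewrite -ler_pdivlMr // ge_min lexx orbT.
apply/nbhs_ballP; exists (t * r); first by rewrite /= mulr_gt0.
move=> x; rewrite -ball_normE /= => ax; apply: bU; rewrite -ball_normE /=.
have t01 : 0 <= t <= 1 by rewrite (ltW t0).
have xe : ball a e x.
  rewrite -ball_normE /=; apply: lt_le_trans ax _; rewrite /r; nra.
have h1 : `|u x - c mnm0| <= t * S.
  by apply: key => //; rewrite distrC ltW.
have h2 : `|u a - c mnm0| <= t * S.
  apply: key => //; first exact: ballxx.
  by rewrite subrr normr0 mulr_ge0 // ltW.
apply: le_lt_trans tb; rewrite -[u a - u x](subrKA (c mnm0)).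
by apply: le_trans (ler_normD _ _) _; move: h1 h2; rewrite [`|c mnm0 - _|]distrC; lra.
Qed.

(** The first nonzero term dominates the sum of the following ones near the
    centre, by comparison with the terms at radius [r]. *)
Lemma power_series_isolated (a : nat -> R) (g : R -> R) (r S : R) : 0 < r ->
  (forall n, \sum_(j < n) `|a j| * r ^+ j <= S) ->
  (forall t, `|t| < r -> (fun n => \sum_(j < n) a j * t ^+ j) @ \oo --> g t) ->
  exists2 d : R, 0 < d & (forall t, `|t| < d -> g t = 0) \/
    (forall t, 0 < `|t| < d -> g t <> 0).
Proof.
move=> r0 hS hg.
have S0 : 0 <= S by apply: le_trans (hS 0%N); rewrite big_ord0.
have [az|] := pselect (forall j, a j = 0).
  exists r => //; left => t /hg h; apply/eqP; rewrite -normr_le0 -[g t]subr0.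
  apply: (lim_dist_le h) => n; rewrite subr0 big1 ?normr0 // => j _.
  by rewrite az mul0r.
move=> /existsNP[j0 /eqP aj0].
have ex : exists j, a j != 0 by exists j0.
pose q := ex_minn ex; have [aq qmin] : a q != 0 /\ forall j, (j < q)%N -> a j = 0.
  rewrite /q; case: ex_minnP => q' h hmin; split=> // j jq; apply/eqP.
  by apply: contraTT jq => /hmin; rewrite -leqNgt.
pose A := `|a q| * r ^+ q; have A0 : 0 < A by rewrite mulr_gt0 ?normr_gt0 ?exprn_gt0.
have S1 : 0 < S + 1 by rewrite ltr_wpDl.
pose d := Num.min 1 (A / (S + 1)) * r.
have th0 : 0 < Num.min 1 (A / (S + 1)) by rewrite lt_min ltr01 divr_gt0.
exists d; first by rewrite mulr_gt0.
right=> t /andP[t0 td] gt0.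
pose th := `|t| / r; have tE : `|t| = th * r by rewrite divfK // gt_eqF.
have th1 : 0 < th by rewrite divr_gt0.
have thd : th < Num.min 1 (A / (S + 1)) by rewrite ltr_pdivrMr.
have [thl1 thA] : th < 1 /\ th < A / (S + 1) by move: thd; rewrite lt_min => /andP[].
have tr : `|t| < r by rewrite tE gtr_pMl.
have b n : `|\sum_(j < (n.+1 + q)) a j * t ^+ j - a q * t ^+ q| <= th ^+ q.+1 * S.
  have qn : (q < n.+1 + q)%N by rewrite addSn ltnS leq_addl.
  rewrite (bigD1 (Ordinal qn)) //= addrAC subrr add0r.
  apply: le_trans (ler_norm_sum _ _ _) _.
  apply: (@le_trans _ _ (th ^+ q.+1 * \sum_(j < n.+1 + q) `|a j| * r ^+ j)); last first.
    by rewrite ler_wpM2l // exprn_ge0 // ltW.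
  rewrite [X in _ <= _ * X](bigD1 (Ordinal qn)) //= mulrDr ler_wpDl //.
    by rewrite !mulr_ge0 // exprn_ge0 // ltW.
  rewrite mulr_sumr ler_sum // => j jq; rewrite normrM normrX tE exprMn.
  have [lt|le] := ltnP j q; first by rewrite qmin // normr0 !mul0r mulr0.
  rewrite mulrCA ler_wpM2r ?mulr_ge0 ?exprn_ge0 ?(ltW r0) //.
  apply: ler_wiXn2l; rewrite ?(ltW th1) ?(ltW thl1) //.
  by rewrite ltn_neqAle le andbT eq_sym; apply: contra jq => /eqP e; apply/eqP/val_inj.
have lim : (fun n => \sum_(j < (n + q)) a j * t ^+ j) @ \oo --> g t.
  by have := hg t tr; rewrite -(cvg_shiftn q).
have := lim_dist_le lim b; rewrite gt0 sub0r normrN normrM normrX tE exprMn.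
rewrite exprS mulrCA -/A [leRHS]mulrAC mulrC ler_pM2r ?exprn_gt0 //.
move=> le; have : A < A; last by rewrite ltxx.
apply: le_lt_trans le _; apply: (@le_lt_trans _ _ (th * (S + 1))).
  by rewrite ler_wpM2l ?(ltW th1) // lerDl.
by rewrite -ltr_pdivlMr.
Qed.

(** On the segment from [x0] to [x], vanishing near a parameter is a locally
    constant property, because zeros of power series are isolated. *)
Theorem analytic_identity (u : 'rV[R]_k -> R) (x0 : 'rV[R]_k) :
  real_analytic u -> nbhs x0 [set x | u x = 0] -> forall x, u x = 0.
Proof.
move=> hu nx0 x; pose v := x - x0; pose g (t : R) := u (x0 + t *: v).
have lineC (t : R) U : nbhs (x0 + t *: v) U -> exists2 d : R, 0 < d &
    forall s, `|s - t| < d -> U (x0 + s *: v).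
  move=> /nbhs_ballP[e /= e0 eU]; have v1 : 0 < `|v| + 1 by rewrite ltr_wpDl.
  exists (e / (`|v| + 1)); first by rewrite divr_gt0.
  move=> s st; apply: eU; rewrite -ball_normE /= opprD addrACA subrr add0r -scalerBl.
  rewrite normrZ distrC; apply: (@le_lt_trans _ _ (`|s - t| * (`|v| + 1))).
    by rewrite ler_wpM2l // lerDl.
  by rewrite -ltr_pdivlMr.
pose Q t := exists2 d : R, 0 < d & forall s, `|s - t| < d -> g s = 0.
suff : Q 1.
  by move=> [d d0 /(_ 1)]; rewrite subrr normr0 /g scale1r /v addrC subrK; apply.
apply: (@interval_induction R Q).
  have := @lineC 0 [set x | u x = 0]; rewrite scale0r addr0 => /(_ nx0)[d d0 hd].
  by exists d.
move=> t _; have [c nc] := hu (x0 + t *: v).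
have [d1 d10 hd1] := lineC t _ nc.
pose a j : R := \sum_(m : bmultinom k j.+1 | mdeg m == j) (c m * monom m v).
pose r := d1 / 2; have r0 : 0 < r by rewrite divr_gt0.
have mE s m : monom m (x0 + (t + s) *: v - (x0 + t *: v)) = s ^+ mdeg m * monom m v.
  by rewrite -monomZ; congr monom; rewrite opprD addrACA subrr add0r -scalerBl addrC addKr.
have [S hS] : exists S, forall n, \sum_(j < n) `|a j| * r ^+ j <= S.
  have tr : `|t + r - t| < d1 by rewrite addrC addKr gtr0_norm // /r; lra.
  have [/cvg_bounded[S S0 hS] _] := hd1 (t + r) tr.
  exists S => n; apply: le_trans (hS n); rewrite ger0_norm ?sumr_ge0 //.
  under [X in _ <= X]eq_bigr => m _ do rewrite mE mulrCA normrM normrX gtr0_norm // mulrC.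
  rewrite (sum_bmultinom (fun m => `|c m * monom m v|)); apply: ler_sum => j _.
  by rewrite ler_wpM2r ?exprn_ge0 ?(ltW r0) // ler_norm_sum.
have hg s : `|s| < r -> (fun n => \sum_(j < n) a j * s ^+ j) @ \oo --> g (t + s).
  move=> sr; have ts : `|t + s - t| < d1 by rewrite addrC addKr; move: sr; rewrite /r; lra.
  have [_] := hd1 (t + s) ts; apply: cvg_trans; apply: near_eq_cvg; near=> n.
  rewrite -(sum_bmultinom (fun m => c m * monom m v)); apply: eq_bigr => m _.
  by rewrite mE mulrA [c m * _]mulrC -!mulrA mulrC -mulrA.
have [d d0 [gz|gn]] := power_series_isolated r0 hS hg.
  exists (d / 2); first by rewrite divr_gt0.
  have gz' s : `|s - t| < d -> g s = 0.
    by move=> /gz; rewrite [t + _]addrC subrK.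
  move=> s _ st; split=> _; last by exists d.
  exists (d / 2); first by rewrite divr_gt0.
  move=> w ws; apply: gz'; rewrite -(subrKA s).
  by apply: le_lt_trans (ler_normD _ _) _; move: ws st; lra.
have gn' s : 0 < `|s - t| < d -> g s <> 0.
  by move=> /gn; rewrite [t + _]addrC subrK.
exists (d / 2); first by rewrite divr_gt0.
have nQt : ~ Q t.
  move=> [b b0 hb]; pose w := Num.min b d / 2.
  have m0 : 0 < Num.min b d by rewrite lt_min b0.
  have [m1 m2] : Num.min b d <= b /\ Num.min b d <= d by rewrite !ge_min !lexx orbT.
  have wE : `|t + w - t| = w by rewrite addrC addKr gtr0_norm // divr_gt0.
  apply: (gn' (t + w)); last by apply: hb; rewrite wE /w; lra.
  by rewrite wE /w; apply/andP; split; lra.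
move=> s _ st; split=> // -[b b0 hb]; exfalso.
have [ts|ts] := eqVneq s t; first by apply: nQt; exists b => // w; rewrite -ts; exact: hb.
apply: (gn' s); last by apply: hb; rewrite subrr normr0.
by rewrite normr_gt0 subr_eq0 ts /=; lra.
Unshelve. all: by end_near. Qed.

(** By Baire's theorem one degree is enough for an open set of parameters, and
    then for all of them. *)
Theorem analytic_finite_support (J : Type) (rk : J -> nat)
    (u : J -> 'rV[R]_k -> R) :
  (forall i, real_analytic (u i)) ->
  (forall e, exists B, forall i, (B <= rk i)%N -> u i e = 0) ->
  exists B, forall i, (B <= rk i)%N -> forall e, u i e = 0.
Proof.
move=> ua fin; pose O B := [set e | exists2 i, (B <= rk i)%N & u i e != 0].
have oO B : open (O B).
  rewrite openE => e [i Bi ue]; rewrite /interior.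
  have n0 : 0 < `|u i e| by rewrite normr_gt0.
  have nb : nbhs e [set e' | ball (u i e) `|u i e| (u i e')].
    exact: (@analytic_continuous _ (ua i) e _ (nbhsx_ballx (u i e) _ n0)).
  apply: filterS nb => e' /=; rewrite -ball_normE /= => lt; exists i => //.
  by apply: contraTneq lt => ->; rewrite subr0 ltxx.
have [dO|/existsNP[B nd]] := pselect (forall B, dense (O B)).
  have /(_ setT) := @Baire R ('rV[R]_k : completeNormedModType R) O (fun i => conj (oO i) (dO i)).
  case=> [||e [_ he]]; [by exists 0|exact: openT|].
  have [B hB] := fin e; have [i Bi] := he B I.
  by rewrite hB // eqxx.
exists B => i Bi; move/existsNP: nd => [U].
move=> /not_implyP[[e0 Ue0]] /not_implyP[oU nU].
apply: (@analytic_identity (u i) e0) => //.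
have nb : nbhs e0 U by exact: open_nbhs_nbhs.
apply: filterS nb => e Ue; apply/eqP; rewrite -[_ == _]negbK; apply/negP => ne.
by apply: nU; exists e; split=> //; exists i.
Qed.

End RealAnalyticFunctions.

(** * Deformations by terms of larger weighted degree *)

Lemma tame_le (R : realType) L (del : 'I_L -> nat) (e e' : R) c :
  e <= e' -> tame del e c -> tame del e' c.
Proof. by move=> ee' h a /h ca; exact: le_trans ca ee'. Qed.

Lemma ball0_connected (R : realType) k (r : R) : 0 < r ->
  connected [set x : 'rV[R]_k | `|x| < r].
Proof.
move=> r0; have -> : [set x : 'rV[R]_k | `|x| < r] =
    \bigcup_(x in [set x : 'rV[R]_k | `|x| < r])
      [set t *: x | t in [set t : R | 0 <= t <= 1]].
  apply/seteqP; split=> x; last first.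
    move=> [y yr [t /andP[t0 t1] <-]]; rewrite /= normrZ ger0_norm //.
    by apply: le_lt_trans yr; rewrite ler_piMl.
  by move=> xr; exists x => //; exists 1; rewrite ?scale1r //= ler01 lexx.
apply: bigcup_connected; first by exists 0 => x _; exists 0; rewrite ?scale0r //= lexx ler01.
move=> x _; apply: connected_continuous_connected; last first.
  apply/cts_onP; apply: (lip_cts_on (L := `|x|)) => s t _ _.
  by rewrite -scalerBl normrZ mulrC.
have -> : [set t : R | 0 <= t <= 1] = [set` `[0, 1]].
  by apply/seteqP; split=> t; rewrite /= in_itv.
exact: segment_connected.
Qed.

Section Deformation.
Variables (R : realType) (N P L : nat).
Variables (W m : 'I_N -> nat) (M : nat) (D : 'I_P -> nat) (del : 'I_L -> nat).
Hypothesis M_gt0 : (0 < M)%N.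
Hypothesis mW : forall i, (m i * W i = M)%N.
Hypothesis D_gt0 : forall j, (0 < D j)%N.
Variables (fw : 'I_P -> mpoly N R) (mm : 'I_L -> 'I_P -> mpoly N R).
Hypothesis hfw : forall j, whomog W (D j) (fw j).
Hypothesis hmm : forall a j, whomog W (D j + del a) (mm a j).
Hypothesis fw_isolated : forall x : 'rV[R]_N, x != 0 ->
  (forall j, pe (fw j) x = 0) -> regular fw x.

Let G (E : Type) (c : E -> 'rV[R]_L) e := real_map (gp fw mm (c e)).

(** One threshold serves links and homeomorphisms; it depends on the initial
    form and on the finite list of terms only. *)
Theorem tame_deformation : exists2 b : R, 0 < b &
  forall (E : topologicalType) (e0 : E) (c : E -> 'rV[R]_L) (T : set E),
    open T -> continuous c -> (forall e, T e -> tame del b (c e)) ->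
    tame del b (c e0) ->
    link_constant e0 (G c) T /\
    ((forall x : 'rV[R]_N, x != 0 -> regular fw x) ->
      topologically_trivial e0 (G c) T).
Proof.
have [b1 b10 h1] := regular_small M_gt0 mW mm hfw fw_isolated.
have lc b (E : topologicalType) (e0 : E) (c : E -> 'rV[R]_L) (T : set E) : b <= b1 ->
    (forall e, T e -> tame del b (c e)) -> tame del b (c e0) -> link_constant e0 (G c) T.
  move=> bb1 ct c0 e Te; have te := tame_le bb1 (ct e Te); split.
    exact: (tame_has_link M_gt0 mW hfw hmm b10 h1).
  exact: (tame_link_isotopic M_gt0 mW hfw hmm b10 h1 (tame_le bb1 c0) te).
have [sub|nsub] := pselect (forall x : 'rV[R]_N, x != 0 -> regular fw x).
  have [b2 b20 h2] := tame_trivial M_gt0 mW hfw hmm D_gt0 sub.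
  exists (Num.min b1 b2); first by rewrite lt_min b10.
  move=> E e0 c T oT cc ct c0; split.
    by apply: (lc (Num.min b1 b2)) => //; rewrite ge_min lexx.
  have m2 : Num.min b1 b2 <= b2 by rewrite ge_min lexx orbT.
  by move=> _; apply: h2 => // [e Te|]; apply: (tame_le m2) => //; exact: ct.
exists b1 => // E e0 c T oT cc ct c0; split; first exact: (lc b1).
by move=> /nsub.
Qed.

(** The coefficients of critical degree vanish at the centre of the deformation,
    so by continuity they are below the threshold on a small ball.  The
    homeomorphism with a Euclidean space covers real and complex parameters. *)
Theorem parametrized_deformation (k : nat) (E : topologicalType)
    (phi : 'rV[R]_k -> E) (psi : E -> 'rV[R]_k) (c : E -> 'rV[R]_L) :
  continuous phi -> continuous psi -> cancel phi psi -> cancel psi phi ->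
  continuous (c \o phi) ->
  (forall a, del a = 0%N -> c (phi 0) 0 a = 0) ->
  (exists T : set E,
     [/\ nbhs (phi 0) T, connected T, link_constant (phi 0) (G c) T &
         (forall x : 'rV[R]_N, x != 0 -> regular fw x) ->
           topologically_trivial (phi 0) (G c) T]) /\
  ((forall e a, del a = 0%N -> c e 0 a = 0) ->
     link_constant (phi 0) (G c) setT /\
     ((forall x : 'rV[R]_N, x != 0 -> regular fw x) ->
        topologically_trivial (phi 0) (G c) setT)).
Proof.
move=> cphi cpsi phiK psiK cc c0; have [b b0 hb] := tame_deformation.
have cE : continuous c.
  have -> : c = (c \o phi) \o psi by apply/funext => e /=; rewrite psiK.
  by move=> e; apply: continuous_comp; [exact: cpsi|exact: cc].
have t0 : tame del b (c (phi 0)) by move=> a /c0 ->; rewrite normr0 ltW.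
split; last first.
  move=> cz; have ct e : setT e -> tame del b (c e).
    by move=> _ a /cz ->; rewrite normr0 ltW.
  by apply: hb => //; exact: openT.
have nb : nbhs (0 : 'rV[R]_k) [set y | forall a, del a = 0%N -> `|c (phi y) 0 a| <= b].
  have h : nbhs (0 : 'rV[R]_k) [set y | ball ((c \o phi) 0) b ((c \o phi) y)].
    exact: (cc 0 _ (nbhsx_ballx _ _ b0)).
  apply: filterS h => y; rewrite -ball_normE /= => h a da.
  have := normr_coord (c (phi 0) - c (phi y)) a; rewrite !mxE c0 // sub0r normrN.
  by move=> /le_trans; apply; exact: ltW.
move/nbhs_ballP: nb => [r /= r0 hr].
pose B := [set y : 'rV[R]_k | `|y| < r]; pose T := psi @^-1` B.
have oB : open B.
  have -> : B = ball (0 : 'rV[R]_k) r.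
    by apply/seteqP; split=> y; rewrite -ball_normE /B /= sub0r normrN.
  exact: ball_open.
have oT : open T by move/continuousP: cpsi; exact.
have ct e : T e -> tame del b (c e).
  move=> Te a da; rewrite -(psiK e).
  by apply: hr => //; rewrite -ball_normE /= sub0r normrN.
have [h1 h2] := hb E (phi 0) c T oT cE ct t0.
exists T; split=> //.
  by apply: open_nbhs_nbhs; split=> //; rewrite /T /= phiK /B /= normr0.
have -> : T = [set phi y | y in B].
  apply/seteqP; split=> e; first by move=> Te; exists (psi e).
  by move=> [y By <-]; rewrite /T /= phiK.
apply: connected_continuous_connected; first exact: ball0_connected.
exact: continuous_subspaceT.
Qed.

End Deformation.

(** * Weighted degrees *)

(** With integer weights the dilations are polynomial in [l ^ (1 / q)], and
    homogeneity becomes a statement about powers with natural exponents. *)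
Lemma common_denominator (I : finType) (w : I -> rat) : (forall i, 0 < w i) ->
  exists (q : nat) (W : I -> nat),
    [/\ (0 < q)%N, forall i, (0 < W i)%N & forall i, (W i)%:R = q%:R * w i].
Proof.
move=> w0; pose b i := `|denq (w i)|%N; pose a i := `|numq (w i)|%N.
have b0 i : (0 < b i)%N by rewrite /b absz_gt0 denq_neq0.
have a0 i : (0 < a i)%N by rewrite /a absz_gt0 gt_eqF // numq_gt0.
have wE i : (b i)%:R * w i = (a i)%:R.
  rewrite -[in LHS](divq_num_den (w i)) /a /b !natr_absz.
  rewrite gtr0_norm ?denq_gt0 // gtr0_norm ?numq_gt0 //.
  by rewrite mulrC divfK // intr_eq0 denq_neq0.
exists (\prod_i b i)%N, (fun i => a i * \prod_(j | j != i) b j)%N; split.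
- by rewrite prodn_gt0.
- by move=> i; rewrite muln_gt0 a0 prodn_gt0.
by move=> i; rewrite [in RHS](bigD1 i) //= !natrM -wE; ring.
Qed.

Lemma integer_weights n p (w : 'I_n -> rat) (d : 'I_p -> rat) :
  (forall i, 0 < w i) -> (forall j, 0 < d j) ->
  exists q (W : 'I_n -> nat) (D : 'I_p -> nat), [/\ (0 < q)%N,
    (forall i, (0 < W i)%N) /\ (forall i, (W i)%:R = q%:R * w i) &
    (forall j, (0 < D j)%N) /\ (forall j, (D j)%:R = q%:R * d j)].
Proof.
move=> w0 d0; have [|q [W [q0 W0 WE]]] := @common_denominator ('I_n + 'I_p)%type
  (fun i => match i with inl i => w i | inr j => d j end).
  by case.
exists q, (fun i => W (inl i)), (fun j => W (inr j)); split=> //.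
Qed.

Lemma common_multiple n (W : 'I_n -> nat) : (forall i, (0 < W i)%N) ->
  exists M, exists2 m : 'I_n -> nat, (0 < M)%N & forall i, (m i * W i = M)%N.
Proof.
move=> W0; exists (\prod_i W i)%N, (fun i => \prod_(j | j != i) W j)%N.
  by rewrite prodn_gt0.
by move=> i; rewrite [RHS](bigD1 i) //= mulnC.
Qed.

Section WeightedDegree.
Variables (R : realType) (N : nat).
Implicit Types (w : 'I_N -> rat) (W : 'I_N -> nat).

Lemma powR_ratr (t : R) q (r : rat) k : 0 < t -> k%:R = q%:R * r ->
  (t ^+ q) `^ ratr r = t ^+ k.
Proof.
move=> t0 h; rewrite -(powR_mulrn q (ltW t0)) -powRrM -(ratr_nat R q) -rmorphM.
by rewrite /= -h ratr_nat powR_mulrn // ltW.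
Qed.

Definition wsize W (a : multinom N) : nat := (\sum_i W i * a i)%N.

Lemma wsizeE q w W a : (forall i, (W i)%:R = q%:R * w i) ->
  (wsize W a)%:R = q%:R * wdot w a.
Proof.
move=> hW; rewrite /wsize natr_sum /wdot mulr_sumr; apply: eq_bigr => i _.
by rewrite natrM hW mulrA.
Qed.

Lemma pe_monom (a : multinom N) (x : 'rV[R]_N) : pe (mpolyX R a) x = monom a x.
Proof. exact: mevalX. Qed.

Lemma monom_wscale W (a : multinom N) t (x : 'rV[R]_N) :
  monom a (wscale W t x) = t ^+ wsize W a * monom a x.
Proof.
rewrite /wsize /monom -prodrXr -big_split /=; apply: eq_bigr => i _.
by rewrite mxE exprMn exprM.
Qed.

Lemma whomogX W (a : multinom N) : whomog W (wsize W a) (mpolyX R a).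
Proof. by move=> t x t0; rewrite !pe_monom monom_wscale. Qed.

End WeightedDegree.

Section Support.
Variables (K : nzRingType) (m n : nat) (expo : multinom m -> multinom n).
Variable w : 'I_n -> rat.
Implicit Types g : mpoly m K.

Lemma wdeg_supp g a : mcoeff a g != 0 -> (wdeg expo w g <= (wdot w (expo a))%:E)%E.
Proof.
rewrite -mcoeff_msupp /wdeg /supp big_map; elim: (msupp g) => // b s ih.
rewrite inE big_cons => /predU1P[->|/ih h]; first by rewrite ge_min lexx.
by rewrite ge_min h orbT.
Qed.

Lemma wdot_ge (d : rat) g a : (d%:E <= wdeg expo w g)%E -> mcoeff a g != 0 ->
  d <= wdot w (expo a).
Proof. by move=> h /wdeg_supp /(le_trans h); rewrite lee_fin. Qed.

Lemma wdot_gt (d : rat) g a : (d%:E < wdeg expo w g)%E -> mcoeff a g != 0 ->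
  d < wdot w (expo a).
Proof. by move=> h /wdeg_supp /(lt_le_trans h); rewrite lte_fin. Qed.

Lemma mcoeffB_neq0 g h k a : mcoeff a (g - k) != 0 ->
  mcoeff a (g - h) != 0 \/ mcoeff a (h - k) != 0.
Proof.
have -> : mcoeff a (g - k) = mcoeff a (g - h) + mcoeff a (h - k).
  by rewrite -mcoeffD subrKA.
by have [->|h0 _] := eqVneq (mcoeff a (g - h)) 0; [rewrite add0r; right|left].
Qed.

Lemma mcoeff_winit_eq0 g a : mcoeff a g = 0 -> mcoeff a (winit expo w g) = 0.
Proof.
move=> ga; rewrite /winit raddf_sum big1 // => b _ /=.
by rewrite mcoeffZ mcoeffX; case: eqP => [->|_]; rewrite ?ga ?mul0r ?mulr0.
Qed.

Lemma msize_le g B : (forall a, (B <= mdeg a)%N -> mcoeff a g = 0) ->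
  (msize g <= B)%N.
Proof.
move=> h; rewrite msizeE; apply/bigmax_leqP_seq => a ag _.
by rewrite ltnNge; apply: contraL ag => /h e; rewrite -mcoeff_eq0 e.
Qed.

End Support.

Lemma continuous_row (R : realType) (T : topologicalType) n (f : T -> 'rV[R]_n) :
  (forall i, continuous (fun x => f x 0 i)) -> continuous f.
Proof.
move=> cf x U nU.
have h : cts_on setT f by apply: cts_on_row => i; apply: cts_on_continuous; exact: cf.
by apply: filterS (h x I U nU) => z /(_ I).
Qed.

(** * Real deformations *)

Section IndexedSum.

Lemma sum_enum_val (I : finType) (V : nmodType) (F : I -> V) :
  \sum_(a < #|I|) F (enum_val a) = \sum_i F i.
Proof. by rewrite -big_enum_val. Qed.

End IndexedSum.

Section RealCase.
Variables (R : realType) (n p : nat) (w : 'I_n -> rat) (d : 'I_p -> rat).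
Variables (f : 'I_p -> mpoly n R) (F : R -> 'I_p -> mpoly n R).
Let fw := fun j => real_winit w (f j).
Let G := fun e : R => real_map (F e).

(** The terms of degree less than [d j] are absent from [F e j - fw j], and
    those of degree [d j] vanish at [e = 0].  The degrees that occur are bounded
    by [analytic_finite_support], which leaves finitely many coefficients. *)
Theorem real_case : real_deformation f F -> SWH w d f ->
  (forall j e, ((d j)%:E <= real_wdeg w (F e j - f j)%R)%E) ->
  (exists T : set R,
     [/\ nbhs 0 T, connected T,
         link_constant 0 G T &
         sing_set (real_map fw) = [set 0] ->
         topologically_trivial 0 G T]) /\
  ((forall j e, ((d j)%:E < real_wdeg w (F e j - f j)%R)%E) ->
     link_constant 0 G setT /\
     (sing_set (real_map fw) = [set 0] ->
      topologically_trivial 0 G setT)).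
Proof.
move=> [F0 _ Fan] [[_ w0 d0 hWH] hsing hfd] hFd.
have [q [W [D [q0 [W0 WE] [D0 DE]]]]] := integer_weights w0 d0.
have qr : 0 < q%:R :> rat by rewrite ltr0n.
have DleW j a : (D j <= wsize W a)%N = (d j <= wdot w a).
  by rewrite -(ler_nat rat) DE (wsizeE _ WE) ler_pM2l.
have DltW j a : (D j < wsize W a)%N = (d j < wdot w a).
  by rewrite -(ltr_nat rat) DE (wsizeE _ WE) ltr_pM2l.
have [M [m M0 mW]] := common_multiple W0.
have [B hB] : exists B, forall j a e, (B <= mdeg a)%N -> mcoeff a (F e j) = 0.
  have [|e|B hB] := @analytic_finite_support R 1 ('I_p * multinom n)%type
    (fun ja => mdeg ja.2) (fun ja (e : 'rV[R]_1) => mcoeff ja.2 (F (e 0 0) ja.1)).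
  - by move=> [j a]; exact: Fan.
  - exists (\max_j msize (F (e 0%R 0%R) j)) => -[j a] /= le.
    apply: memN_msupp_eq0; apply: contraL le => /msize_mdeg_lt lt.
    by rewrite -ltnNge (leq_trans lt) // (leq_bigmax j).
  exists B => j a e le; have := hB (j, a) le (const_mx e).
  by rewrite mxE.
have hfw j : whomog W (D j) (fw j).
  move=> t x t0; have := hWH (t ^+ q) x j (exprn_gt0 q t0); rewrite !mxE.
  rewrite (powR_ratr t0 (DE j)) => h; rewrite /pe -[RHS]h; congr meval.
  by apply/funext => i; rewrite !mxE (powR_ratr t0 (WE i)).
have fw_iso (x : 'rV[R]_n) : x != 0 -> (forall j, pe (fw j) x = 0) -> regular fw x.
  move=> x0 fx; apply: contrapT => /sing_setP sx.
  have : (sing_set (real_map fw) `&` zero_set (real_map fw)) x.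
    by split=> //; apply/zero_setP.
  by rewrite hsing => /= xz; rewrite xz eqxx in x0.
pose I : finType := ('I_p * bmultinom n B)%type.
pose ix (a : 'I_#|I|) : I := enum_val a.
pose c (e : R) : 'rV[R]_#|I| := \row_a mcoeff (bmnm (ix a).2) (F e (ix a).1 - fw (ix a).1).
pose mm (a : 'I_#|I|) j : mpoly n R :=
  if ((ix a).1 == j) && (D j <= wsize W (bmnm (ix a).2))%N then mpolyX R (bmnm (ix a).2) else 0.
pose del (a : 'I_#|I|) := (wsize W (bmnm (ix a).2) - D (ix a).1)%N.
have hmm a j : whomog W (D j + del a) (mm a j).
  rewrite /mm /del; case: ifP => [/andP[/eqP <- le]|_].
    by rewrite subnKC //; exact: whomogX.
  by move=> t x _; rewrite !pe0 mulr0.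
have coef_le e j a : mcoeff a (F e j - fw j) != 0 -> (D j <= wsize W a)%N.
  move=> /(mcoeffB_neq0 (f j))[h|h]; rewrite DleW.
    exact: (wdot_ge (hFd j e) h).
  exact: ltW (wdot_gt (hfd j) h).
have gpE e j : gp fw mm (c e) j = F e j.
  rewrite /gp -[RHS](subrK (fw j)) addrC; congr (_ + _).
  have sz : (msize (F e j - fw j) <= B)%N.
    apply: msize_le => a Ba; rewrite mcoeffB hB // mcoeff_winit_eq0 ?subr0 //.
    by rewrite -F0 hB.
  rewrite [RHS](mpolywE sz).
  rewrite (eq_bigr (fun a : 'I_#|I| => (fun i : I => mcoeff (bmnm i.2) (F e i.1 - fw i.1) *:
    (if (i.1 == j) && (D j <= wsize W (bmnm i.2))%N then mpolyX R (bmnm i.2) else 0)) (ix a))).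
    2: by move=> a _; rewrite mxE.
  rewrite (sum_enum_val (fun i : I => mcoeff (bmnm i.2) (F e i.1 - fw i.1) *:
    (if (i.1 == j) && (D j <= wsize W (bmnm i.2))%N then mpolyX R (bmnm i.2) else 0))).
  rewrite -(pair_big xpredT xpredT (fun i b => mcoeff (bmnm b) (F e i - fw i) *:
    (if (i == j) && (D j <= wsize W (bmnm b))%N then mpolyX R (bmnm b) else 0))) /=.
  rewrite (bigD1 j) //= [X in _ + X]big1 ?addr0 => [|i ij]; last first.
    by rewrite big1 // => b _; rewrite (negbTE ij) scaler0.
  apply: eq_bigr => b _; rewrite eqxx /=; case: ifP => // /negbT le.
  have [->|/coef_le] := eqVneq (mcoeff (bmnm b) (F e j - fw j)) 0; first by rewrite !scale0r.
  by rewrite (negbTE le).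
have GE : G = fun e => real_map (gp fw mm (c e)).
  by apply/funext => e; congr real_map; apply/funext => j; rewrite gpE.
have c_cts : continuous (c \o (fun y : 'rV[R]_1 => y 0 0)).
  apply: continuous_row => a.
  have -> : (fun y : 'rV[R]_1 => (c \o (fun y : 'rV[R]_1 => y 0 0)) y 0 a) =
      fun y => mcoeff (bmnm (ix a).2) (F (y 0 0) (ix a).1) - mcoeff (bmnm (ix a).2) (fw (ix a).1).
    by apply/funext => y; rewrite /= mxE mcoeffB.
  move=> y; apply: (@continuousB _ R^o); last exact: cst_continuous.
  exact: (analytic_continuous (Fan _ _)).
have phi_cts : continuous (fun y : 'rV[R]_1 => y 0 0) by exact: coord_continuous.
have psi_cts : continuous (fun e : R => const_mx e : 'rV[R]_1).
  apply: (@lip_continuous _ _ _ _ 1) => x y; rewrite mul1r.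
  by apply: normr_row_le => // i; rewrite !mxE.
have phiK : cancel (fun y : 'rV[R]_1 => y 0 0) (fun e : R => const_mx e).
  by move=> y; apply/rowP => i; rewrite mxE ord1.
have psiK : cancel (fun e : R => const_mx e) (fun y : 'rV[R]_1 => y 0 0).
  by move=> e; rewrite mxE.
have c00 a : del a = 0%N -> c ((0 : 'rV[R]_1) 0 0) 0 a = 0.
  move=> da; rewrite !mxE F0; apply/eqP; apply: contraT => /(wdot_gt (hfd _)).
  by rewrite -DltW -subn_gt0 -/(del a) da.
have [h1 h2] := parametrized_deformation M0 mW D0 hfw hmm fw_iso
  phi_cts psi_cts phiK psiK c_cts c00.
have sub : sing_set (real_map fw) = [set 0] -> forall x : 'rV[R]_n, x != 0 -> regular fw x.
  move=> hs x x0; apply: contrapT => /sing_setP; rewrite hs => /= xz.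
  by rewrite xz eqxx in x0.
rewrite !mxE in h1 h2; rewrite GE; split.
  by have [T [nT cT lT tT]] := h1; exists T; split=> // /sub.
move=> hs; have [|lT tT] := h2; last by split=> // /sub.
move=> e a da; rewrite mxE; apply/eqP; apply: contraT => /(mcoeffB_neq0 (f (ix a).1)).
by case=> [/(wdot_gt (hs _ _))|/(wdot_gt (hfd _))]; rewrite -DltW -subn_gt0 -/(del a) da.
Qed.

End RealCase.

(** * Mixed deformations *)

Local Open Scope complex_scope.

Section Realify.
Variables (R : realType) (n : nat).
Implicit Types (g : mpoly (n + n) R[i]) (x : 'rV[R]_(n + n)).

Lemma cReD (x y : R[i]) : complex.Re (x + y) = complex.Re x + complex.Re y.
Proof. by case: x; case: y. Qed.

Lemma cImD (x y : R[i]) : complex.Im (x + y) = complex.Im x + complex.Im y.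
Proof. by case: x; case: y. Qed.

Lemma cRe_sum (J : Type) (s : seq J) (F : J -> R[i]) :
  complex.Re (\sum_(j <- s) F j) = \sum_(j <- s) complex.Re (F j).
Proof. by elim: s => [|j s ih]; rewrite ?big_nil ?big_cons ?cReD ?ih. Qed.

Lemma cIm_sum (J : Type) (s : seq J) (F : J -> R[i]) :
  complex.Im (\sum_(j <- s) F j) = \sum_(j <- s) complex.Im (F j).
Proof. by elim: s => [|j s ih]; rewrite ?big_nil ?big_cons ?cImD ?ih. Qed.

Lemma cReM (x y : R[i]) : complex.Re (x * y) =
  complex.Re x * complex.Re y - complex.Im x * complex.Im y.
Proof. by case: x; case: y. Qed.

Lemma cImM (x y : R[i]) : complex.Im (x * y) =
  complex.Re x * complex.Im y + complex.Im x * complex.Re y.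
Proof. by case: x => a b; case: y. Qed.

Definition mixed_var x (i : 'I_(n + n)) : R[i] := match fintype.split i with
  | inl k => cplx_row x 0 k
  | inr k => (cplx_row x 0 k)^*
  end.

Definition mixed_eval g x : R[i] := meval (mixed_var x) g.

(** Real and imaginary parts of a mixed polynomial are real polynomials. *)
Lemma realify g : exists AB : mpoly (n + n) R * mpoly (n + n) R,
  forall x, mixed_eval g x = pe AB.1 x +i* pe AB.2 x.
Proof.
rewrite /mixed_eval; elim/mpoly_ring_ind: g => [c|i|g h [A hA] [B hB]|g h [A hA] [B hB]].
- exists (mpolyC _ (complex.Re c), mpolyC _ (complex.Im c)) => x /=.
  by rewrite mevalC !peC; case: c.
- case E : (fintype.split i) => [k|k].
    exists (mpolyX R (mnm1 (lshift n k)), mpolyX R (mnm1 (rshift n k))) => x /=.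
    by rewrite mevalXU /mixed_var E !peX mxE.
  exists (mpolyX R (mnm1 (lshift n k)), -1 *: mpolyX R (mnm1 (rshift n k))) => x /=.
  by rewrite mevalXU /mixed_var E peZ !peX mxE mulN1r.
- exists (A.1 + B.1, A.2 + B.2) => x /=.
  by rewrite mevalD hA hB !peD.
exists (A.1 * B.1 - A.2 * B.2, A.1 * B.2 + A.2 * B.1) => x /=.
rewrite mevalM hA hB -(scaleN1r (A.2 * B.2)) !peD peZ !peM mulN1r.
by [].
Qed.

Variable W : 'I_n -> nat.

Definition double_weight (i : 'I_(n + n)) : nat :=
  match fintype.split i with inl k => W k | inr k => W k end.

Lemma mixed_var_scale t x i : mixed_var (wscale double_weight t x) i =
  (t ^+ double_weight i)%:C * mixed_var x i.
Proof.
rewrite /mixed_var /double_weight; case: fintype.split => k; rewrite !mxE.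
  rewrite /double_weight -/(unsplit (inl k)) -/(unsplit (inr k)) !unsplitK.
  by apply/eqP; rewrite eq_complex /= !mul0r subr0 addr0 !eqxx.
rewrite /double_weight -/(unsplit (inl k)) -/(unsplit (inr k)) !unsplitK.
by apply/eqP; rewrite eq_complex /= !mul0r subr0 addr0 mulrN !eqxx.
Qed.

Lemma mixed_monom_scale b t x :
  mixed_eval (mpolyX _ b) (wscale double_weight t x) =
  (t ^+ wsize W (mixed_expo b))%:C * mixed_eval (mpolyX _ b) x.
Proof.
have -> : wsize W (mixed_expo b) = (\sum_i double_weight i * b i)%N.
  rewrite big_split_ord /= -big_split /=; apply: eq_bigr => k _.
  rewrite /double_weight -/(unsplit (inl k)) -/(unsplit (inr k)) !unsplitK.
  by rewrite mnm_tnth tnth_mktuple mulnDr.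
rewrite /mixed_eval !mevalX -prodrXr rmorph_prod -big_split /=.
apply: eq_bigr => i _; rewrite mixed_var_scale exprMn exprM; congr (_ * _).
by rewrite [RHS]rmorphXn.
Qed.

Lemma whomog_realify g (A B : mpoly (n + n) R) k :
  (forall x, mixed_eval g x = pe A x +i* pe B x) ->
  (forall t x, 0 < t -> mixed_eval g (wscale double_weight t x) =
     (t ^+ k)%:C * mixed_eval g x) ->
  whomog double_weight k A /\ whomog double_weight k B.
Proof.
move=> hg hs; split=> t x t0; have := hs t x t0; rewrite !hg.
  by case; rewrite mul0r subr0.
by case=> _; rewrite mul0r addr0.
Qed.

Lemma mixed_mapE p (g : 'I_p -> mpoly (n + n) R[i]) x j :
  mixed_map g (cplx_row x) 0 j = mixed_eval (g j) x.
Proof. by rewrite mxE. Qed.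

End Realify.

Section ComplexParameter.
Variable R : realType.

Lemma normc_le (z : R[i]) : `|z| <= (`|complex.Re z| + `|complex.Im z|)%:C.
Proof.
rewrite {1}(complexE z); apply: le_trans (ler_normD _ _) _.
rewrite rmorphD lerD //=; first by rewrite normc_def /= expr0n addr0 sqrtr_sqr.
by rewrite normrM normc_def /= expr0n add0r expr1n sqrtr1 mul1r normc_def /= expr0n addr0 sqrtr_sqr.
Qed.

Lemma normc_ge_Im (z : R[i]) : `|complex.Im z|%:C <= `|z|.
Proof.
rewrite normc_def lecR -sqrtr_sqr ler_wsqrtr // lerDr; exact: sqr_ge0.
Qed.

Definition cplx_param (y : 'rV[R]_(1 + 1)) : R[i]^o := cplx_row y 0 0.

Definition real_param (z : R[i]^o) : 'rV[R]_(1 + 1) := real_row (const_mx z : 'rV[R[i]]_1).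

Lemma cplx_paramK : cancel cplx_param real_param.
Proof.
move=> y; apply/rowP => i; rewrite /real_param /real_row mxE.
case: fintype.splitP => k ik; rewrite !mxE /cplx_param mxE /=; congr (y _ _);
  by apply: val_inj; rewrite /= ik (ord1 k).
Qed.

Lemma real_paramK : cancel real_param cplx_param.
Proof.
move=> z; rewrite /cplx_param /real_param /real_row mxE row_mxEl row_mxEr !mxE.
by case: z.
Qed.

Lemma cplx_param_continuous : continuous cplx_param.
Proof.
move=> y U /nbhs_ballP[[e1 e2] /=]; rewrite ltcE /= => /andP[/eqP e20 e10] eU.
apply/nbhs_ballP; exists (e1 / 2); first by rewrite /= divr_gt0.
move=> y'; rewrite -ball_normE /= => yy; apply: eU; rewrite -ball_normE /=.
apply: le_lt_trans (normc_le _) _; rewrite ltcE /= e20 eqxx /=.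
have h i : `|y 0 i - y' 0 i| < e1 / 2.
  have := normr_coord (y - y') i; rewrite !mxE => h; exact: le_lt_trans h yy.
have := h (lshift 1 0); have := h (rshift 1 0).
rewrite /cplx_param !mxE /=; lra.
Qed.

Lemma real_param_continuous : continuous real_param.
Proof.
move=> z U /nbhs_ballP[e /= e0 eU]; apply/nbhs_ballP.
exists (e%:C); first by rewrite /= ltcR.
move=> z'; rewrite -ball_normE /= => zz; apply: eU; rewrite -ball_normE /=.
have e2 : 0 < e / 2 by rewrite divr_gt0.
have h1 : `|complex.Re (z - z')| < e.
  by rewrite -ltcR; apply: le_lt_trans (normc_ge_Re _) zz.
have h2 : `|complex.Im (z - z')| < e.
  by rewrite -ltcR; apply: le_lt_trans (normc_ge_Im _) zz.
apply: (@le_lt_trans _ _ (Num.max `|complex.Re (z - z')| `|complex.Im (z - z')|)).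
  apply: normr_row_le => [|i]; first by rewrite le_max normr_ge0.
  rewrite le_max /real_param /real_row !mxE.
  case: (fintype.split i) => k; rewrite !mxE; apply/orP; [left|right];
    by case: (z) => ? ?; case: (z').
by rewrite gt_max h1.
Qed.

End ComplexParameter.

Section MixedCase.
Variables (R : realType) (n p : nat) (w : 'I_n -> rat) (d : 'I_p -> rat).
Variables (f : 'I_p -> mpoly (n + n) R[i]) (F : R[i] -> 'I_p -> mpoly (n + n) R[i]).
Let fw := fun j => mixed_winit w (f j).
Let G := fun e : R[i]^o => mixed_real_map (F e).

(** The real and imaginary parts of the coefficients are real parameters, and
    each of them multiplies the real and imaginary parts of a mixed monomial;
    a variable and its two real coordinates have the same weight. *)
Theorem mixed_case : mixed_deformation f F -> SRWH w d f ->
  (forall j e, ((d j)%:E <= mixed_wdeg w (F e j - f j)%R)%E) ->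
  (exists T : set R[i]^o,
     [/\ nbhs 0 T, connected T,
         link_constant 0 G T &
         sing_set (mixed_real_map fw) = [set 0] ->
         topologically_trivial 0 G T]) /\
  ((forall j e, ((d j)%:E < mixed_wdeg w (F e j - f j)%R)%E) ->
     link_constant 0 G setT /\
     (sing_set (mixed_real_map fw) = [set 0] ->
      topologically_trivial 0 G setT)).
Proof.
move=> [F0 _ Fan] [[_ w0 d0 hWH] hsing hfd] hFd.
have [q [W [D [q0 [W0 WE] [D0 DE]]]]] := integer_weights w0 d0.
have qr : 0 < q%:R :> rat by rewrite ltr0n.
pose ws (b : multinom (n + n)) := wsize W (mixed_expo b).
have DleW j b : (D j <= ws b)%N = (d j <= wdot w (mixed_expo b)).
  by rewrite -(ler_nat rat) DE (wsizeE _ WE) ler_pM2l.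
have DltW j b : (D j < ws b)%N = (d j < wdot w (mixed_expo b)).
  by rewrite -(ltr_nat rat) DE (wsizeE _ WE) ltr_pM2l.
pose W2 := double_weight W; pose D2 := double_weight D.
have W20 i : (0 < W2 i)%N by rewrite /W2 /double_weight; case: fintype.split.
have D20 i : (0 < D2 i)%N by rewrite /D2 /double_weight; case: fintype.split.
have [M [m M0 mW]] := common_multiple W20.
have [B hB] : exists B, forall j a e, (B <= mdeg a)%N -> mcoeff a (F e j) = 0.
  pose u (ja : 'I_p * multinom (n + n) * bool) (y : 'rV[R]_(1 + 1)) : R :=
    let z := mcoeff ja.1.2 (F (cplx_row y 0 0) ja.1.1) in
    if ja.2 then complex.Re z else complex.Im z.
  have [|y|B hB] := @analytic_finite_support R (1 + 1) _ (fun ja => mdeg ja.1.2) u.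
  - by move=> [[j a] []]; rewrite /u /=; have [] := Fan j a.
  - exists (\max_j msize (F (cplx_row y 0%R 0%R) j)) => -[[j a] b] /= le.
    rewrite /u /= memN_msupp_eq0; first by case: b.
    apply: contraL le => /msize_mdeg_lt lt.
    by rewrite -ltnNge (leq_trans lt) // (leq_bigmax j).
  exists B => j a e le; have h b := hB (j, a, b) le (real_param e).
  have := h true; have := h false.
  rewrite /u /= -/(cplx_param _) real_paramK; case: (mcoeff a _) => x y /= -> ->.
  by [].
have /choice[rl hrl] := @realify R n.
pose fwr (j : 'I_(p + p)) := match fintype.split j with
  | inl k => (rl (fw k)).1 | inr k => (rl (fw k)).2 end.
have fwrE : mixed_real_map fw = real_map fwr.
  apply/funext => x; apply/rowP => j; rewrite /mixed_real_map /real_row [LHS]mxE [RHS]mxE.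
  by rewrite /fwr; case: fintype.split => k; rewrite mxE mixed_mapE hrl.
have hom_fw k : whomog W2 (D k) (rl (fw k)).1 /\ whomog W2 (D k) (rl (fw k)).2.
  apply: (@whomog_realify _ _ W (fw k)); first exact: hrl.
  move=> t x t0; have := hWH (t ^+ q) (cplx_row x) k (exprn_gt0 q t0).
  rewrite (powR_ratr t0 (DE k)) -mixed_mapE -[mixed_eval _ x](mixed_mapE fw x k) => <-.
  rewrite /mixed_map !mxE; congr meval; apply/funext => i.
  rewrite -/(mixed_var (wscale (double_weight W) t x) i) mixed_var_scale /double_weight /mixed_var.
  case: fintype.split => l; rewrite !mxE (powR_ratr t0 (WE l)) //.
  by rewrite rmorphM /= oppr0.
have hfw j : whomog W2 (D2 j) (fwr j).
  by rewrite /fwr /D2 /double_weight; case: fintype.split => k; have [] := hom_fw k.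
have fw_iso (x : 'rV[R]_(n + n)) : x != 0 -> (forall j, pe (fwr j) x = 0) -> regular fwr x.
  move=> x0 fx; apply: contrapT => /sing_setP sx.
  have : (sing_set (real_map fwr) `&` zero_set (real_map fwr)) x.
    by split=> //; apply/zero_setP.
  by rewrite -fwrE hsing => /= xz; rewrite xz eqxx in x0.
pose I : finType := ('I_p * bmultinom (n + n) B * bool)%type.
pose mn (i : I) : multinom (n + n) := bmnm i.1.2.
pose cf (e : R[i]) (i : I) : R := let z := mcoeff (mn i) (F e i.1.1 - fw i.1.1) in
  if i.2 then complex.Re z else complex.Im z.
pose mmI (i : I) (j : 'I_(p + p)) : mpoly (n + n) R := match fintype.split j with
  | inl k => if (i.1.1 == k) && (D k <= ws (mn i))%N then
      (if i.2 then (rl (mpolyX _ (mn i))).1 else -1 *: (rl (mpolyX _ (mn i))).2) else 0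
  | inr k => if (i.1.1 == k) && (D k <= ws (mn i))%N then
      (if i.2 then (rl (mpolyX _ (mn i))).2 else (rl (mpolyX _ (mn i))).1) else 0
  end.
pose ix (a : 'I_#|I|) : I := enum_val a.
pose c (e : R[i]^o) : 'rV[R]_#|I| := \row_a cf e (ix a).
pose mm (a : 'I_#|I|) := mmI (ix a).
pose del (a : 'I_#|I|) := (ws (mn (ix a)) - D (ix a).1.1)%N.
have hom_mon b : whomog W2 (ws b) (rl (mpolyX _ b)).1 /\ whomog W2 (ws b) (rl (mpolyX _ b)).2.
  apply: (@whomog_realify _ _ W (mpolyX _ b)); first exact: hrl.
  by move=> t x _; exact: mixed_monom_scale.
have hmm a j : whomog W2 (D2 j + del a) (mm a j).
  have h0 k : whomog W2 k (0 : mpoly (n + n) R) by move=> t x _; rewrite !pe0 mulr0.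
  have [h1 h2] := hom_mon (mn (ix a)).
  rewrite /mm /mmI /D2 /double_weight /del; case: fintype.split => k; case: ifP => // /andP[/eqP ->].
    move=> /subnKC ->; case: ifP => // _ t x t0.
    by rewrite !peZ h2 // mulrCA.
  by move=> /subnKC ->; case: ifP.
have coef_le e j b : mcoeff b (F e j - fw j) != 0 -> (D j <= ws b)%N.
  move=> /(mcoeffB_neq0 (f j))[h|h]; rewrite DleW.
    exact: (wdot_ge (hFd j e) h).
  exact: ltW (wdot_gt (hfd j) h).
have evE e k x : mixed_eval (F e k) x = mixed_eval (fw k) x +
    \sum_(b : bmultinom (n + n) B) (if (D k <= ws (bmnm b))%N then
      mcoeff (bmnm b) (F e k - fw k) * mixed_eval (mpolyX _ (bmnm b)) x else 0).
  rewrite -[in LHS](subrK (fw k) (F e k)) addrC /mixed_eval mevalD; congr (_ + _).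
  have sz : (msize (F e k - fw k) <= B)%N.
    apply: msize_le => a Ba; rewrite mcoeffB hB // mcoeff_winit_eq0 ?subr0 //.
    by rewrite -F0 hB.
  rewrite [in LHS](mpolywE sz) rmorph_sum; apply: eq_bigr => b _ /=.
  rewrite mevalZ; case: ifP => // /negbT le.
  have [->|/coef_le] := eqVneq (mcoeff (bmnm b) (F e k - fw k)) 0; first by rewrite mul0r.
  by rewrite (negbTE le).
have sumE e x j : \sum_a c e 0 a * pe (mm a j) x = \sum_(i : I) cf e i * pe (mmI i j) x.
  rewrite -(sum_enum_val (fun i : I => cf e i * pe (mmI i j) x)).
  by apply: eq_bigr => a _; rewrite mxE.
have sumI (H : I -> R) k : (forall i, i.1.1 != k -> H i = 0) ->
    \sum_i H i = \sum_b (H (k, b, true) + H (k, b, false)).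
  move=> h; have -> : \sum_i H i = \sum_j \sum_b \sum_s H (j, b, s).
    by rewrite pair_bigA pair_bigA /=; apply: eq_bigr => -[[]].
  rewrite (bigD1 k) //= [X in _ + X]big1 ?addr0 => [|j jk].
    by apply: eq_bigr => b _; rewrite big_bool.
  by rewrite big1 // => b _; rewrite big1 // => s _; exact: h.
have GE : G = fun e : R[i]^o => real_map (gp fwr mm (c e)).
  apply/funext => e; apply/funext => x; apply/rowP => j.
  rewrite /G /mixed_real_map /real_row [LHS]mxE [RHS]mxE -/(pe _ x) pe_gp sumE.
  rewrite /fwr /mmI; case: fintype.split => k; rewrite mxE mixed_mapE evE.
    rewrite cReD hrl cRe_sum (sumI _ k) => [|i /negbTE ik]; last by rewrite ik pe0 mulr0.
    congr (_ + _); apply: eq_bigr => b _; rewrite /cf /mn /= eqxx /=.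
    by case: ifP => _; rewrite ?pe0 ?mulr0 ?addr0 // cReM hrl /= peZ mulN1r mulrN.
  rewrite cImD hrl cIm_sum (sumI _ k) => [|i /negbTE ik]; last by rewrite ik pe0 mulr0.
  congr (_ + _); apply: eq_bigr => b _; rewrite /cf /mn /= eqxx /=.
  by case: ifP => _; rewrite ?pe0 ?mulr0 ?addr0 // cImM hrl.
have ReN (z : R[i]) : complex.Re (- z) = - complex.Re z by case: z.
have ImN (z : R[i]) : complex.Im (- z) = - complex.Im z by case: z.
have c_cts : continuous (c \o @cplx_param R).
  apply: continuous_row => a.
  pose z0 := mcoeff (mn (ix a)) (fw (ix a).1.1).
  have [h1 h2] := Fan (ix a).1.1 (mn (ix a)).
  case E : (ix a).2.
    have -> : (fun y => (c \o @cplx_param R) y 0 a) = fun y : 'rV[R]_(1 + 1) =>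
        complex.Re (mcoeff (mn (ix a)) (F (cplx_row y 0 0) (ix a).1.1)) - complex.Re z0.
      by apply/funext => y; rewrite /= mxE /cf E mcoeffB cReD ReN.
    move=> y; apply: (@continuousB _ R^o); last exact: cst_continuous.
    exact: (analytic_continuous h1).
  have -> : (fun y => (c \o @cplx_param R) y 0 a) = fun y : 'rV[R]_(1 + 1) =>
      complex.Im (mcoeff (mn (ix a)) (F (cplx_row y 0 0) (ix a).1.1)) - complex.Im z0.
    by apply/funext => y; rewrite /= mxE /cf E mcoeffB cImD ImN.
  move=> y; apply: (@continuousB _ R^o); last exact: cst_continuous.
  exact: (analytic_continuous h2).
have phi0 : cplx_param (0 : 'rV[R]_(1 + 1)) = 0.
  by rewrite /cplx_param mxE !mxE.
have c00 a : del a = 0%N -> c (cplx_param (0 : 'rV[R]_(1 + 1))) 0 a = 0.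
  move=> da; rewrite phi0 mxE /cf F0.
  have -> : mcoeff (mn (ix a)) (f (ix a).1.1 - fw (ix a).1.1) = 0.
    apply/eqP; apply: contraT => /(wdot_gt (hfd _)).
    by rewrite -DltW -subn_gt0 -/(del a) da.
  by case: ifP.
have [h1 h2] := parametrized_deformation M0 mW D20 hfw hmm fw_iso
  (@cplx_param_continuous R) (@real_param_continuous R) (@cplx_paramK R) (@real_paramK R)
  c_cts c00.
have sub : sing_set (mixed_real_map fw) = [set 0] ->
    forall x : 'rV[R]_(n + n), x != 0 -> regular fwr x.
  move=> hs x x0; apply: contrapT => /sing_setP; rewrite -fwrE hs => /= xz.
  by rewrite xz eqxx in x0.
rewrite phi0 in h1 h2; rewrite GE; split.
  by have [T [nT cT lT tT]] := h1; exists T; split=> // /sub.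
move=> hs; have [|lT tT] := h2; last by split=> // /sub.
move=> e a da; rewrite mxE /cf.
have -> : mcoeff (mn (ix a)) (F e (ix a).1.1 - fw (ix a).1.1) = 0.
  apply/eqP; apply: contraT => /(mcoeffB_neq0 (f (ix a).1.1)).
  by case=> [/(wdot_gt (hs _ _))|/(wdot_gt (hfd _))]; rewrite -DltW -subn_gt0 -/(del a) da.
by case: ifP.
Qed.

End MixedCase.



Theorem theorem4p11 (R : realType) (n p : nat)
    (w : 'I_n -> rat) (d : 'I_p -> rat) :
  (forall (f : 'I_p -> mpoly n R) (F : R -> 'I_p -> mpoly n R),
     let fw := fun j => real_winit w (f j) in
     let G := fun e : R => real_map (F e) in
     real_map f 0 = 0 ->
     real_deformation f F ->
     SWH w d f ->
     (forall j e, ((d j)%:E <= real_wdeg w (F e j - f j)%R)%E) ->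
     (exists T : set R,
        [/\ nbhs 0 T, connected T,
            link_constant 0 G T &
            sing_set (real_map fw) = [set 0] ->
            topologically_trivial 0 G T]) /\
     ((forall j e, ((d j)%:E < real_wdeg w (F e j - f j)%R)%E) ->
        link_constant 0 G setT /\
        (sing_set (real_map fw) = [set 0] ->
         topologically_trivial 0 G setT))) /\
  (forall (f : 'I_p -> mpoly (n + n) R[i])
          (F : R[i] -> 'I_p -> mpoly (n + n) R[i]),
     let fw := fun j => mixed_winit w (f j) in
     let G := fun e : R[i]^o => mixed_real_map (F e) in
     mixed_map f 0 = 0 ->
     mixed_deformation f F ->
     SRWH w d f ->
     (forall j e, ((d j)%:E <= mixed_wdeg w (F e j - f j)%R)%E) ->
     (exists T : set R[i]^o,
        [/\ nbhs 0 T, connected T,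
            link_constant 0 G T &
            sing_set (mixed_real_map fw) = [set 0] ->
            topologically_trivial 0 G T]) /\
     ((forall j e, ((d j)%:E < mixed_wdeg w (F e j - f j)%R)%E) ->
        link_constant 0 G setT /\
        (sing_set (mixed_real_map fw) = [set 0] ->
         topologically_trivial 0 G setT))).
Proof.
split=> f F fw G _; [exact: real_case|exact: mixed_case].
Qed.
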